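(* Let $K\subset\mathbb H^3$ be a compact convex set with nonempty interior and let $q\in\partial K$ be a normal point. Then there exist a real number $k=k(q)$ and a smooth surface $S_k$ of constant sectional curvature $k$ such that, for all sufficiently small $\epsilon>0$, the metric ball $B_\epsilon(q)\subset\partial K$ is biLipschitz equivalent to an open set $U_\epsilon\subset S_k$, with Lipschitz constants smaller than $1+o(\epsilon^2)$ as $\epsilon\to0$.
   Context: $\mathbb H^3$ is hyperbolic $3$-space of constant curvature $-1$. $\partial K$ is endowed with the intrinsic length metric induced by $\mathbb H^3$, $B_\epsilon(q)$ is the ball of radius $\epsilon$ for this metric, and $S_k$ carries its Riemannian distance. The Lipschitz constants are those of the biLipschitz homeomorphism and of its inverse. Normal points. A point $q\in\partial K$ is smooth if $K$ has a unique supporting totally geodesic plane at $q$; let $\nu_q$ be the exterior unit normal there. For a smooth $q$, identify $\mathbb H^3$ by an isometry with the upper half-space $\{(\mathbf x,z):\mathbf x\in\mathbb R^2,z>0\}$, with metric $z^{-2}(|d\mathbf x|^2+dz^2)$, so that $q=(\mathbf 0,1)$ and $\nu_q=-\partial_z$; near $q$, $\partial K$ is a graph $\{(\mathbf x,e^{-u_q(\mathbf x)}):|\mathbf x|<\epsilon_0\}$ for some $\epsilon_0>0$, where $u_q$ is horoconvex (i.e. $\mathbf x\mapsto e^{-2u_q(\mathbf x)}+|\mathbf x|^2$ is convex), $u_q(\mathbf 0)=0$ and $\nabla_{\mathbf 0} u_q=0$. The point $q$ is normal if it is smooth and $u_q$ is two times differentiable at $\mathbf 0$, i.e. there is a symmetric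 matrix $A$ with $u_q(\mathbf x)=\frac12\langle A\mathbf x,\mathbf x\rangle+o(|\mathbf x|^2)$ as $\mathbf x\to\mathbf 0$. *)

(* Defs.v *)
From Stdlib Require Import Reals List.
From Coquelicot Require Import Coquelicot.
Open Scope R_scope.

(* * Hyperbolic 3-space: the upper half-space model *)

(* Points (x, y, z) of H^3, and also tangent vectors; the topology is that of
   the product R * R * R, which induces the topology of H^3 on [H3]. *)
Definition E3 : Type := (R * R * R)%type.
Definition cx (p : E3) : R := fst (fst p).
Definition cy (p : E3) : R := snd (fst p).
Definition cz (p : E3) : R := snd p.

Definition H3 (p : E3) : Prop := 0 < cz p.

(* Distance of the metric z^-2 (dx^2 + dy^2 + dz^2):
   sinh (d/2) = |p - q| / (2 sqrt (z_p z_q)). *)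
Definition hdist (p q : E3) : R :=
  2 * arcsinh (sqrt ((cx p - cx q) ^ 2 + (cy p - cy q) ^ 2 + (cz p - cz q) ^ 2)
               / (2 * sqrt (cz p * cz q))).

Definition isometry_H3 (Phi : E3 -> E3) : Prop :=
  (forall p, H3 p -> H3 (Phi p)) /\
  (forall p q, H3 p -> H3 q -> hdist (Phi p) (Phi q) = hdist p q) /\
  (forall q, H3 q -> exists p, H3 p /\ Phi p = q).

Definition geodesic (l : R) (gam : R -> E3) : Prop :=
  (forall t, 0 <= t <= l -> H3 (gam t)) /\
  (forall s t, 0 <= s <= l -> 0 <= t <= l ->
     hdist (gam s) (gam t) = Rabs (s - t)).

Definition hconvex (K : E3 -> Prop) : Prop :=
  forall l gam, 0 <= l -> geodesic l gam -> K (gam 0) -> K (gam l) ->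
  forall t, 0 <= t <= l -> K (gam t).

Definition compact_set {T : UniformSpace} (K : T -> Prop) : Prop :=
  forall (I : Type) (U : I -> T -> Prop),
    (forall i, open (U i)) ->
    (forall p, K p -> exists i, U i p) ->
    exists l : list I, forall p, K p -> exists i, In i l /\ U i p.

Definition interior_pt (K : E3 -> Prop) (p : E3) : Prop := locally p K.

Definition bdry (K : E3 -> Prop) (p : E3) : Prop :=
  H3 p /\ ~ locally p K /\ ~ locally p (fun r => ~ K r).

(* * Intrinsic length metric of a subset *)

(* Length of a curve over [0, 1], as the supremum of the hyperbolic lengths of
   the inscribed polygons; only t 0, ..., t (n+1) matter in the sum. *)
Definition curve_length (gam : R -> E3) : Rbar :=
  Lub_Rbar (fun s => exists (n : nat) (t : nat -> R),
    0 <= t 0%nat /\ (forall i, t i <= t (S i)) /\ (forall i, t i <= 1) /\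
    s = sum_n (fun i => hdist (gam (t i)) (gam (t (S i)))) n).

(* Infimum over rectifiable curves in A; it is p_infty if there are none.
   Continuity of the curve on all of R is no restriction: a curve given on
   [0, 1] extends by constants. *)
Definition intrinsic_dist (A : E3 -> Prop) (p q : E3) : Rbar :=
  Glb_Rbar (fun l => exists gam : R -> E3,
    (forall t, continuous gam t) /\ (forall t, 0 <= t <= 1 -> A (gam t)) /\
    gam 0 = p /\ gam 1 = q /\ curve_length gam = Finite l).

Definition bdry_ball (K : E3 -> Prop) (q : E3) (eps : R) (p : E3) : Prop :=
  bdry K p /\ Rbar_lt (intrinsic_dist (bdry K) q p) (Finite eps).

(* * Supporting planes and normals *)

(* The totally geodesic planes are the traces on H^3 of the vertical planes
   and of the spheres centred on {z = 0}: the zero sets of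
   a |p|^2 + b x + c y + d with b^2 + c^2 - 4 a d > 0.  Such a function also
   selects one of the two sides of its plane, {plane_fun <= 0}. *)
Definition plane_fun (a b c d : R) (p : E3) : R :=
  a * (cx p ^ 2 + cy p ^ 2 + cz p ^ 2) + b * cx p + c * cy p + d.

Definition plane_grad (a b c d : R) (p : E3) : E3 :=
  (2 * a * cx p + b, 2 * a * cy p + c, 2 * a * cz p).

Definition supports (K : E3 -> Prop) (q : E3) (a b c d : R) : Prop :=
  0 < b ^ 2 + c ^ 2 - 4 * a * d /\
  plane_fun a b c d q = 0 /\
  (forall p, K p -> plane_fun a b c d p <= 0).

Definition supporting_plane (K : E3 -> Prop) (q : E3) (P : E3 -> Prop) : Prop :=
  exists a b c d, supports K q a b c d /\
    forall p, P p <-> H3 p /\ plane_fun a b c d p = 0.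

Definition smooth_pt (K : E3 -> Prop) (q : E3) : Prop :=
  exists P, supporting_plane K q P /\
    forall P', supporting_plane K q P' -> forall p, P' p <-> P p.

(* Norm of a tangent vector v at q for z^-2 (dx^2 + dy^2 + dz^2). *)
Definition hnorm (q v : E3) : R :=
  sqrt (cx v ^ 2 + cy v ^ 2 + cz v ^ 2) / cz q.

(* The metric is conformal to the Euclidean one, so the normal direction is
   that of the Euclidean gradient. *)
Definition exterior_unit_normal (K : E3 -> Prop) (q nu : E3) : Prop :=
  hnorm q nu = 1 /\
  exists a b c d lam, supports K q a b c d /\ 0 < lam /\
    cx nu = lam * cx (plane_grad a b c d q) /\
    cy nu = lam * cy (plane_grad a b c d q) /\
    cz nu = lam * cz (plane_grad a b c d q).

(* * Normal points *)

(* Phi is an isometry with Phi q = (0, 0, 1) whose differential at q maps the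
   exterior unit normal to - d/dz. *)
Definition normalizes (K : E3 -> Prop) (q : E3) (Phi : E3 -> E3) : Prop :=
  isometry_H3 Phi /\ Phi q = (0, 0, 1) /\
  exists nu, exterior_unit_normal K q nu /\
    exists dPhi : E3 -> E3,
      filterdiff Phi (locally (q : prod_UniformSpace _ _)) dPhi /\
      dPhi nu = (0, 0, -1).

Definition horoconvex (r : R) (u : R -> R -> R) : Prop :=
  let h x y := exp (- 2 * u x y) + (x ^ 2 + y ^ 2) in
  forall x y x' y' s,
    x ^ 2 + y ^ 2 < r ^ 2 -> x' ^ 2 + y' ^ 2 < r ^ 2 -> 0 <= s <= 1 ->
    h (s * x + (1 - s) * x') (s * y + (1 - s) * y')
      <= s * h x y + (1 - s) * h x' y'.

(* Near (0, 0, 1), A is the graph {(x, y, e^(-u x y)) : x^2 + y^2 < r^2}. *)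
Definition locally_graph (A : E3 -> Prop) (r : R) (u : R -> R -> R) : Prop :=
  exists W : E3 -> Prop, open W /\ W (0, 0, 1) /\
    forall p, (W p /\ A p) <->
      exists x y, x ^ 2 + y ^ 2 < r ^ 2 /\ p = (x, y, exp (- u x y)).

(* u = <A (x, y), (x, y)> / 2 + o(x^2 + y^2), A = ((a11, a12), (a12, a22)). *)
Definition twice_differentiable_at_0 (u : R -> R -> R) : Prop :=
  exists a11 a12 a22 : R,
    forall eta, 0 < eta -> exists del, 0 < del /\
      forall x y, x ^ 2 + y ^ 2 < del ^ 2 ->
        Rabs (u x y - / 2 * (a11 * x ^ 2 + 2 * a12 * x * y + a22 * y ^ 2))
          <= eta * (x ^ 2 + y ^ 2).

Definition normal_pt (K : E3 -> Prop) (q : E3) : Prop :=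
  smooth_pt K q /\
  exists (Phi : E3 -> E3) (r : R) (u : R -> R -> R),
    normalizes K q Phi /\
    0 < r /\
    locally_graph (fun p => exists p', bdry K p' /\ Phi p' = p) r u /\
    horoconvex r u /\
    u 0 0 = 0 /\
    differentiable_pt_lim u 0 0 0 0 /\
    twice_differentiable_at_0 u.

(* * Smooth Riemannian surfaces *)

Inductive axis := ax1 | ax2.

Definition sum_axis (f : axis -> R) : R := f ax1 + f ax2.

Definition partial (i : axis) (f : R -> R -> R) (x y : R) : R :=
  match i with
  | ax1 => Derive (fun t => f t y) x
  | ax2 => Derive (fun t => f x t) y
  end.

(* Meant for all (x, y) in an open set, where it says that f is C^infinity. *)
Definition smooth_2d (f : R -> R -> R) (x y : R) : Prop :=
  forall n, ex_diff_n f n x y.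

(* A sequence of local parametrizations by subsets of R^2 (possibly empty, so
   that every countable atlas is covered), with the components of the metric
   tensor in each of them. *)
Record surface := {
  carrier : Type;
  dom : nat -> R -> R -> Prop;
  par : nat -> R -> R -> carrier;
  metric : nat -> axis -> axis -> R -> R -> R
}.

Definition open_in (S : surface) (U : carrier S -> Prop) : Prop :=
  forall n x y, dom S n x y -> U (par S n x y) ->
    locally_2d (fun a b => U (par S n a b)) x y.

(* C^1 arcs in a chart, over [0, 1]; a C^1 function on [0, 1] extends to a C^1
   function on R. *)
Definition C1_arc (S : surface) (n : nat) (c : axis -> R -> R) : Prop :=
  (forall i t, ex_derive (c i) t /\ continuous (Derive (c i)) t) /\
  (forall t, 0 <= t <= 1 -> dom S n (c ax1 t) (c ax2 t)).

Definition arc_length (S : surface) (n : nat) (c : axis -> R -> R) : R :=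
  RInt (fun t => sqrt (sum_axis (fun i => sum_axis (fun j =>
          metric S n i j (c ax1 t) (c ax2 t) * Derive (c i) t * Derive (c j) t))))
       0 1.

(* There is a piecewise C^1 curve of length l from p to q. *)
Inductive curve_of_length (S : surface) : carrier S -> carrier S -> R -> Prop :=
| curve_nil p : curve_of_length S p p 0
| curve_cons n c q l :
    C1_arc S n c ->
    curve_of_length S (par S n (c ax1 1) (c ax2 1)) q l ->
    curve_of_length S (par S n (c ax1 0) (c ax2 0)) q (arc_length S n c + l).

Definition riemannian_dist (S : surface) (p q : carrier S) : Rbar :=
  Glb_Rbar (curve_of_length S p q).

Record smooth_riemannian_surface (S : surface) : Prop := {
  dom_open : forall n x y, dom S n x y -> locally_2d (dom S n) x y;
  par_inj : forall n x y x' y', dom S n x y -> dom S n x' y' ->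
    par S n x y = par S n x' y' -> x = x' /\ y = y';
  par_cover : forall p, exists n x y, dom S n x y /\ par S n x y = p;
  (* Overlaps are open; changes of coordinates tau are smooth, and they pull
     the metric of the chart m back to that of the chart n. *)
  compatible : forall n m x y x' y', dom S n x y -> dom S m x' y' ->
    par S n x y = par S m x' y' ->
    exists tau : axis -> R -> R -> R,
      locally_2d (fun a b =>
        dom S m (tau ax1 a b) (tau ax2 a b) /\
        par S m (tau ax1 a b) (tau ax2 a b) = par S n a b /\
        (forall i, smooth_2d (tau i) a b) /\
        (forall i j, metric S n i j a b =
           sum_axis (fun k => sum_axis (fun l =>
             metric S m k l (tau ax1 a b) (tau ax2 a b)
             * partial i (tau k) a b * partial j (tau l) a b)))) x y;
  hausdorff : forall p q : carrier S, p <> q ->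
    exists U V, open_in S U /\ open_in S V /\ U p /\ V q /\
      forall r, ~ (U r /\ V r);
  connected : forall p q, exists l, curve_of_length S p q l;
  metric_smooth : forall n i j x y, dom S n x y -> smooth_2d (metric S n i j) x y;
  metric_sym : forall n i j x y, dom S n x y ->
    metric S n i j x y = metric S n j i x y;
  metric_pos : forall n x y (v : axis -> R), dom S n x y ->
    (v ax1 <> 0 \/ v ax2 <> 0) ->
    0 < sum_axis (fun i => sum_axis (fun j => metric S n i j x y * v i * v j))
}.

(* * Sectional curvature *)

Definition metric_det (g : axis -> axis -> R -> R -> R) (x y : R) : R :=
  g ax1 ax1 x y * g ax2 ax2 x y - g ax1 ax2 x y * g ax2 ax1 x y.

Definition metric_inv (g : axis -> axis -> R -> R -> R) (i j : axis) (x y : R) : R :=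
  match i, j with
  | ax1, ax1 => g ax2 ax2 x y / metric_det g x y
  | ax2, ax2 => g ax1 ax1 x y / metric_det g x y
  | i, j => - g i j x y / metric_det g x y
  end.

(* Gamma^k_ij, the Christoffel symbols of the Levi-Civita connection. *)
Definition christoffel (g : axis -> axis -> R -> R -> R) (k i j : axis) (x y : R) : R :=
  / 2 * sum_axis (fun l => metric_inv g k l x y *
    (partial i (g j l) x y + partial j (g i l) x y - partial l (g i j) x y)).

(* Component along d_l of R(d_1, d_2) d_2 = nabla_1 nabla_2 d_2 - nabla_2 nabla_1 d_2. *)
Definition riemann_122 (g : axis -> axis -> R -> R -> R) (l : axis) (x y : R) : R :=
  partial ax1 (christoffel g l ax2 ax2) x y - partial ax2 (christoffel g l ax1 ax2) x y
  + sum_axis (fun m =>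
      christoffel g l ax1 m x y * christoffel g m ax2 ax2 x y
      - christoffel g l ax2 m x y * christoffel g m ax1 ax2 x y).

(* <R(d_1, d_2) d_2, d_1> / (|d_1|^2 |d_2|^2 - <d_1, d_2>^2) *)
Definition sectional_curvature (g : axis -> axis -> R -> R -> R) (x y : R) : R :=
  sum_axis (fun l => g l ax1 x y * riemann_122 g l x y) / metric_det g x y.

Definition has_constant_curvature (S : surface) (k : R) : Prop :=
  forall n x y, dom S n x y -> sectional_curvature (metric S n) x y = k.

(* * BiLipschitz equivalence *)

Definition lipschitz_on {X Y : Type} (A : X -> Prop) (dX : X -> X -> Rbar)
    (dY : Y -> Y -> Rbar) (L : R) (f : X -> Y) : Prop :=
  forall p p', A p -> A p' ->
    Rbar_le (dY (f p) (f p')) (Rbar_mult (Finite L) (dX p p')).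

(* A and B are biLipschitz homeomorphic, with both constants smaller than C. *)
Definition biLipschitz_lt {X Y : Type} (A : X -> Prop) (dX : X -> X -> Rbar)
    (B : Y -> Prop) (dY : Y -> Y -> Rbar) (C : R) : Prop :=
  exists (f : X -> Y) (g : Y -> X) (L : R),
    (forall p, A p -> B (f p) /\ g (f p) = p) /\
    (forall m, B m -> A (g m) /\ f (g m) = m) /\
    0 < L < C /\
    lipschitz_on A dX dY L f /\ lipschitz_on B dY dX L g.

(* Main.v *)
Require Import Defs.
From Stdlib Require Import Reals Lra Lia Classical ClassicalEpsilon ProofIrrelevance.
From Coquelicot Require Import Coquelicot.
Open Scope R_scope.

(** Near a normal point the boundary is, after an isometry, a graph
    [z = exp (- u)] with [u = <A x, x> / 2 + o(|x|^2)], and the metric that it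
    inherits is [exp (2 u) |dx|^2 + (d u)^2]. Three facts give the result.

    First, convexity improves the expansion of [u] to one of its slopes: since
    [exp (- 2 u) + |x|^2] is convex and equals a quadratic polynomial up to
    [o(|x|^2)], its difference quotients at distance at most [eps] from 0 are those
    of the polynomial up to [o(eps)] ([convex_gradient]). Hence the slope of the
    height along [dx] is [- <A x, dx> + o(eps) |dx|], and squaring it costs only
    [o(eps^2) |dx|^2]: the metric of the graph is
    [(1 + <A x, x>) |dx|^2 + <A x, dx>^2] up to a relative error [o(eps^2)]. The
    boundary need not be differentiable near the point, so this is a statement
    on the hyperbolic chords between any two sufficiently close points of the
    graph ([chord_fine]).

    Second, a smooth metric given up to [o(|x|^2)] is, in suitable coordinates, a
    metric of constant curvature up to [o(|x|^2)]. Here the new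
    coordinates differ from [x] by explicit polynomials that start with cubic
    terms, and the curvature that makes the linear system for these terms solvable is [k = det A - tr A] ([metric_normal_form]), the
    value that the Gauss equation gives: -1 plus the product of the eigenvalues of
    [1 - A]. The model is a small disc with the metric
    [(1 + k |X|^2 / 4)^-2 |dX|^2] ([conf_curvature]). In the new coordinates
    short chords of the boundary and of the model agree up to a factor
    [1 + o(eps^2)] on the disc of radius [eps] ([chart_fine]).

    Third, both distances are infima of lengths of curves, and lengths are
    obtained from short chords. A curve between two points of [B_eps(q)] that is
    nearly as short as possible stays in a ball of radius [O(eps)], where the
    comparison of chords holds with [o(eps^2)] as before; so it can be
    transferred, in both directions, to a curve whose length is multiplied by at
    most [1 + o(eps^2)] ([intrinsic_dist_curve], [riemannian_dist_lifted_curve],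
    [ball_biLipschitz]). Cutting curves into short chords and joining curves rests
    on the triangle inequality for [hdist] ([hdist_triangle]). *)

(** * The hyperbolic distance *)

Lemma sqr_le_inv a b : 0 <= b -> a ^ 2 <= b ^ 2 -> a <= b.
Proof. intros hb h; apply Rnot_lt_le; intro; nra. Qed.

Lemma sqr_lt_inv a b : 0 <= b -> a ^ 2 < b ^ 2 -> a < b.
Proof. intros hb h; apply Rnot_le_lt; intro; nra. Qed.

Lemma sqr_eq_0 a : a ^ 2 = 0 -> a = 0.
Proof. intros h; apply Rsqr_0_uniq; unfold Rsqr; lra. Qed.

Definition edist2 (p q : E3) : R :=
  (cx p - cx q) ^ 2 + (cy p - cy q) ^ 2 + (cz p - cz q) ^ 2.

Definition chord (p q : E3) : R := edist2 p q / (cz p * cz q).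

Lemma edist2_nonneg p q : 0 <= edist2 p q.
Proof.
  unfold edist2.
  pose proof (pow2_ge_0 (cx p - cx q)); pose proof (pow2_ge_0 (cy p - cy q)).
  pose proof (pow2_ge_0 (cz p - cz q)); lra.
Qed.

Lemma chord_nonneg p q : H3 p -> H3 q -> 0 <= chord p q.
Proof.
  intros hp hq; apply Rmult_le_pos; [apply edist2_nonneg|].
  apply Rlt_le, Rinv_0_lt_compat, Rmult_lt_0_compat; assumption.
Qed.

Lemma hdist_chord p q : H3 p -> H3 q ->
  hdist p q = 2 * arcsinh (sqrt (chord p q / 4)).
Proof.
  intros hp hq; unfold hdist; fold (edist2 p q).
  assert (0 < cz p * cz q) by (apply Rmult_lt_0_compat; assumption).
  do 2 f_equal.
  unfold chord.
  replace (edist2 p q / (cz p * cz q) / 4)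
    with (edist2 p q / (2 ^ 2 * (cz p * cz q)))
    by (unfold H3 in *; field; lra).
  rewrite sqrt_div_alt by lra.
  rewrite (sqrt_mult (2 ^ 2)) by lra.
  now rewrite sqrt_pow2 by lra.
Qed.

Lemma hdist_nonneg p q : 0 <= hdist p q.
Proof.
  unfold hdist.
  apply Rmult_le_pos; [lra|].
  rewrite <- arcsinh_0; apply arcsinh_le.
  destruct (Req_dec (sqrt (cz p * cz q)) 0) as [E|E].
  - rewrite E, Rmult_0_r; unfold Rdiv; rewrite Rinv_0; lra.
  - apply Rmult_le_pos; [apply sqrt_pos|].
    apply Rlt_le, Rinv_0_lt_compat.
    pose proof (sqrt_pos (cz p * cz q)); lra.
Qed.

Lemma hdist_sym p q : hdist p q = hdist q p.
Proof.
  unfold hdist; rewrite (Rmult_comm (cz p)).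
  do 4 f_equal; ring.
Qed.

Lemma hdist_refl p : hdist p p = 0.
Proof.
  unfold hdist.
  replace (_ + _ + _) with 0 by ring.
  rewrite sqrt_0; unfold Rdiv; rewrite Rmult_0_l, arcsinh_0; ring.
Qed.

Lemma sqrt_chord p q : H3 p -> H3 q ->
  sqrt (chord p q / 4) = sinh (hdist p q / 2).
Proof.
  intros hp hq; rewrite hdist_chord by assumption.
  replace (2 * _ / 2) with (arcsinh (sqrt (chord p q / 4))) by field.
  now rewrite sinh_arcsinh.
Qed.

Lemma cosh_double t : cosh (2 * t) = 1 + 2 * sinh t ^ 2.
Proof.
  unfold cosh, sinh.
  replace (2 * t) with (t + t) by ring.
  rewrite Ropp_plus_distr, !exp_plus, exp_Ropp.
  pose proof (exp_pos t); field; lra.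
Qed.

Lemma cosh2_sinh2 t : cosh t ^ 2 - sinh t ^ 2 = 1.
Proof.
  unfold cosh, sinh; rewrite exp_Ropp; pose proof (exp_pos t); field; lra.
Qed.

Lemma cosh_pos t : 0 < cosh t.
Proof. unfold cosh; pose proof (exp_pos t); pose proof (exp_pos (-t)); lra. Qed.

Lemma sinh_nonneg t : 0 <= t -> 0 <= sinh t.
Proof.
  intros [h|<-]; [|rewrite sinh_0; lra].
  rewrite <- sinh_0; apply Rlt_le, sinh_lt, h.
Qed.

Lemma cosh_plus s t : cosh (s + t) = cosh s * cosh t + sinh s * sinh t.
Proof.
  unfold cosh, sinh; rewrite Ropp_plus_distr, !exp_plus; field.
Qed.

Lemma cosh_le_inv a b : 0 <= a -> 0 <= b -> cosh a <= cosh b -> a <= b.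
Proof.
  intros ha hb h.
  destruct (Rle_lt_dec a b) as [|hlt]; [assumption|exfalso].
  pose proof (sinh_lt _ _ hlt); pose proof (sinh_nonneg b hb).
  pose proof (cosh2_sinh2 a); pose proof (cosh2_sinh2 b).
  pose proof (cosh_pos a); pose proof (cosh_pos b); nra.
Qed.

Lemma cosh_hdist p q : H3 p -> H3 q -> cosh (hdist p q) = 1 + chord p q / 2.
Proof.
  intros hp hq.
  replace (hdist p q) with (2 * (hdist p q / 2)) by field.
  rewrite cosh_double, <- sqrt_chord by assumption.
  rewrite pow2_sqrt; [field|].
  pose proof (chord_nonneg p q hp hq); lra.
Qed.

(** Read in the hyperboloid model, the hyperbolic cosine of a distance is a
    Lorentz product, and splitting off the components along [q] leaves an
    ordinary scalar product of the tangent vectors [u] and [v] at [q] that point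
    to [p] and to [r], of lengths [sinh (hdist p q)] and [sinh (hdist q r)];
    then Cauchy-Schwarz in the tangent space is the triangle inequality. *)
Lemma hdist_triangle p q r : H3 p -> H3 q -> H3 r ->
  hdist p r <= hdist p q + hdist q r.
Proof.
  intros hp hq hr.
  pose proof (hdist_nonneg p q) as npq; pose proof (hdist_nonneg q r) as nqr.
  apply cosh_le_inv; [apply hdist_nonneg|lra|].
  rewrite cosh_plus.
  pose proof (sinh_nonneg _ npq) as sp; pose proof (sinh_nonneg _ nqr) as sr.
  pose proof (cosh2_sinh2 (hdist p q)) as cp.
  pose proof (cosh2_sinh2 (hdist q r)) as cr.
  rewrite (cosh_hdist p q) in cp |- * by assumption.
  rewrite (cosh_hdist q r) in cr |- * by assumption.
  rewrite (cosh_hdist p r) by assumption.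
  destruct p as [[px py] pz], q as [[qx qy] qz], r as [[rx ry] rz].
  unfold H3, chord, edist2, cx, cy, cz in *; simpl fst in *; simpl snd in *.
  pose (u1 := (px - qx) / pz); pose (u2 := (py - qy) / pz).
  pose (u3 := ((px - qx) ^ 2 + (py - qy) ^ 2 + pz ^ 2 - qz ^ 2) / (2 * pz * qz)).
  pose (v1 := (rx - qx) / rz); pose (v2 := (ry - qy) / rz).
  pose (v3 := ((rx - qx) ^ 2 + (ry - qy) ^ 2 + rz ^ 2 - qz ^ 2) / (2 * rz * qz)).
  set (s := sinh (hdist (px, py, pz) _)) in *;
  set (t := sinh (hdist (qx, qy, qz) _)) in *.
  assert (hs : s ^ 2 = u1 ^ 2 + u2 ^ 2 + u3 ^ 2).
  { match type of cp with ?e - _ = _ => transitivity (e - 1); [lra|] end.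
    unfold u1, u2, u3; field; lra. }
  assert (ht : t ^ 2 = v1 ^ 2 + v2 ^ 2 + v3 ^ 2).
  { match type of cr with ?e - _ = _ => transitivity (e - 1); [lra|] end.
    unfold v1, v2, v3; field; lra. }
  assert (CS : - (u1 * v1 + u2 * v2 + u3 * v3) <= s * t).
  { apply Rsqr_incr_0_var; [|nra].
    unfold Rsqr.
    replace (s * t * (s * t)) with (s ^ 2 * t ^ 2) by ring.
    rewrite hs, ht.
    pose proof (pow2_ge_0 (u1 * v2 - u2 * v1)).
    pose proof (pow2_ge_0 (u1 * v3 - u3 * v1)).
    pose proof (pow2_ge_0 (u2 * v3 - u3 * v2)).
    lra. }
  match goal with |- ?l <= ?a * ?b + _ =>
    replace l with (a * b - (u1 * v1 + u2 * v2 + u3 * v3)) end.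
  - lra.
  - unfold u1, u2, u3, v1, v2, v3; field; lra.
Qed.

Lemma sinh_ge t : 0 <= t -> t <= sinh t.
Proof.
  intros h.
  pose proof (arcsinh_sinh t) as e.
  destruct (MVT_gen (fun x => sinh x - x) 0 t (fun x => cosh x - 1))
    as (c & hc & E).
  - intros x _; auto_derive; [exact I|].
    unfold cosh; ring.
  - intros x _; apply continuity_pt_minus;
      [apply derivable_continuous_pt, derivable_sinh|apply continuity_pt_id].
  - rewrite sinh_0 in E.
    pose proof (cosh2_sinh2 c); pose proof (cosh_pos c).
    assert (1 <= cosh c) by nra.
    nra.
Qed.

Lemma arcsinh_bounds t : 0 <= t -> t - t ^ 3 <= arcsinh t <= t.
Proof.
  intros h.
  assert (h0 : 0 <= arcsinh t) by (rewrite <- arcsinh_0; apply arcsinh_le, h).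
  split.
  - destruct (MVT_gen (fun x => arcsinh x - x + x ^ 3) 0 t
      (fun x => / sqrt (x ^ 2 + 1) - 1 + 3 * x ^ 2)) as (c & hc & E).
    + intros x _.
      apply (is_derive_plus (fun x => arcsinh x - x) (fun x => x ^ 3)).
      * apply (is_derive_minus arcsinh (fun x => x)).
        -- apply is_derive_Reals, derivable_pt_lim_arcsinh.
        -- apply @is_derive_id.
      * auto_derive; [exact I|ring].
    + intros x _.
      apply continuity_pt_plus; [apply continuity_pt_minus|].
      * apply derivable_continuous_pt.
        exists (/ sqrt (x ^ 2 + 1)); apply derivable_pt_lim_arcsinh.
      * apply continuity_pt_id.
      * apply derivable_continuous_pt, derivable_pt_pow.
    + rewrite arcsinh_0 in E.
      assert (0 < sqrt (c ^ 2 + 1)) by (apply sqrt_lt_R0; nra).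
      assert (sq : sqrt (c ^ 2 + 1) ^ 2 = c ^ 2 + 1) by (apply pow2_sqrt; nra).
      assert (1 - 3 * c ^ 2 <= / sqrt (c ^ 2 + 1)).
      { apply (Rmult_le_reg_r (sqrt (c ^ 2 + 1))); [assumption|].
        rewrite Rinv_l by lra.
        destruct (Rle_lt_dec (1 - 3 * c ^ 2) 0); [nra|].
        assert (sqrt (c ^ 2 + 1) <= 1 + c ^ 2) by nra.
        nra. }
      nra.
  - rewrite <- (sinh_arcsinh t) at 2.
    apply sinh_ge, h0.
Qed.

(** Infinitesimally [hdist] is the chord length: the error is of second
    order. *)
Lemma hdist2_chord p q : H3 p -> H3 q ->
  Rabs (hdist p q ^ 2 - chord p q) <= chord p q ^ 2 / 2.
Proof.
  intros hp hq.
  rewrite hdist_chord by assumption.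
  pose proof (chord_nonneg p q hp hq) as hc.
  set (t := sqrt (chord p q / 4)).
  assert (ht : 0 <= t) by apply sqrt_pos.
  assert (E : chord p q = 4 * t ^ 2) by (unfold t; rewrite pow2_sqrt; lra).
  rewrite E.
  destruct (arcsinh_bounds t ht) as [h1 h2].
  assert (h0 : 0 <= arcsinh t) by (rewrite <- arcsinh_0; apply arcsinh_le, ht).
  apply Rabs_le; split; [|nra].
  destruct (Rle_lt_dec t 1) as [t1|t1]; [|nra].
  assert (0 <= t - t ^ 3) by nra.
  assert ((t - t ^ 3) ^ 2 <= arcsinh t ^ 2) by (apply pow_incr; lra).
  nra.
Qed.

Lemma hdist_eq_0 p q : H3 p -> H3 q -> hdist p q = 0 -> p = q.
Proof.
  intros hp hq h.
  pose proof (cosh_hdist p q hp hq) as E.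
  rewrite h in E; unfold cosh in E; rewrite Ropp_0, exp_0 in E.
  assert (Z : chord p q = 0) by lra.
  unfold chord in Z.
  assert (0 < cz p * cz q) by (apply Rmult_lt_0_compat; assumption).
  assert (Z' : edist2 p q = 0).
  { replace (edist2 p q) with (edist2 p q / (cz p * cz q) * (cz p * cz q))
      by (field; unfold H3 in *; lra).
    rewrite Z; ring. }
  destruct p as [[px py] pz], q as [[qx qy] qz].
  unfold edist2, cx, cy, cz in Z'; simpl fst in Z'; simpl snd in Z'.
  pose proof (pow2_ge_0 (px - qx)); pose proof (pow2_ge_0 (py - qy)).
  pose proof (pow2_ge_0 (pz - qz)).
  assert (px - qx = 0) by (apply sqr_eq_0; lra).
  assert (py - qy = 0) by (apply sqr_eq_0; lra).
  assert (pz - qz = 0) by (apply sqr_eq_0; lra).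
  replace qx with px by lra; replace qy with py by lra.
  now replace qz with pz by lra.
Qed.

Lemma chord_le_hdist p q : H3 p -> H3 q -> hdist p q < 3 / 4 ->
  chord p q <= 2 * hdist p q ^ 2.
Proof.
  intros hp hq.
  rewrite hdist_chord by assumption.
  pose proof (chord_nonneg p q hp hq) as hc.
  set (t := sqrt (chord p q / 4)); intros hd.
  assert (ht : 0 <= t) by apply sqrt_pos.
  assert (E : chord p q = 4 * t ^ 2) by (unfold t; rewrite pow2_sqrt; lra).
  rewrite E.
  destruct (arcsinh_bounds t ht) as [h1 h2].
  assert (h0 : 0 <= arcsinh t) by (rewrite <- arcsinh_0; apply arcsinh_le, ht).
  assert (t < 1 / 2).
  { destruct (Rlt_le_dec t (1 / 2)) as [|h]; [assumption|].
    apply arcsinh_le in h.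
    destruct (arcsinh_bounds (1 / 2)); lra. }
  assert (3 / 4 * t <= arcsinh t) by nra.
  nra.
Qed.

(** The chord involves the heights of both end points; when [hdist p q] is small
    the height of [p] is controlled by that of [q]. *)
Lemma hdist_small_edist q eta : H3 q -> 0 < eta ->
  exists d, 0 < d /\ forall p, H3 p -> hdist p q < d -> edist2 p q < eta ^ 2.
Proof.
  unfold H3; intros hq he.
  pose (m := Rmin eta (cz q)).
  assert (hm : 0 < m /\ m <= eta /\ m <= cz q).
  { unfold m; split; [apply Rmin_glb_lt; assumption|].
    split; [apply Rmin_l|apply Rmin_r]. }
  destruct hm as (hm & hme & hmq).
  exists (Rmin (3 / 4) (m / (4 * cz q))); split.
  { apply Rmin_glb_lt; [lra|].
    apply Rdiv_lt_0_compat; lra. }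
  intros p hp hd.
  pose proof (Rlt_le_trans _ _ _ hd (Rmin_l _ _)) as d1.
  pose proof (Rlt_le_trans _ _ _ hd (Rmin_r _ _)) as d2.
  pose proof (hdist_nonneg p q) as d0.
  pose proof (chord_le_hdist p q hp hq d1) as hc.
  pose proof (edist2_nonneg p q) as en.
  apply Rnot_le_lt; intros hbad.
  set (h := hdist p q) in *.
  set (w := sqrt (edist2 p q)).
  assert (w2 : w ^ 2 = edist2 p q) by (apply pow2_sqrt, en).
  assert (w0 : 0 <= w) by apply sqrt_pos.
  assert (wm : m <= w) by (apply sqr_le_inv; [lra|];
    apply Rle_trans with (eta ^ 2); [apply pow_incr|]; lra).
  assert (zw : cz p <= cz q + w).
  { assert ((cz p - cz q) ^ 2 <= w ^ 2).
    { rewrite w2; unfold edist2.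
      pose proof (pow2_ge_0 (cx p - cx q)); pose proof (pow2_ge_0 (cy p - cy q)).
      lra. }
    assert (cz p - cz q <= w) by (apply sqr_le_inv; lra). lra. }
  assert (ew : w ^ 2 <= 2 * h ^ 2 * (cz p * cz q)).
  { rewrite w2.
    replace (edist2 p q) with (chord p q * (cz p * cz q))
      by (unfold chord; field; lra).
    apply Rmult_le_compat_r; [|assumption].
    apply Rlt_le, Rmult_lt_0_compat; assumption. }
  assert (hz : h * (4 * cz q) < m).
  { apply (Rmult_lt_compat_r (4 * cz q)) in d2; [|lra].
    replace (m / (4 * cz q) * (4 * cz q)) with m in d2 by (field; lra).
    exact d2. }
  (* cz p <= cz q + w <= 2 w cz q / m, so that w^2 <= w m / 4 *)
  assert (m * cz p <= 2 * w * cz q) by nra.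
  assert (m * w ^ 2 <= 4 * (h * cz q) ^ 2 * w).
  { assert (0 <= 2 * h ^ 2 * cz q) by (apply Rmult_le_pos; nra).
    apply Rle_trans with (2 * h ^ 2 * cz q * (m * cz p)); nra. }
  assert (16 * (h * cz q) ^ 2 <= m ^ 2).
  { replace (16 * (h * cz q) ^ 2) with ((h * (4 * cz q)) ^ 2) by ring.
    apply pow_incr; split; [apply Rmult_le_pos|]; lra. }
  assert (4 * (m * w ^ 2) <= m ^ 2 * w) by nra.
  assert (0 < m * w) by (apply Rmult_lt_0_compat; lra).
  nra.
Qed.

Lemma edist_small_hdist z0 eta : 0 < z0 -> 0 < eta ->
  exists d, 0 < d /\ forall p q, z0 <= cz q -> edist2 p q < d ^ 2 ->
    H3 p /\ hdist p q < eta.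
Proof.
  unfold H3; intros hz0 he.
  exists (Rmin (z0 / 2) (z0 * eta / 2)); split.
  { apply Rmin_glb_lt; nra. }
  intros p q hz hp.
  assert (hq : 0 < cz q) by lra.
  pose proof (edist2_nonneg p q) as en.
  assert (d1 : edist2 p q < (cz q / 2) ^ 2).
  { eapply Rlt_le_trans; [exact hp|].
    apply pow_incr; split; [apply Rmin_glb; nra|].
    eapply Rle_trans; [apply Rmin_l|lra]. }
  assert (d2 : edist2 p q < (cz q * eta / 2) ^ 2).
  { eapply Rlt_le_trans; [exact hp|].
    apply pow_incr; split; [apply Rmin_glb; nra|].
    eapply Rle_trans; [apply Rmin_r|nra]. }
  assert (zp : cz q / 2 <= cz p).
  { assert ((cz p - cz q) ^ 2 <= (cz q / 2) ^ 2).
    { unfold edist2 in d1.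
      pose proof (pow2_ge_0 (cx p - cx q)); pose proof (pow2_ge_0 (cy p - cy q)).
      lra. }
    assert (cz q - cz p <= cz q / 2); [|lra].
    apply sqr_le_inv; [lra|].
    replace ((cz q - cz p) ^ 2) with ((cz p - cz q) ^ 2) by ring; lra. }
  assert (hp' : 0 < cz p) by lra.
  split; [assumption|].
  rewrite hdist_chord by assumption.
  set (t := sqrt (chord p q / 4)).
  assert (ht : 0 <= t) by apply sqrt_pos.
  assert (ht2 : t ^ 2 = chord p q / 4).
  { apply pow2_sqrt; pose proof (chord_nonneg p q hp' hq); lra. }
  destruct (arcsinh_bounds t ht) as [_ h2].
  assert (t < eta / 2); [|lra].
  assert (cE : edist2 p q = 4 * t ^ 2 * (cz p * cz q)).
  { rewrite ht2; unfold chord; field; lra. }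
  apply Rnot_le_lt; intros hbad.
  assert (h3 : eta ^ 2 <= 4 * t ^ 2) by nra.
  assert (h4 : cz q ^ 2 <= 2 * (cz p * cz q)) by nra.
  assert (eta ^ 2 * (cz q ^ 2) <= 4 * t ^ 2 * (2 * (cz p * cz q))).
  { apply Rmult_le_compat; [apply pow2_ge_0|apply pow2_ge_0|exact h3|exact h4]. }
  assert (0 < (cz q * eta) ^ 2) by (apply pow_lt, Rmult_lt_0_compat; assumption).
  replace ((cz q * eta / 2) ^ 2) with ((cz q * eta) ^ 2 / 4) in d2 by field.
  rewrite cE in d2.
  replace (eta ^ 2 * cz q ^ 2) with ((cz q * eta) ^ 2) in * by ring.
  lra.
Qed.

(** * Curves and the intrinsic distance of a subset of hyperbolic space *)

Definition clamp (t : R) : R := Rmax 0 (Rmin 1 t).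

Lemma clamp_range t : 0 <= clamp t <= 1.
Proof.
  unfold clamp; split; [apply Rmax_l|].
  apply Rmax_lub; [lra|apply Rmin_l].
Qed.

Lemma clamp_id t : 0 <= t <= 1 -> clamp t = t.
Proof.
  intros h; unfold clamp; rewrite Rmin_right by lra; apply Rmax_right; lra.
Qed.

Lemma clamp_lipschitz s t : Rabs (clamp s - clamp t) <= Rabs (s - t).
Proof.
  unfold clamp, Rmax, Rmin, Rabs.
  repeat destruct Rle_dec; repeat destruct Rcase_abs; lra.
Qed.

Lemma clamp_le s t : s <= t -> clamp s <= clamp t.
Proof.
  intros h; unfold clamp, Rmax, Rmin; repeat destruct Rle_dec; lra.
Qed.

Lemma ball_E3 (p q : E3) (e : R) :
  ball (M := prod_UniformSpace _ _) p e q <->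
  Rabs (cx q - cx p) < e /\ Rabs (cy q - cy p) < e /\ Rabs (cz q - cz p) < e.
Proof.
  destruct p as [[px py] pz], q as [[qx qy] qz].
  split; [intros [[h1 h2] h3]|intros (h1 & h2 & h3)].
  - repeat split; assumption.
  - split; [split|]; assumption.
Qed.

Lemma edist2_lt p q d : 0 < d ->
  Rabs (cx p - cx q) < d / 2 -> Rabs (cy p - cy q) < d / 2 ->
  Rabs (cz p - cz q) < d / 2 -> edist2 p q < d ^ 2.
Proof.
  intros hd h1 h2 h3; unfold edist2.
  rewrite <- (pow2_abs (cx p - _)), <- (pow2_abs (cy p - _)),
    <- (pow2_abs (cz p - _)).
  assert (sq : forall a, Rabs a < d / 2 -> Rabs a ^ 2 < d ^ 2 / 4).
  { intros a ha; pose proof (Rabs_pos a).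
    replace (d ^ 2 / 4) with ((d / 2) ^ 2) by field.
    unfold pow; rewrite !Rmult_1_r; apply Rmult_le_0_lt_compat; assumption. }
  pose proof (sq _ h1); pose proof (sq _ h2); pose proof (sq _ h3).
  nra.
Qed.

(** [hdist] has the same small balls as the Euclidean distance, so continuity
    may be checked with it: this is how curves are carried over by maps which are
    only known to respect [hdist]. *)
Lemma continuous_of_hdist (gam : R -> E3) t :
  (forall s, H3 (gam s)) ->
  (forall eta, 0 < eta -> exists d, 0 < d /\
     forall s, Rabs (s - t) < d -> hdist (gam s) (gam t) < eta) ->
  continuous (gam : R -> prod_UniformSpace _ _) t.
Proof.
  intros hH hc.
  apply filterlim_locally; intros eps.
  destruct (hdist_small_edist (gam t) eps (hH t) (cond_pos eps))
    as (d & hd & he).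
  destruct (hc d hd) as (d' & hd' & hs).
  exists (mkposreal d' hd'); intros s hst.
  specialize (he (gam s) (hH s) (hs s hst)).
  apply ball_E3; unfold edist2 in he.
  pose proof (cond_pos eps) as he0.
  pose proof (pow2_ge_0 (cx (gam s) - cx (gam t))).
  pose proof (pow2_ge_0 (cy (gam s) - cy (gam t))).
  pose proof (pow2_ge_0 (cz (gam s) - cz (gam t))).
  repeat split; (apply sqr_lt_inv; [lra|]; rewrite pow2_abs; lra).
Qed.

Lemma hdist_mesh (gam : R -> E3) eta :
  (forall t, continuous (gam : R -> prod_UniformSpace _ _) t) ->
  (forall t, 0 <= t <= 1 -> H3 (gam t)) -> 0 < eta ->
  exists d, 0 < d /\ forall s t, 0 <= s <= 1 -> 0 <= t <= 1 ->
    Rabs (s - t) < d -> hdist (gam s) (gam t) < eta.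
Proof.
  intros hc hH he.
  assert (zc : forall t, 0 <= t <= 1 -> continuity_pt (fun t => cz (gam t)) t).
  { intros t _; apply continuity_pt_filterlim.
    apply (filterlim_comp _ _ _ (gam : R -> prod_UniformSpace _ _)
      (snd : _ -> R) _ (locally (gam t)));
      [apply hc|apply continuous_snd]. }
  destruct (continuity_ab_min (fun t => cz (gam t)) 0 1 ltac:(lra) zc)
    as (m & hm & hm01).
  destruct (edist_small_hdist (cz (gam m)) eta (hH m hm01) he)
    as (d & hd & hsm).
  destruct (unifcont_1d (V := prod_UniformSpace _ _) gam 0 1 (fun t _ => hc t)
    (mkposreal (d / 2) ltac:(lra))) as [[d' hd'] hu].
  exists d'; split; [assumption|].
  intros s t hs ht hst.
  apply (hsm (gam s) (gam t) (hm t ht)).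
  assert (hb := NNPP _ (hu t s ht hs hst)).
  apply ball_E3 in hb; simpl in hb.
  apply edist2_lt; tauto.
Qed.

Definition partition01 (t : nat -> R) : Prop :=
  0 <= t 0%nat /\ (forall i, t i <= t (S i)) /\ (forall i, t i <= 1).

Lemma partition01_range t i : partition01 t -> 0 <= t i <= 1.
Proof.
  intros (h0 & hm & h1); split; [|apply h1].
  induction i as [|i IH]; [assumption|].
  specialize (hm i); lra.
Qed.

Lemma curve_length_le gam b :
  (forall n t, partition01 t ->
     sum_n (fun i => hdist (gam (t i)) (gam (t (S i)))) n <= b) ->
  exists l, curve_length gam = Finite l /\ l <= b.
Proof.
  intros h.
  unfold curve_length.
  match goal with |- context [Lub_Rbar ?S] => set (E := S) end.
  destruct (Lub_Rbar_correct E) as [hub hlub].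
  assert (hb : Rbar_le (Lub_Rbar E) b).
  { apply hlub; intros s (n & t & h0 & hm & h1 & ->).
    apply h; repeat split; assumption. }
  assert (h0 : Rbar_le (sum_n (fun _ => hdist (gam 0) (gam 0)) 0) (Lub_Rbar E)).
  { apply hub; exists 0%nat, (fun _ => 0).
    repeat split; intros; lra. }
  destruct (Lub_Rbar E) as [l| |]; simpl in hb, h0; try contradiction.
  exists l; split; [reflexivity|assumption].
Qed.

Lemma curve_length_ge gam l n t : curve_length gam = Finite l ->
  partition01 t -> sum_n (fun i => hdist (gam (t i)) (gam (t (S i)))) n <= l.
Proof.
  intros hl (h0 & hm & h1).
  unfold curve_length in hl.
  match type of hl with context [Lub_Rbar ?S] => set (E := S) in hl end.
  destruct (Lub_Rbar_correct E) as [hub _].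
  rewrite hl in hub; apply hub.
  exists n, t; repeat split; assumption.
Qed.

Lemma curve_length_hdist gam l t : curve_length gam = Finite l ->
  0 <= t <= 1 -> hdist (gam 0) (gam t) <= l.
Proof.
  intros hl ht.
  pose proof (curve_length_ge gam l 0 (fun i => match i with O => 0 | _ => t end)
    hl) as h.
  rewrite sum_O in h; apply h.
  split; [lra|split; intros [|i]; lra].
Qed.

Lemma sum_n_telescope (M : R -> R) (t : nat -> R) n :
  sum_n (fun i => M (t (S i)) - M (t i)) n = M (t (S n)) - M (t 0%nat).
Proof.
  induction n as [|n IH]; [now rewrite sum_O|].
  rewrite sum_Sn, IH; unfold plus; simpl; ring.
Qed.

Definition curve_from_to (A : E3 -> Prop) (p q : E3) (l : R) (gam : R -> E3) :=
  (forall t, continuous (gam : R -> prod_UniformSpace _ _) t) /\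
  (forall t, 0 <= t <= 1 -> A (gam t)) /\
  gam 0 = p /\ gam 1 = q /\ curve_length gam = Finite l.

Lemma intrinsic_dist_le A p q l gam : curve_from_to A p q l gam ->
  Rbar_le (intrinsic_dist A p q) l.
Proof.
  intros h; unfold intrinsic_dist.
  match goal with |- context [Glb_Rbar ?S] => set (E := S) end.
  apply (Glb_Rbar_correct E); exists gam; exact h.
Qed.

Lemma intrinsic_dist_glb A p q (b : Rbar) :
  (forall l gam, curve_from_to A p q l gam -> Rbar_le b l) ->
  Rbar_le b (intrinsic_dist A p q).
Proof.
  intros h; unfold intrinsic_dist.
  match goal with |- context [Glb_Rbar ?S] => set (E := S) end.
  apply (Glb_Rbar_correct E); intros l (gam & hg).
  exact (h l gam hg).
Qed.

Lemma Glb_Rbar_approx (E : R -> Prop) (b b' : R) : Rbar_le (Glb_Rbar E) b ->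
  b < b' -> exists l, E l /\ l < b'.
Proof.
  intros h hb.
  apply NNPP; intros hn.
  assert (Rbar_le b' (Glb_Rbar E)) as hc.
  { apply (Glb_Rbar_correct E); intros l hl; simpl.
    apply Rnot_lt_le; intros hlt; apply hn; now exists l. }
  pose proof (Rbar_le_trans _ _ _ hc h) as hd; simpl in hd; lra.
Qed.

Lemma intrinsic_dist_approx A p q (b b' : R) :
  Rbar_le (intrinsic_dist A p q) b -> b < b' ->
  exists l gam, l < b' /\ curve_from_to A p q l gam.
Proof.
  intros h hb.
  destruct (Glb_Rbar_approx _ b b' h hb) as (l & (gam & hg) & hl).
  exists l, gam; split; assumption.
Qed.

Lemma intrinsic_dist_ge_hdist A p q :
  Rbar_le (hdist p q) (intrinsic_dist A p q).
Proof.
  apply intrinsic_dist_glb; intros l gam (_ & _ & <- & <- & hl); simpl.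
  apply curve_length_hdist; [assumption|lra].
Qed.

(** The increments of [M] telescope along every inscribed polygon. Outside
    [0, 1] the path is replaced by constants. *)
Lemma intrinsic_dist_le_increment A (gam : R -> E3) (M : R -> R) :
  (forall p, A p -> H3 p) ->
  (forall t, 0 <= t <= 1 -> A (gam t)) ->
  (forall t eta, 0 <= t <= 1 -> 0 < eta -> exists d, 0 < d /\
     forall s, 0 <= s <= 1 -> Rabs (s - t) < d -> hdist (gam s) (gam t) < eta) ->
  (forall s t, 0 <= s -> s <= t -> t <= 1 ->
     hdist (gam s) (gam t) <= M t - M s) ->
  Rbar_le (intrinsic_dist A (gam 0) (gam 1)) (M 1 - M 0).
Proof.
  intros hA hin hc hM.
  pose (g := fun t => gam (clamp t)).
  assert (Mle : forall s t, 0 <= s -> s <= t -> t <= 1 -> M s <= M t).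
  { intros s t h1 h2 h3; pose proof (hM s t h1 h2 h3).
    pose proof (hdist_nonneg (gam s) (gam t)); lra. }
  destruct (curve_length_le g (M 1 - M 0)) as (l & hl & hb).
  { intros n t ht.
    apply Rle_trans with (sum_n (fun i => M (t (S i)) - M (t i)) n).
    - apply sum_n_m_le; intros i.
      pose proof (partition01_range t i ht).
      pose proof (partition01_range t (S i) ht).
      unfold g; rewrite !clamp_id by assumption.
      apply hM; [lra| |lra].
      apply ht.
    - rewrite sum_n_telescope.
      pose proof (partition01_range t (S n) ht).
      pose proof (partition01_range t 0 ht).
      pose proof (Mle (t (S n)) 1); pose proof (Mle 0 (t 0%nat)); lra. }
  apply Rbar_le_trans with (Finite l); [|exact hb].
  apply intrinsic_dist_le with g.
  repeat split; try assumption.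
  - intros t; apply continuous_of_hdist.
    + intros s; apply hA, hin, clamp_range.
    + intros eta he.
      destruct (hc (clamp t) eta (clamp_range t) he) as (d & hd & hs).
      exists d; split; [assumption|]; intros s hst.
      apply hs; [apply clamp_range|].
      pose proof (clamp_lipschitz s t); lra.
  - intros t ht; apply hin, clamp_range.
  - unfold g; now rewrite clamp_id by lra.
  - unfold g; now rewrite clamp_id by lra.
Qed.

Lemma continuous_glue (f g : R -> E3) c :
  (forall t, continuous (f : R -> prod_UniformSpace _ _) t) ->
  (forall t, continuous (g : R -> prod_UniformSpace _ _) t) ->
  f c = g c ->
  forall t, continuous ((fun t => if Rle_dec t c then f t else g t)
                        : R -> prod_UniformSpace _ _) t.
Proof.
  intros hf hg hfg t.
  apply filterlim_locally; intros eps.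
  destruct (proj1 (filterlim_locally _ _) (hf t) eps) as [df hdf].
  destruct (proj1 (filterlim_locally _ _) (hg t) eps) as [dg hdg].
  destruct (total_order_T t c) as [[htc|htc]|htc].
  - exists (mkposreal (Rmin df (c - t))
      (Rmin_glb_lt _ _ _ (cond_pos df) (proj2 (Rlt_0_minus t c) htc))).
    intros s hs; change (Rabs (s - t) < Rmin df (c - t)) in hs.
    destruct (Rle_dec t c) as [_|]; [|lra].
    pose proof (Rlt_le_trans _ _ _ hs (Rmin_l _ _)).
    pose proof (Rlt_le_trans _ _ _ hs (Rmin_r _ _)) as h2.
    apply Rabs_lt_between in h2.
    destruct (Rle_dec s c) as [_|]; [|lra].
    now apply hdf.
  - exists (mkposreal (Rmin df dg)
      (Rmin_glb_lt _ _ _ (cond_pos df) (cond_pos dg))).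
    intros s hs; change (Rabs (s - t) < Rmin df dg) in hs.
    pose proof (Rlt_le_trans _ _ _ hs (Rmin_l _ _)).
    pose proof (Rlt_le_trans _ _ _ hs (Rmin_r _ _)).
    destruct (Rle_dec t c) as [_|]; [|lra].
    destruct (Rle_dec s c) as [_|].
    + now apply hdf.
    + rewrite htc, hfg, <- htc; now apply hdg.
  - exists (mkposreal (Rmin dg (t - c))
      (Rmin_glb_lt _ _ _ (cond_pos dg) (proj2 (Rlt_0_minus c t) htc))).
    intros s hs; change (Rabs (s - t) < Rmin dg (t - c)) in hs.
    destruct (Rle_dec t c) as [|_]; [lra|].
    pose proof (Rlt_le_trans _ _ _ hs (Rmin_l _ _)).
    pose proof (Rlt_le_trans _ _ _ hs (Rmin_r _ _)) as h2.
    apply Rabs_lt_between in h2.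
    destruct (Rle_dec s c) as [|_]; [lra|].
    now apply hdg.
Qed.

(** Clamping the two halves of the time interval makes every polygon inscribed
    in a concatenation the sum of a polygon inscribed in the first curve and of
    one inscribed in the second. *)
Lemma curve_concat A p q r l1 l2 g1 g2 : (forall p, A p -> H3 p) ->
  curve_from_to A p q l1 g1 -> curve_from_to A q r l2 g2 ->
  exists l g, l <= l1 + l2 /\ curve_from_to A p r l g.
Proof.
  intros hA (c1 & in1 & s1 & e1 & len1) (c2 & in2 & s2 & e2 & len2).
  pose (f1 := fun t => g1 (clamp (2 * t))).
  pose (f2 := fun t => g2 (clamp (2 * t - 1))).
  pose (g := fun t => if Rle_dec t (/ 2) then f1 t else f2 t).
  assert (cc : forall a b t, continuous (fun t => clamp (a * t - b)) t).
  { intros a b t; apply filterlim_locally; intros eps.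
    assert (ha : 0 < eps / (Rabs a + 1)).
    { pose proof (Rabs_pos a); apply Rdiv_lt_0_compat; [apply eps|lra]. }
    exists (mkposreal _ ha); intros s hs.
    change (Rabs (s - t) < eps / (Rabs a + 1)) in hs.
    change (Rabs (clamp (a * s - b) - clamp (a * t - b)) < eps).
    eapply Rle_lt_trans; [apply clamp_lipschitz|].
    replace (a * s - b - (a * t - b)) with (a * (s - t)) by ring.
    rewrite Rabs_mult.
    pose proof (Rabs_pos a); pose proof (Rabs_pos (s - t)).
    apply (Rmult_lt_compat_r (Rabs a + 1)) in hs; [|lra].
    replace (eps / (Rabs a + 1) * (Rabs a + 1)) with (pos eps) in hs
      by (field; lra).
    nra. }
  assert (cg : forall t, continuous (g : R -> prod_UniformSpace _ _) t).
  { apply continuous_glue.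
    - intros t.
      apply (filterlim_comp _ _ _ (fun t => clamp (2 * t)) g1 _
        (locally (clamp (2 * t)))); [|apply c1].
      eapply filterlim_ext; [|replace (2 * t) with (2 * t - 0) by ring;
        apply (cc 2 0 t)].
      intros s; simpl; f_equal; ring.
    - intros t.
      apply (filterlim_comp _ _ _ (fun t => clamp (2 * t - 1)) g2 _
        (locally (clamp (2 * t - 1)))); [apply cc|apply c2].
    - unfold f1, f2.
      rewrite !clamp_id by lra.
      replace (2 * / 2) with 1 by field.
      rewrite e1, <- s2; f_equal; ring. }
  assert (gH : forall t, H3 (g t)).
  { intros t; unfold g, f1, f2; destruct Rle_dec;
      [apply hA, in1, clamp_range|apply hA, in2, clamp_range]. }
  destruct (curve_length_le g (l1 + l2)) as (l & hl & hb).
  { intros n t ht.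
    assert (p1 : partition01 (fun i => clamp (2 * t i))).
    { destruct ht as (h0 & hm & h1); split; [apply clamp_range|].
      split; intros i; [apply clamp_le; specialize (hm i); lra|apply clamp_range]. }
    assert (p2 : partition01 (fun i => clamp (2 * t i - 1))).
    { destruct ht as (h0 & hm & h1); split; [apply clamp_range|].
      split; intros i; [apply clamp_le; specialize (hm i); lra|apply clamp_range]. }
    pose proof (curve_length_ge g1 l1 n _ len1 p1) as b1.
    pose proof (curve_length_ge g2 l2 n _ len2 p2) as b2.
    eapply Rle_trans; [|apply Rplus_le_compat; [exact b1|exact b2]].
    simpl in b1, b2 |- *.
    match goal with |- _ <= sum_n ?a n + sum_n ?b n =>
      apply Rle_trans with (sum_n (fun i => a i + b i) n);
        [|right; exact (sum_n_plus a b n)] end.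
    apply sum_n_m_le; intros i.
    pose proof (partition01_range t i ht); pose proof (partition01_range t (S i) ht).
    assert (t i <= t (S i)) by apply ht.
    pose proof (hdist_nonneg (g1 (clamp (2 * t i))) (g1 (clamp (2 * t (S i))))).
    pose proof (hdist_nonneg (g2 (clamp (2 * t i - 1)))
      (g2 (clamp (2 * t (S i) - 1)))).
    unfold g, f1, f2.
    destruct (Rle_dec (t i) (/ 2)) as [hi|hi],
      (Rle_dec (t (S i)) (/ 2)) as [hi'|hi']; try lra.
    (* the polygon side that straddles the junction *)
    assert (E1 : clamp (2 * t (S i)) = 1).
    { unfold clamp; rewrite Rmin_left by lra; apply Rmax_right; lra. }
    assert (E2 : clamp (2 * t i - 1) = 0).
    { unfold clamp; rewrite Rmin_right by lra; apply Rmax_left; lra. }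
    rewrite E1, E2, e1, s2.
    apply hdist_triangle.
    - apply hA, in1, clamp_range.
    - rewrite <- s2; apply hA, in2; lra.
    - apply hA, in2, clamp_range. }
  exists l, g; split; [assumption|].
  repeat split; try assumption.
  - intros t _; unfold g, f1, f2; destruct Rle_dec;
      [apply in1, clamp_range|apply in2, clamp_range].
  - unfold g, f1; destruct Rle_dec as [_|]; [|lra].
    rewrite clamp_id by lra; rewrite <- s1; f_equal; ring.
  - unfold g, f2; destruct Rle_dec; [lra|].
    rewrite clamp_id by lra; rewrite <- e2; f_equal; ring.
Qed.

Lemma intrinsic_dist_triangle A p q r (a b : R) : (forall p, A p -> H3 p) ->
  Rbar_le (intrinsic_dist A p q) a -> Rbar_le (intrinsic_dist A q r) b ->
  Rbar_le (intrinsic_dist A p r) (a + b).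
Proof.
  intros hA ha hb.
  destruct (intrinsic_dist A p r) as [d| |] eqn:E; simpl; [|exfalso|exact I].
  - apply le_epsilon; intros eps he.
    destruct (intrinsic_dist_approx A p q a (a + eps / 2) ha) as (l1 & g1 & h1 & c1);
      [lra|].
    destruct (intrinsic_dist_approx A q r b (b + eps / 2) hb) as (l2 & g2 & h2 & c2);
      [lra|].
    destruct (curve_concat A p q r l1 l2 g1 g2 hA c1 c2) as (l & g & hl & c).
    apply intrinsic_dist_le in c; rewrite E in c; simpl in c; lra.
  - destruct (intrinsic_dist_approx A p q a (a + 1) ha) as (l1 & g1 & h1 & c1);
      [lra|].
    destruct (intrinsic_dist_approx A q r b (b + 1) hb) as (l2 & g2 & h2 & c2);
      [lra|].
    destruct (curve_concat A p q r l1 l2 g1 g2 hA c1 c2) as (l & g & hl & c).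
    apply intrinsic_dist_le in c; rewrite E in c; exact c.
Qed.

(** * The Euclidean norm of the plane *)

Definition eucl (x y : R) : R := sqrt (x ^ 2 + y ^ 2).

Lemma sum_sqr_nonneg x y : 0 <= x ^ 2 + y ^ 2.
Proof. pose proof (pow2_ge_0 x); pose proof (pow2_ge_0 y); lra. Qed.

Lemma eucl_nonneg x y : 0 <= eucl x y.
Proof. apply sqrt_pos. Qed.

Lemma eucl_sqr x y : eucl x y ^ 2 = x ^ 2 + y ^ 2.
Proof. apply pow2_sqrt, sum_sqr_nonneg. Qed.

Lemma eucl_le x y r : 0 <= r -> x ^ 2 + y ^ 2 <= r ^ 2 -> eucl x y <= r.
Proof. intros hr h; apply sqr_le_inv; [assumption|]; now rewrite eucl_sqr. Qed.

Lemma eucl_lt x y r : 0 < r -> x ^ 2 + y ^ 2 < r ^ 2 <-> eucl x y < r.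
Proof.
  intros hr; rewrite <- eucl_sqr; pose proof (eucl_nonneg x y); split; intros h.
  - apply sqr_lt_inv; lra.
  - nra.
Qed.

Lemma dot_le_eucl x y x' y' : x * x' + y * y' <= eucl x y * eucl x' y'.
Proof.
  pose proof (eucl_nonneg x y); pose proof (eucl_nonneg x' y').
  apply sqr_le_inv; [now apply Rmult_le_pos|].
  rewrite Rpow_mult_distr, !eucl_sqr.
  pose proof (pow2_ge_0 (x * y' - y * x')); nra.
Qed.

Lemma eucl_triangle x y x' y' : eucl (x + x') (y + y') <= eucl x y + eucl x' y'.
Proof.
  pose proof (eucl_nonneg x y); pose proof (eucl_nonneg x' y').
  apply sqr_le_inv; [lra|].
  pose proof (dot_le_eucl x y x' y').
  replace ((eucl x y + eucl x' y') ^ 2)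
    with (eucl x y ^ 2 + 2 * (eucl x y * eucl x' y') + eucl x' y' ^ 2) by ring.
  rewrite !eucl_sqr; nra.
Qed.

Lemma eucl_opp x y : eucl (- x) (- y) = eucl x y.
Proof. unfold eucl; f_equal; ring. Qed.

Lemma eucl_sub_sym x y x' y' : eucl (x - x') (y - y') = eucl (x' - x) (y' - y).
Proof. rewrite <- eucl_opp; f_equal; ring. Qed.

Lemma eucl_scal s x y : 0 <= s -> eucl (s * x) (s * y) = s * eucl x y.
Proof.
  intros hs; unfold eucl.
  replace ((s * x) ^ 2 + (s * y) ^ 2) with (s ^ 2 * (x ^ 2 + y ^ 2)) by ring.
  rewrite sqrt_mult_alt by apply pow2_ge_0; now rewrite sqrt_pow2.
Qed.

Lemma eucl_eq_0 x y : eucl x y = 0 -> x = 0 /\ y = 0.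
Proof.
  intros h; pose proof (eucl_sqr x y) as e; rewrite h in e.
  pose proof (pow2_ge_0 x); pose proof (pow2_ge_0 y).
  split; apply sqr_eq_0; lra.
Qed.

Lemma eucl_0 : eucl 0 0 = 0.
Proof. unfold eucl; replace (0 ^ 2 + 0 ^ 2) with 0 by ring; apply sqrt_0. Qed.

Lemma Rabs_le_eucl_l x y : Rabs x <= eucl x y.
Proof.
  apply sqr_le_inv; [apply eucl_nonneg|].
  rewrite eucl_sqr, pow2_abs; pose proof (pow2_ge_0 y); lra.
Qed.

Lemma Rabs_le_eucl_r x y : Rabs y <= eucl x y.
Proof.
  apply sqr_le_inv; [apply eucl_nonneg|].
  rewrite eucl_sqr, pow2_abs; pose proof (pow2_ge_0 x); lra.
Qed.

Lemma eucl_le_Rabs x y : eucl x y <= Rabs x + Rabs y.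
Proof.
  pose proof (Rabs_pos x); pose proof (Rabs_pos y).
  apply eucl_le; [lra|].
  rewrite <- (pow2_abs x), <- (pow2_abs y); nra.
Qed.

Lemma eucl_diff_le x y x' y' : eucl x' y' <= eucl x y + eucl (x' - x) (y' - y).
Proof.
  replace x' with (x + (x' - x)) at 1 by ring.
  replace y' with (y + (y' - y)) at 1 by ring.
  apply eucl_triangle.
Qed.

(** * A disc of constant curvature *)

Definition rho (k x y : R) : R := 1 + k * (x ^ 2 + y ^ 2) / 4.

Definition conf (k x y : R) : R := / rho k x y.

Definition conf_metric (k : R) (i j : axis) (x y : R) : R :=
  match i, j with
  | ax1, ax1 | ax2, ax2 => conf k x y ^ 2
  | _, _ => 0
  end.

(** The functions built from the coordinates and [1 / rho]: a class that is
    closed under partial derivatives. *)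
Inductive rational (k : R) : (R -> R -> R) -> Prop :=
| rational_const c : rational k (fun _ _ => c)
| rational_fst : rational k (fun x _ => x)
| rational_snd : rational k (fun _ y => y)
| rational_conf : rational k (conf k)
| rational_plus f g : rational k f -> rational k g ->
    rational k (fun x y => f x y + g x y)
| rational_mult f g : rational k f -> rational k g ->
    rational k (fun x y => f x y * g x y).

Lemma rational_derive k f : rational k f ->
  exists fx fy, rational k fx /\ rational k fy /\
    forall x y, rho k x y <> 0 ->
      is_derive (fun t => f t y) x (fx x y) /\
      is_derive (fun t => f x t) y (fy x y).
Proof.
  induction 1 as [c| | | |f g hf (fx & fy & rfx & rfy & df) hg (gx & gy & rgx & rgy & dg)
    |f g hf (fx & fy & rfx & rfy & df) hg (gx & gy & rgx & rgy & dg)].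
  - exists (fun _ _ => 0), (fun _ _ => 0).
    split; [constructor|split; [constructor|]].
    intros x y _; split; apply @is_derive_const.
  - exists (fun _ _ => 1), (fun _ _ => 0).
    split; [constructor|split; [constructor|]].
    intros x y _; split; [apply @is_derive_id|apply @is_derive_const].
  - exists (fun _ _ => 0), (fun _ _ => 1).
    split; [constructor|split; [constructor|]].
    intros x y _; split; [apply @is_derive_const|apply @is_derive_id].
  - exists (fun x y => (- k / 2 * x) * (conf k x y * conf k x y)),
      (fun x y => (- k / 2 * y) * (conf k x y * conf k x y)).
    split; [repeat constructor|split; [repeat constructor|]].
    intros x y h; unfold conf, rho in *.
    split; auto_derive; try assumption; field; contradict h; lra.
  - exists (fun x y => fx x y + gx x y), (fun x y => fy x y + gy x y).
    split; [now constructor|split; [now constructor|]].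
    intros x y h; destruct (df x y h), (dg x y h).
    split; apply @is_derive_plus; assumption.
  - exists (fun x y => fx x y * g x y + f x y * gx x y),
      (fun x y => fy x y * g x y + f x y * gy x y).
    split; [repeat constructor; assumption|
      split; [repeat constructor; assumption|]].
    intros x y h; destruct (df x y h), (dg x y h).
    split.
    + apply (is_derive_mult (fun t => f t y) (fun t => g t y));
        [assumption..|intros; apply Rmult_comm].
    + apply (is_derive_mult (fun t => f x t) (fun t => g x t));
        [assumption..|intros; apply Rmult_comm].
Qed.

Lemma continuity_2d_rho k x y : continuity_2d_pt (rho k) x y.
Proof.
  unfold rho, Rdiv.
  apply continuity_2d_pt_plus; [apply continuity_2d_pt_const|].
  apply continuity_2d_pt_mult; [|apply continuity_2d_pt_const].
  apply continuity_2d_pt_mult; [apply continuity_2d_pt_const|].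
  apply continuity_2d_pt_plus; unfold pow;
    repeat apply continuity_2d_pt_mult;
    try apply continuity_2d_pt_const;
    first [apply continuity_2d_pt_id1|apply continuity_2d_pt_id2].
Qed.

Lemma rational_continuity k f x y : rational k f -> rho k x y <> 0 ->
  continuity_2d_pt f x y.
Proof.
  intros hf h; induction hf.
  - apply continuity_2d_pt_const.
  - apply continuity_2d_pt_id1.
  - apply continuity_2d_pt_id2.
  - apply continuity_2d_pt_inv; [apply continuity_2d_rho|assumption].
  - now apply continuity_2d_pt_plus.
  - now apply continuity_2d_pt_mult.
Qed.

Lemma locally_rho_neq_0 k x y : rho k x y <> 0 ->
  locally_2d (fun a b => rho k a b <> 0) x y.
Proof. apply continuity_2d_pt_neq_0, continuity_2d_rho. Qed.

Lemma rational_smooth k f x y : rational k f -> rho k x y <> 0 ->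
  smooth_2d f x y.
Proof.
  intros hf h n; revert f x y hf h.
  induction n as [|n IH]; intros f x y hf h.
  - split; [now apply rational_continuity with k|exact I].
  - destruct (rational_derive k f hf) as (fx & fy & rfx & rfy & d).
    split; [now apply rational_continuity with k|].
    destruct (d x y h) as [d1 d2].
    split; [eexists; exact d1|]; split; [eexists; exact d2|].
    pose proof (locally_rho_neq_0 k x y h) as hl.
    split.
    + apply ex_diff_n_ext_loc with fx; [|now apply IH].
      revert hl; apply locally_2d_impl, locally_2d_forall; intros u v huv.
      symmetry; apply is_derive_unique, d, huv.
    + apply ex_diff_n_ext_loc with fy; [|now apply IH].
      revert hl; apply locally_2d_impl, locally_2d_forall; intros u v huv.
      symmetry; apply is_derive_unique, d, huv.
Qed.

Lemma conf_metric_rational k i j : rational k (conf_metric k i j).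
Proof.
  assert (h : rational k (fun x y => conf k x y * (conf k x y * 1))).
  { apply (rational_mult k (conf k) (fun x y => conf k x y * 1));
      [constructor|].
    apply (rational_mult k (conf k) (fun _ _ => 1)); constructor. }
  destruct i, j; first [exact h|exact (rational_const k 0)].
Qed.

Lemma smooth_2d_fst x y : smooth_2d (fun a _ => a) x y.
Proof.
  apply rational_smooth with 0; [constructor|unfold rho; lra].
Qed.

Lemma smooth_2d_snd x y : smooth_2d (fun _ b => b) x y.
Proof.
  apply rational_smooth with 0; [constructor|unfold rho; lra].
Qed.

Definition conf_christoffel (k : R) (l i j : axis) (x y : R) : R :=
  match l, i, j with
  | ax1, ax1, ax1 | ax2, ax1, ax2 | ax2, ax2, ax1 => - (k * x / 2) * conf k x y
  | ax1, ax2, ax2 => k * x / 2 * conf k x y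
  | ax2, ax2, ax2 | ax1, ax1, ax2 | ax1, ax2, ax1 => - (k * y / 2) * conf k x y
  | ax2, ax1, ax1 => k * y / 2 * conf k x y
  end.

Lemma partial_conf_metric k l i j x y : rho k x y <> 0 ->
  partial l (conf_metric k i j) x y =
    match i, j with
    | ax1, ax1 | ax2, ax2 =>
        - k * match l with ax1 => x | ax2 => y end * conf k x y ^ 3
    | _, _ => 0
    end.
Proof.
  intros h.
  destruct i, j; destruct l; unfold partial, conf_metric;
    try apply Derive_const;
    apply is_derive_unique; unfold conf, rho in *;
    (auto_derive; [assumption|field; contradict h; lra]).
Qed.

Lemma christoffel_conf k l i j x y : rho k x y <> 0 ->
  christoffel (conf_metric k) l i j x y = conf_christoffel k l i j x y.
Proof.
  intros h.
  unfold christoffel, sum_axis.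
  rewrite !partial_conf_metric by assumption.
  unfold metric_inv, metric_det.
  assert (conf k x y <> 0) by now apply Rinv_neq_0_compat.
  destruct l, i, j; unfold conf_metric, conf_christoffel; field; assumption.
Qed.

Lemma partial_ext_loc i f g x y : locally_2d (fun a b => f a b = g a b) x y ->
  partial i f x y = partial i g x y.
Proof.
  intros h; destruct i; apply Derive_ext_loc.
  - exact (locally_2d_1d_const_y _ _ _ h).
  - exact (locally_2d_1d_const_x _ _ _ h).
Qed.

Lemma partial_christoffel_conf k m l i j x y : rho k x y <> 0 ->
  partial m (christoffel (conf_metric k) l i j) x y =
  partial m (conf_christoffel k l i j) x y.
Proof.
  intros h; apply partial_ext_loc.
  generalize (locally_rho_neq_0 k x y h).
  apply locally_2d_impl, locally_2d_forall; intros a b hab.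
  now apply christoffel_conf.
Qed.

(** In isothermal coordinates the curvature of [rho^-2 (dx^2 + dy^2)] is
    [rho^2] times the Laplacian of [ln rho], which is the constant [k] for this
    choice of [rho]. *)
Lemma conf_curvature k x y : rho k x y <> 0 ->
  sectional_curvature (conf_metric k) x y = k.
Proof.
  intros h.
  unfold sectional_curvature, riemann_122, sum_axis.
  rewrite !partial_christoffel_conf, !christoffel_conf by assumption.
  assert (E1 : partial ax1 (conf_christoffel k ax1 ax2 ax2) x y =
    k / 2 * conf k x y - (k * x / 2) ^ 2 * conf k x y ^ 2).
  { apply is_derive_unique; unfold conf_christoffel, conf, rho in *.
    auto_derive; [assumption|field; contradict h; lra]. }
  assert (E2 : partial ax2 (conf_christoffel k ax1 ax1 ax2) x y =
    - (k / 2) * conf k x y + (k * y / 2) ^ 2 * conf k x y ^ 2).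
  { apply is_derive_unique; unfold conf_christoffel, conf, rho in *.
    auto_derive; [assumption|field; contradict h; lra]. }
  rewrite E1, E2.
  unfold conf_metric, metric_det, conf_christoffel.
  unfold conf; unfold rho in *; field.
  contradict h; lra.
Qed.

Definition in_disc (r x y : R) : Prop := x ^ 2 + y ^ 2 < r ^ 2.

Lemma in_disc_eucl r x y : 0 < r -> in_disc r x y <-> eucl x y < r.
Proof. apply eucl_lt. Qed.

Definition disc_point (r : R) : Type := {p : R * R | in_disc r (fst p) (snd p)}.

Definition px {r} (m : disc_point r) : R := fst (proj1_sig m).
Definition py {r} (m : disc_point r) : R := snd (proj1_sig m).

Lemma in_disc_0 r : 0 < r -> in_disc r 0 0.
Proof. unfold in_disc; intros h; nra. Qed.

Definition disc_par (r : R) (hr : 0 < r) (x y : R) : disc_point r :=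
  match Rlt_dec (x ^ 2 + y ^ 2) (r ^ 2) with
  | left h => exist _ (x, y) h
  | right _ => exist _ (0, 0) (in_disc_0 r hr)
  end.

Definition disc_surface (k r : R) (hr : 0 < r) : surface :=
  {| carrier := disc_point r;
     dom := fun _ => in_disc r;
     par := fun _ => disc_par r hr;
     metric := fun _ => conf_metric k |}.

Lemma disc_point_eq r (m m' : disc_point r) :
  px m = px m' -> py m = py m' -> m = m'.
Proof.
  destruct m as [[x y] h], m' as [[x' y'] h']; unfold px, py; simpl.
  intros <- <-; f_equal; apply proof_irrelevance.
Qed.

Lemma px_disc_par r hr x y : in_disc r x y -> px (disc_par r hr x y) = x.
Proof. intros h; unfold disc_par; destruct Rlt_dec; [reflexivity|contradiction]. Qed.

Lemma py_disc_par r hr x y : in_disc r x y -> py (disc_par r hr x y) = y.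
Proof. intros h; unfold disc_par; destruct Rlt_dec; [reflexivity|contradiction]. Qed.

Lemma disc_par_px_py r hr (m : disc_point r) : disc_par r hr (px m) (py m) = m.
Proof.
  apply disc_point_eq; [apply px_disc_par|apply py_disc_par]; apply (proj2_sig m).
Qed.

Lemma in_disc_px_py r (m : disc_point r) : in_disc r (px m) (py m).
Proof. apply (proj2_sig m). Qed.

Lemma locally_2d_eucl_lt x y d : 0 < d ->
  locally_2d (fun a b => eucl (a - x) (b - y) < d) x y.
Proof.
  intros hd; exists (mkposreal (d / 2) ltac:(lra)); simpl; intros a b ha hb.
  eapply Rle_lt_trans; [apply eucl_le_Rabs|lra].
Qed.

Lemma locally_2d_in_disc r x y : 0 < r -> in_disc r x y ->
  locally_2d (in_disc r) x y.
Proof.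
  intros hr h; apply in_disc_eucl in h; [|assumption].
  generalize (locally_2d_eucl_lt x y (r - eucl x y) ltac:(lra)).
  apply locally_2d_impl, locally_2d_forall; intros a b hab.
  apply in_disc_eucl; [assumption|].
  pose proof (eucl_diff_le x y a b); lra.
Qed.

Lemma open_in_disc k r hr (U : R -> R -> Prop) :
  (forall x y, in_disc r x y -> U x y -> locally_2d U x y) ->
  open_in (disc_surface k r hr) (fun m => U (px m) (py m)).
Proof.
  intros hU n x y hd hu; simpl in *.
  rewrite px_disc_par, py_disc_par in hu by assumption.
  generalize (locally_2d_and _ _ _ _ (hU x y hd hu)
    (locally_2d_in_disc r x y hr hd)).
  apply locally_2d_impl, locally_2d_forall; intros a b [h1 h2].
  now rewrite px_disc_par, py_disc_par.
Qed.

Lemma disc_segment r x y x' y' t : 0 < r -> in_disc r x y -> in_disc r x' y' ->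
  0 <= t <= 1 -> in_disc r (x + t * (x' - x)) (y + t * (y' - y)).
Proof.
  intros hr h h' ht; apply in_disc_eucl; [assumption|].
  apply in_disc_eucl in h, h'; try assumption.
  replace (x + t * (x' - x)) with ((1 - t) * x + t * x') by ring.
  replace (y + t * (y' - y)) with ((1 - t) * y + t * y') by ring.
  eapply Rle_lt_trans; [apply eucl_triangle|].
  rewrite !eucl_scal by lra.
  destruct (Req_dec t 0) as [->|]; [lra|].
  assert (t * eucl x' y' < t * r) by (apply Rmult_lt_compat_l; lra).
  assert ((1 - t) * eucl x y <= (1 - t) * r) by (apply Rmult_le_compat_l; lra).
  lra.
Qed.

Definition segment (x y x' y' : R) (i : axis) (t : R) : R :=
  match i with
  | ax1 => x + t * (x' - x)
  | ax2 => y + t * (y' - y)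
  end.

Lemma is_derive_segment x y x' y' i t :
  is_derive (segment x y x' y' i) t (match i with ax1 => x' - x | ax2 => y' - y end).
Proof. destruct i; unfold segment; auto_derive; auto; ring. Qed.

Lemma segment_C1_arc k r hr n x y x' y' : in_disc r x y -> in_disc r x' y' ->
  C1_arc (disc_surface k r hr) n (segment x y x' y').
Proof.
  intros h h'; split.
  - intros i t; split; [eexists; apply is_derive_segment|].
    apply (continuous_ext (fun _ => match i with ax1 => x' - x | ax2 => y' - y end)).
    + intros s; symmetry; apply is_derive_unique, is_derive_segment.
    + apply continuous_const.
  - intros t ht; now apply disc_segment.
Qed.

Lemma segment_curve k r hr x y x' y' : in_disc r x y -> in_disc r x' y' ->
  curve_of_length (disc_surface k r hr) (disc_par r hr x y) (disc_par r hr x' y')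
    (arc_length (disc_surface k r hr) 0 (segment x y x' y')).
Proof.
  intros h h'.
  rewrite <- (Rplus_0_r (arc_length _ _ _)).
  assert (E0 : disc_par r hr x y =
    par (disc_surface k r hr) 0 (segment x y x' y' ax1 0) (segment x y x' y' ax2 0)).
  { simpl; f_equal; ring. }
  assert (E1 : disc_par r hr x' y' =
    par (disc_surface k r hr) 0 (segment x y x' y' ax1 1) (segment x y x' y' ax2 1)).
  { simpl; f_equal; ring. }
  rewrite E0, E1.
  apply curve_cons; [now apply segment_C1_arc|apply curve_nil].
Qed.

Lemma disc_surface_smooth k r hr :
  (forall x y, in_disc r x y -> 0 < rho k x y) ->
  smooth_riemannian_surface (disc_surface k r hr).
Proof.
  intros hrho; split; simpl.
  - intros _ x y; now apply locally_2d_in_disc.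
  - intros _ x y x' y' h h' E; split.
    + now rewrite <- (px_disc_par r hr x y), E, px_disc_par.
    + now rewrite <- (py_disc_par r hr x y), E, py_disc_par.
  - intros m; exists 0%nat, (px m), (py m).
    split; [apply in_disc_px_py|apply disc_par_px_py].
  - intros _ _ x y x' y' h h' E.
    exists (fun i a b => match i with ax1 => a | ax2 => b end).
    generalize (locally_2d_in_disc r x y hr h).
    apply locally_2d_impl, locally_2d_forall; intros a b hab.
    split; [assumption|]; split; [reflexivity|]; split.
    + intros []; [apply smooth_2d_fst|apply smooth_2d_snd].
    + intros i j; unfold sum_axis, partial.
      destruct i, j; rewrite ?Derive_id, ?Derive_const; simpl; ring.
  - intros m m' hne.
    pose (d := eucl (px m' - px m) (py m' - py m)).
    assert (hd : 0 < d).
    { destruct (eucl_nonneg (px m' - px m) (py m' - py m)) as [|e]; [assumption|].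
      exfalso; apply hne; symmetry in e; apply eucl_eq_0 in e.
      apply disc_point_eq; lra. }
    assert (op : forall x0 y0, open_in (disc_surface k r hr)
      (fun m => eucl (px m - x0) (py m - y0) < d / 2)).
    { intros x0 y0.
      apply (open_in_disc k r hr (fun x y => eucl (x - x0) (y - y0) < d / 2)).
      intros x y _ hxy.
      generalize (locally_2d_eucl_lt x y (d / 2 - eucl (x - x0) (y - y0))
        ltac:(lra)).
      apply locally_2d_impl, locally_2d_forall; intros a b hab.
      pose proof (eucl_diff_le (x - x0) (y - y0) (a - x0) (b - y0)) as t.
      replace (a - x0 - (x - x0)) with (a - x) in t by ring.
      replace (b - y0 - (y - y0)) with (b - y) in t by ring.
      lra. }
    exists (fun p => eucl (px p - px m) (py p - py m) < d / 2),
      (fun p => eucl (px p - px m') (py p - py m') < d / 2).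
    split; [apply op|]; split; [apply op|].
    split; [unfold Rminus; rewrite !Rplus_opp_r, eucl_0; lra|].
    split; [unfold Rminus; rewrite !Rplus_opp_r, eucl_0; lra|].
    intros p [h1 h2].
    pose proof (eucl_diff_le (px p - px m) (py p - py m)
      (px m' - px m) (py m' - py m)) as t.
    replace (px m' - px m - (px p - px m)) with (px m' - px p) in t by ring.
    replace (py m' - py m - (py p - py m)) with (py m' - py p) in t by ring.
    rewrite (eucl_sub_sym (px p) (py p)) in h2; fold d in t; lra.
  - intros m m'.
    rewrite <- (disc_par_px_py r hr m), <- (disc_par_px_py r hr m').
    eexists; apply segment_curve; apply in_disc_px_py.
  - intros _ i j x y h.
    apply rational_smooth with k; [apply conf_metric_rational|].
    specialize (hrho x y h); lra.
  - intros _ [] [] x y _; reflexivity.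
  - intros _ x y v h hv; unfold sum_axis, conf_metric.
    assert (hc : 0 < conf k x y) by apply Rinv_0_lt_compat, hrho, h.
    assert (0 < v ax1 ^ 2 + v ax2 ^ 2).
    { destruct (sum_sqr_nonneg (v ax1) (v ax2)) as [|e]; [assumption|].
      pose proof (pow2_ge_0 (v ax1)); pose proof (pow2_ge_0 (v ax2)).
      destruct hv as [hv|hv]; exfalso; apply hv, sqr_eq_0; lra. }
    assert (0 < conf k x y ^ 2) by now apply pow_lt.
    nra.
Qed.

Lemma disc_surface_curvature k r hr :
  (forall x y, in_disc r x y -> 0 < rho k x y) ->
  has_constant_curvature (disc_surface k r hr) k.
Proof.
  intros h n x y hd; apply conf_curvature.
  specialize (h x y hd); lra.
Qed.

Lemma riemannian_dist_le S p q l : curve_of_length S p q l ->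
  Rbar_le (riemannian_dist S p q) l.
Proof. intros h; now apply (Glb_Rbar_correct (curve_of_length S p q)). Qed.

Lemma riemannian_dist_glb S p q (b : Rbar) :
  (forall l, curve_of_length S p q l -> Rbar_le b l) ->
  Rbar_le b (riemannian_dist S p q).
Proof. intros h; now apply (Glb_Rbar_correct (curve_of_length S p q)). Qed.

(** * Arc lengths in the disc *)

Definition speed (k : R) (c : axis -> R -> R) (t : R) : R :=
  conf k (c ax1 t) (c ax2 t) * eucl (Derive (c ax1) t) (Derive (c ax2) t).

Section Arc.

Variables (k r : R) (hr : 0 < r).
Hypothesis hrho : forall x y, in_disc r x y -> 0 < rho k x y.

Lemma conf_pos x y : in_disc r x y -> 0 < conf k x y.
Proof. intros h; now apply Rinv_0_lt_compat, hrho. Qed.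

Lemma arc_length_speed n c : C1_arc (disc_surface k r hr) n c ->
  arc_length (disc_surface k r hr) n c = RInt (speed k c) 0 1.
Proof.
  intros [_ hin]; apply RInt_ext.
  intros t ht; rewrite Rmin_left, Rmax_right in ht by lra.
  unfold sum_axis, speed, eucl; simpl.
  assert (hc := conf_pos _ _ (hin t ltac:(lra))).
  rewrite <- (sqrt_pow2 (conf k (c ax1 t) (c ax2 t))) at 5 by lra.
  rewrite <- sqrt_mult_alt by apply pow2_ge_0.
  f_equal; ring.
Qed.

Lemma continuous_sqr (f : R -> R) t :
  continuous f t -> continuous (fun s => f s ^ 2) t.
Proof.
  intros hf; apply (continuous_ext (fun s => f s * f s)).
  - intros s; simpl; ring.
  - apply (continuous_mult f f t hf hf).
Qed.

Lemma continuous_conf_comp (f g : R -> R) t :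
  continuous f t -> continuous g t -> rho k (f t) (g t) <> 0 ->
  continuous (fun s => conf k (f s) (g s)) t.
Proof.
  intros hf hg h.
  assert (cr : continuous (fun s => rho k (f s) (g s)) t).
  { unfold rho, Rdiv.
    apply @continuous_plus; [apply continuous_const|].
    apply @continuous_mult; [|apply continuous_const].
    apply @continuous_mult; [apply continuous_const|].
    apply @continuous_plus; now apply continuous_sqr. }
  apply continuity_pt_filterlim in cr; apply continuity_pt_filterlim.
  now apply continuity_pt_inv.
Qed.

Lemma continuous_eucl_comp (f g : R -> R) t :
  continuous f t -> continuous g t ->
  continuous (fun s => eucl (f s) (g s)) t.
Proof.
  intros hf hg; unfold eucl.
  apply continuous_sqrt_comp.
  apply @continuous_plus; now apply continuous_sqr.
Qed.

Lemma continuous_speed n c t : C1_arc (disc_surface k r hr) n c ->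
  0 <= t <= 1 -> continuous (speed k c) t.
Proof.
  intros [hd hin] ht.
  apply @continuous_mult.
  - apply continuous_conf_comp.
    + apply @ex_derive_continuous, hd.
    + apply @ex_derive_continuous, hd.
    + specialize (hrho _ _ (hin t ht)); lra.
  - apply continuous_eucl_comp; apply hd.
Qed.

Lemma ex_RInt_speed n c s t : C1_arc (disc_surface k r hr) n c ->
  0 <= s -> s <= t -> t <= 1 -> ex_RInt (speed k c) s t.
Proof.
  intros hc h1 h2 h3; apply @ex_RInt_continuous.
  rewrite Rmin_left, Rmax_right by assumption; intros z hz.
  apply (continuous_speed n c z hc); lra.
Qed.

Definition arc_upto (c : axis -> R -> R) (t : R) : R := RInt (speed k c) 0 t.

Lemma arc_upto_diff n c s t : C1_arc (disc_surface k r hr) n c ->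
  0 <= s -> s <= t -> t <= 1 ->
  arc_upto c t - arc_upto c s = RInt (speed k c) s t.
Proof.
  intros hc h1 h2 h3; unfold arc_upto.
  rewrite <- (RInt_Chasles (speed k c) 0 s t).
  - unfold plus; simpl; ring.
  - apply (ex_RInt_speed n); try assumption; lra.
  - now apply (ex_RInt_speed n).
Qed.

Lemma arc_length_upto n c : C1_arc (disc_surface k r hr) n c ->
  arc_length (disc_surface k r hr) n c = arc_upto c 1 - arc_upto c 0.
Proof.
  intros hc; rewrite (arc_upto_diff n) by (assumption || lra).
  now apply arc_length_speed.
Qed.

Lemma speed_nonneg n c t : C1_arc (disc_surface k r hr) n c ->
  0 <= t <= 1 -> 0 <= speed k c t.
Proof.
  intros [_ hin] ht; apply Rmult_le_pos; [|apply eucl_nonneg].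
  apply Rlt_le, conf_pos, hin, ht.
Qed.

(** Projecting the velocity on the direction of the chord bounds the length
    of an arc from below. *)
Lemma chord_le_arc n c s t kappa C : C1_arc (disc_surface k r hr) n c ->
  0 <= s -> s <= t -> t <= 1 -> 0 <= kappa -> 0 <= C ->
  (forall u, s <= u <= t -> kappa <= C * conf k (c ax1 u) (c ax2 u)) ->
  kappa * eucl (c ax1 t - c ax1 s) (c ax2 t - c ax2 s)
    <= C * (arc_upto c t - arc_upto c s).
Proof.
  intros hc h1 h2 h3 hk hC hle.
  rewrite (arc_upto_diff n) by assumption.
  set (d := eucl _ _).
  destruct (eucl_nonneg (c ax1 t - c ax1 s) (c ax2 t - c ax2 s)) as [hd|hd];
    fold d in hd.
  2: { rewrite <- hd, Rmult_0_r; apply Rmult_le_pos; [assumption|].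
       apply RInt_ge_0; [assumption|now apply (ex_RInt_speed n)|].
       intros u hu; apply (speed_nonneg n); [assumption|lra]. }
  pose (e1 := (c ax1 t - c ax1 s) / d); pose (e2 := (c ax2 t - c ax2 s) / d).
  assert (he : eucl e1 e2 = 1).
  { unfold e1, e2, Rdiv; rewrite !(Rmult_comm _ (/ d)).
    rewrite eucl_scal by now apply Rlt_le, Rinv_0_lt_compat.
    fold d; field; lra. }
  assert (I : is_RInt (fun u => kappa * (e1 * Derive (c ax1) u + e2 * Derive (c ax2) u))
    s t (kappa * d)).
  { replace (kappa * d) with
      (minus (kappa * (e1 * c ax1 t + e2 * c ax2 t))
             (kappa * (e1 * c ax1 s + e2 * c ax2 s))).
    - apply (is_RInt_derive (fun u => kappa * (e1 * c ax1 u + e2 * c ax2 u))).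
      + intros u _; auto_derive; [split; [apply hc|split; [apply hc|exact I]]|].
        change (fun x : R => c ax1 x) with (c ax1).
        change (fun x : R => c ax2 x) with (c ax2).
        ring.
      + intros u _; apply @continuous_mult; [apply continuous_const|].
        apply @continuous_plus; apply @continuous_mult;
          try apply continuous_const; apply hc.
    - unfold minus, plus, opp; simpl.
      apply Rplus_eq_reg_l with (- (kappa * d)); rewrite Rplus_opp_l.
      assert (E : d * d = (c ax1 t - c ax1 s) ^ 2 + (c ax2 t - c ax2 s) ^ 2).
      { rewrite <- eucl_sqr; unfold d; ring. }
      assert (E' : e1 * (c ax1 t - c ax1 s) + e2 * (c ax2 t - c ax2 s) = d).
      { apply Rmult_eq_reg_r with d; [|lra].
        rewrite E; unfold e1, e2; field; lra. }
      rewrite <- E' at 1; ring. }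
  rewrite <- (is_RInt_unique _ _ _ _ I).
  change (C * RInt (speed k c) s t) with (scal C (RInt (speed k c) s t)).
  rewrite <- RInt_scal by now apply (ex_RInt_speed n).
  apply RInt_le; [assumption|now exists (kappa * d)| |].
  - apply (ex_RInt_scal (V := R_NormedModule) (speed k c) s t C).
    now apply (ex_RInt_speed n).
  - intros u hu.
    set (v := eucl (Derive (c ax1) u) (Derive (c ax2) u)).
    assert (hv : 0 <= v) by apply eucl_nonneg.
    pose proof (dot_le_eucl e1 e2 (Derive (c ax1) u) (Derive (c ax2) u)) as cs.
    rewrite he, Rmult_1_l in cs; fold v in cs.
    apply Rle_trans with (kappa * v); [now apply Rmult_le_compat_l|].
    unfold scal; simpl; unfold mult; simpl; unfold speed; fold v.
    rewrite <- Rmult_assoc; apply Rmult_le_compat_r; [assumption|].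
    apply hle; lra.
Qed.

Lemma segment_length_le x y x' y' M : in_disc r x y -> in_disc r x' y' ->
  (forall t, 0 <= t <= 1 ->
    conf k (x + t * (x' - x)) (y + t * (y' - y)) * eucl (x' - x) (y' - y) <= M) ->
  arc_length (disc_surface k r hr) 0 (segment x y x' y') <= M.
Proof.
  intros h h' hM.
  pose proof (segment_C1_arc k r hr 0 x y x' y' h h') as hc.
  rewrite (arc_length_speed 0) by assumption.
  replace M with (RInt (fun _ => M) 0 1)
    by (rewrite RInt_const; unfold scal; simpl; unfold mult; simpl; ring).
  apply RInt_le; [lra|apply (ex_RInt_speed 0); (assumption || lra)| |].
  - apply ex_RInt_const.
  - intros t ht; unfold speed.
    rewrite !(is_derive_unique _ _ _ (is_derive_segment x y x' y' _ t)).
    apply hM; lra.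
Qed.

End Arc.

(** * From an infinitesimal isometry to a biLipschitz map *)

(** Taking for each [eps] an almost optimal constant turns a family of
    [eta]-[eps] bounds into a single remainder. *)
Lemma vanishing_constant (Q : R -> R -> Prop) :
  (forall eta eta' eps, eta <= eta' -> Q eta eps -> Q eta' eps) ->
  (forall eta, 0 < eta -> exists eps0, 0 < eps0 /\
     forall eps, 0 < eps < eps0 -> Q eta eps) ->
  exists c : R -> R, filterlim c (at_right 0) (locally 0) /\
    exists eps0, 0 < eps0 /\ forall eps, 0 < eps < eps0 -> Q (c eps) eps.
Proof.
  intros mono h.
  pose (E := fun eps eta => 0 < eta /\ Q eta eps).
  exists (fun eps => real (Glb_Rbar (E eps)) + eps).
  assert (key : forall eta eps, 0 < eta -> Q eta eps ->
    exists g, Glb_Rbar (E eps) = Finite g /\ 0 <= g <= eta).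
  { intros eta eps he hQ.
    destruct (Glb_Rbar_correct (E eps)) as [hlb hglb].
    assert (h1 : Rbar_le 0 (Glb_Rbar (E eps))).
    { apply hglb; intros x [hx _]; simpl; lra. }
    assert (h2 : Rbar_le (Glb_Rbar (E eps)) eta) by (apply hlb; now split).
    destruct (Glb_Rbar (E eps)) as [g| |]; simpl in h1, h2; try contradiction.
    exists g; split; [reflexivity|lra]. }
  split.
  - apply filterlim_locally; intros e.
    destruct (h (e / 2)) as (eps0 & hp & hQ); [pose proof (cond_pos e); lra|].
    assert (hd : 0 < Rmin eps0 (e / 2)).
    { apply Rmin_glb_lt; [assumption|pose proof (cond_pos e); lra]. }
    exists (mkposreal _ hd); intros x hx hx0.
    change (Rabs (x - 0) < Rmin eps0 (e / 2)) in hx.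
    rewrite Rminus_0_r, Rabs_pos_eq in hx by lra.
    pose proof (Rlt_le_trans _ _ _ hx (Rmin_l _ _)).
    pose proof (Rlt_le_trans _ _ _ hx (Rmin_r _ _)).
    destruct (key (e / 2) x) as (g & hg & hg'); [lra|apply hQ; lra|].
    change (Rabs (real (Glb_Rbar (E x)) + x - 0) < e).
    rewrite hg; simpl; rewrite Rabs_pos_eq; lra.
  - destruct (h 1 Rlt_0_1) as (eps0 & hp & hQ).
    exists eps0; split; [assumption|]; intros eps heps.
    destruct (key 1 eps Rlt_0_1 (hQ eps heps)) as (g & hg & hg').
    rewrite hg; simpl.
    destruct (Glb_Rbar_approx (E eps) g (g + eps)) as (eta & [he hq] & hlt);
      [rewrite hg; simpl; lra|lra|].
    apply mono with eta; [lra|assumption].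
Qed.

Lemma Rbar_le_limit (x : Rbar) (C a e : R) : 0 < C -> 0 < e ->
  (forall b, a < b < a + e -> Rbar_le x (C * b)) -> Rbar_le x (C * a).
Proof.
  intros hC he h.
  destruct x as [x| |]; simpl.
  - apply le_epsilon; intros d hd.
    pose (b := a + Rmin (e / 2) (d / C)).
    assert (0 < d / C) by now apply Rdiv_lt_0_compat.
    assert (hm : 0 < Rmin (e / 2) (d / C)) by (apply Rmin_glb_lt; lra).
    pose proof (Rmin_l (e / 2) (d / C)); pose proof (Rmin_r (e / 2) (d / C)) as hr.
    specialize (h b ltac:(unfold b; lra)); simpl in h.
    apply (Rmult_le_compat_l C) in hr; [|lra].
    replace (C * (d / C)) with d in hr by (field; lra).
    unfold b in h; lra.
  - apply (h (a + e / 2)); lra.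
  - exact I.
Qed.

Lemma Rbar_finite (x : Rbar) (a b : R) : Rbar_le a x -> Rbar_le x b ->
  exists c, x = Finite c /\ a <= c <= b.
Proof.
  intros h1 h2; destruct x as [c| |]; simpl in h1, h2; try contradiction.
  now exists c.
Qed.

Lemma increment_chain (gam : R -> E3) (M : R -> R) d : 0 < d ->
  (forall t, 0 <= t <= 1 -> H3 (gam t)) ->
  (forall s t, 0 <= s -> s <= t -> t <= 1 -> t - s < d ->
     hdist (gam s) (gam t) <= M t - M s) ->
  forall s t, 0 <= s -> s <= t -> t <= 1 -> hdist (gam s) (gam t) <= M t - M s.
Proof.
  intros hd hH hloc.
  assert (steps : forall n s t, 0 <= s -> s <= t -> t <= 1 ->
    t - s < INR (S n) * d -> hdist (gam s) (gam t) <= M t - M s).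
  { induction n as [|n IH]; intros s t h1 h2 h3 hst.
    - simpl in hst; apply hloc; lra.
    - pose proof (lt_0_INR (S n) ltac:(lia)) as hn.
      set (N := INR (S n)) in *.
      assert (HN : INR (S (S n)) = N + 1) by apply S_INR.
      rewrite HN in hst.
      pose (w := (t - s) / (N + 1)).
      assert (hw : w * (N + 1) = t - s) by (unfold w; field; lra).
      assert (w0 : 0 <= w) by (apply Rnot_lt_le; intro; nra).
      assert (wd : w < d) by (apply Rnot_le_lt; intro; nra).
      assert (wt : s + w <= t) by nra.
      eapply Rle_trans; [apply (hdist_triangle _ (gam (s + w))); apply hH; lra|].
      pose proof (hloc s (s + w)); pose proof (IH (s + w) t).
      assert (t - (s + w) < N * d) by nra.
      lra. }
  intros s t h1 h2 h3.
  destruct (INR_unbounded ((t - s) / d)) as [n hn].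
  apply (steps n); try assumption.
  apply (Rmult_lt_compat_r d) in hn; [|assumption].
  replace ((t - s) / d * d) with (t - s) in hn by (field; lra).
  rewrite S_INR; lra.
Qed.

Lemma curve_of_length_concat S p q r a b :
  curve_of_length S p q a -> curve_of_length S q r b ->
  curve_of_length S p r (a + b).
Proof.
  intros h hb; induction h as [p|n c q l hc _ IH].
  - now rewrite Rplus_0_l.
  - rewrite Rplus_assoc; apply curve_cons; [assumption|now apply IH].
Qed.

Lemma curve_of_length_chain S (m : nat -> carrier S) (b : nat -> R) n :
  (forall i, (i <= n)%nat ->
     exists l, curve_of_length S (m i) (m (Datatypes.S i)) l /\ l <= b i) ->
  exists l, curve_of_length S (m 0%nat) (m (Datatypes.S n)) l /\ l <= sum_n b n.
Proof.
  induction n as [|n IH]; intros h.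
  - destruct (h 0%nat ltac:(lia)) as (l & hl & hb).
    exists l; rewrite sum_O; split; assumption.
  - destruct IH as (l & hl & hb); [intros i hi; apply h; lia|].
    destruct (h (Datatypes.S n) ltac:(lia)) as (l' & hl' & hb').
    exists (l + l'); rewrite sum_Sn; split.
    + now apply curve_of_length_concat with (m (Datatypes.S n)).
    + unfold plus; simpl; lra.
Qed.

Section Transfer.

Variables (A : E3 -> Prop) (q : E3) (k r r0 : R) (Theta : R -> R -> E3).
Hypothesis hA : forall p, A p -> H3 p.
Hypothesis hr : 0 < r.
Hypothesis hr0 : 0 < r0.
Hypothesis rho_pos : forall x y, in_disc r x y -> 0 < rho k x y.
Hypothesis conf_bounds :
  forall x y, in_disc r x y -> / 2 <= conf k x y <= 2.
Hypothesis Theta_in : forall x y, in_disc r x y -> A (Theta x y).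
Hypothesis Theta_0 : Theta 0 0 = q.
Hypothesis Theta_crude : forall x y x' y', in_disc r x y -> in_disc r x' y' ->
  eucl (x' - x) (y' - y) <= 4 * hdist (Theta x y) (Theta x' y') /\
  hdist (Theta x y) (Theta x' y') <= 4 * eucl (x' - x) (y' - y).
Hypothesis Theta_onto : forall p, A p -> hdist q p < r0 ->
  exists x y, in_disc r x y /\ Theta x y = p.

(** The conformal factor is evaluated at any third nearby point, so that a chord
    can be compared with an integral along an arc or a segment. *)
Definition chordwise_close (eps C d : R) : Prop :=
  forall x y x' y' x'' y'',
    eucl x y <= eps -> eucl x' y' <= eps -> eucl x'' y'' <= eps ->
    eucl (x' - x) (y' - y) < d -> eucl (x'' - x) (y'' - y) < d ->
    hdist (Theta x y) (Theta x' y')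
      <= C * (conf k x'' y'' * eucl (x' - x) (y' - y)) /\
    conf k x'' y'' * eucl (x' - x) (y' - y)
      <= C * hdist (Theta x y) (Theta x' y').

Let S := disc_surface k r hr.

Lemma intrinsic_dist_crude x y x' y' : in_disc r x y -> in_disc r x' y' ->
  Rbar_le (intrinsic_dist A (Theta x y) (Theta x' y'))
    (4 * eucl (x' - x) (y' - y)).
Proof.
  intros h h'.
  pose (gam := fun t => Theta (x + t * (x' - x)) (y + t * (y' - y))).
  assert (lip : forall s t, 0 <= s <= 1 -> 0 <= t <= 1 ->
    hdist (gam s) (gam t) <= 4 * (Rabs (t - s) * eucl (x' - x) (y' - y))).
  { intros s t hs ht; eapply Rle_trans;
      [apply Theta_crude; apply disc_segment; assumption|].
    apply Rmult_le_compat_l; [lra|right].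
    replace (x + t * (x' - x) - (x + s * (x' - x)))
      with ((t - s) * (x' - x)) by ring.
    replace (y + t * (y' - y) - (y + s * (y' - y)))
      with ((t - s) * (y' - y)) by ring.
    unfold Rabs; destruct Rcase_abs.
    - rewrite <- eucl_opp, !Ropp_mult_distr_l; apply eucl_scal; lra.
    - apply eucl_scal; lra. }
  pose proof (eucl_nonneg (x' - x) (y' - y)) as hD.
  set (D := eucl (x' - x) (y' - y)) in *.
  replace (4 * D) with (4 * 1 * D - 4 * 0 * D) by ring.
  replace (Theta x y) with (gam 0) by (unfold gam; f_equal; ring).
  replace (Theta x' y') with (gam 1) by (unfold gam; f_equal; ring).
  apply (intrinsic_dist_le_increment A gam (fun t => 4 * t * D)).
  - assumption.
  - intros t ht; apply Theta_in; now apply disc_segment.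
  - intros t eta ht he; exists (eta / (4 * D + 1)); split.
    { apply Rdiv_lt_0_compat; lra. }
    intros s hs hst.
    apply Rle_lt_trans with (1 := lip s t hs ht).
    rewrite Rabs_minus_sym.
    apply (Rmult_lt_compat_r (4 * D + 1)) in hst; [|lra].
    replace (eta / (4 * D + 1) * (4 * D + 1)) with eta in hst by (field; lra).
    pose proof (Rabs_pos (s - t)); nra.
  - intros s t h1 h2 h3.
    pose proof (lip s t) as l; rewrite (Rabs_pos_eq (t - s)) in l by lra; lra.
Qed.

Lemma riemannian_dist_crude x y x' y' : in_disc r x y -> in_disc r x' y' ->
  Rbar_le (riemannian_dist S (disc_par r hr x y) (disc_par r hr x' y'))
    (2 * eucl (x' - x) (y' - y)).
Proof.
  intros h h'.
  eapply Rbar_le_trans; [apply riemannian_dist_le, segment_curve; assumption|].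
  apply segment_length_le; try assumption.
  intros t ht; apply Rmult_le_compat_r; [apply eucl_nonneg|].
  apply conf_bounds; now apply disc_segment.
Qed.

Lemma curve_of_length_nonneg p p' l : curve_of_length S p p' l -> 0 <= l.
Proof.
  induction 1 as [|n c p' l hc _ IH]; [lra|].
  unfold S in *.
  rewrite (arc_length_speed k r hr rho_pos n c hc).
  assert (0 <= RInt (speed k c) 0 1); [|lra].
  apply RInt_ge_0; [lra|apply (ex_RInt_speed k r hr rho_pos n); (assumption || lra)|].
  intros t ht; apply (speed_nonneg k r hr rho_pos n); (assumption || lra).
Qed.

Section Scale.

Variables (eps C d : R).
Hypothesis heps : 0 < eps < r.
Hypothesis hC : 0 < C.
Hypothesis hd : 0 < d.
Hypothesis close : chordwise_close eps C d.

(** The chords of a short piece of arc are shorter than the piece, up to [C];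
    short pieces add up to the whole arc by the triangle inequality. *)
Lemma intrinsic_dist_arc n c : C1_arc S n c ->
  (forall t, 0 <= t <= 1 -> eucl (c ax1 t) (c ax2 t) <= eps) ->
  Rbar_le (intrinsic_dist A (Theta (c ax1 0) (c ax2 0)) (Theta (c ax1 1) (c ax2 1)))
    (C * arc_length S n c).
Proof.
  intros hc hin.
  pose (gam := fun t => Theta (c ax1 t) (c ax2 t)).
  unfold S; rewrite (arc_length_upto k r hr rho_pos n c hc).
  rewrite Rmult_minus_distr_l.
  assert (cc : forall i t, continuity_pt (c i) t).
  { intros i t; apply continuity_pt_filterlim, @ex_derive_continuous, hc. }
  assert (mesh : forall e, 0 < e -> exists d', 0 < d' /\ forall s t,
    0 <= s <= 1 -> 0 <= t <= 1 -> Rabs (s - t) < d' ->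
    eucl (c ax1 t - c ax1 s) (c ax2 t - c ax2 s) < e).
  { intros e he.
    destruct (Heine_cor2 (fun t (_ : 0 <= t <= 1) => cc ax1 t)
      (mkposreal (e / 2) ltac:(lra))) as [[d1 hd1] h1].
    destruct (Heine_cor2 (fun t (_ : 0 <= t <= 1) => cc ax2 t)
      (mkposreal (e / 2) ltac:(lra))) as [[d2 hd2] h2].
    exists (Rmin d1 d2); split; [now apply Rmin_glb_lt|].
    intros s t hs ht hst; simpl in h1, h2.
    rewrite Rabs_minus_sym in hst.
    eapply Rle_lt_trans; [apply eucl_le_Rabs|].
    specialize (h1 t s ht hs (Rlt_le_trans _ _ _ hst (Rmin_l _ _))).
    specialize (h2 t s ht hs (Rlt_le_trans _ _ _ hst (Rmin_r _ _))).
    lra. }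
  apply (intrinsic_dist_le_increment A gam (fun t => C * arc_upto k c t)).
  - assumption.
  - intros t ht; apply Theta_in, hc, ht.
  - intros t e ht he.
    destruct (mesh (e / 4) ltac:(lra)) as (d' & hd' & hm).
    exists d'; split; [assumption|]; intros s hs hst.
    eapply Rle_lt_trans; [apply Theta_crude; apply hc; assumption|].
    specialize (hm s t hs ht hst); lra.
  - destruct (mesh d hd) as (d' & hd' & hm).
    apply increment_chain with d'; [assumption| |].
    + intros t ht; apply hA, Theta_in, hc, ht.
    + intros s t h1 h2 h3 hst.
      set (D := eucl (c ax1 t - c ax1 s) (c ax2 t - c ax2 s)).
      assert (near : forall u, s <= u <= t ->
        eucl (c ax1 u - c ax1 s) (c ax2 u - c ax2 s) < d).
      { intros u hu; apply hm; try lra.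
        rewrite Rabs_minus_sym, Rabs_pos_eq; lra. }
      destruct (eucl_nonneg (c ax1 t - c ax1 s) (c ax2 t - c ax2 s)) as [D0|D0];
        fold D in D0.
      * replace (hdist (gam s) (gam t)) with (hdist (gam s) (gam t) / D * D)
          by (field; lra).
        rewrite <- Rmult_minus_distr_l.
        apply (chord_le_arc k r hr rho_pos n); try assumption; try lra.
        { apply Rmult_le_pos; [apply hdist_nonneg|].
          now apply Rlt_le, Rinv_0_lt_compat. }
        intros u hu.
        apply Rmult_le_reg_r with D; [assumption|].
        replace (hdist (gam s) (gam t) / D * D) with (hdist (gam s) (gam t))
          by (field; lra).
        rewrite Rmult_assoc.
        apply close; try (apply hin; lra); apply near; lra.
      * symmetry in D0; apply eucl_eq_0 in D0.
        replace (gam t) with (gam s) by (unfold gam; f_equal; lra).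
        rewrite hdist_refl, <- Rmult_minus_distr_l.
        apply Rmult_le_pos; [lra|].
        rewrite (arc_upto_diff k r hr rho_pos n) by assumption.
        apply RInt_ge_0; [assumption|now apply (ex_RInt_speed k r hr rho_pos n)|].
        intros u hu; apply (speed_nonneg k r hr rho_pos n); [assumption|lra].
Qed.

(** The conformal factor is at least 1/2, hence the factor 2. *)
Lemma arc_confined n c t : C1_arc S n c -> 0 <= t <= 1 ->
  eucl (c ax1 t) (c ax2 t)
    <= eucl (c ax1 0) (c ax2 0) + 2 * arc_length S n c.
Proof.
  intros hc ht.
  eapply Rle_trans; [apply eucl_diff_le with (x := c ax1 0) (y := c ax2 0)|].
  apply Rplus_le_compat_l.
  unfold S; rewrite (arc_length_upto k r hr rho_pos n c hc).
  assert (h : / 2 * eucl (c ax1 t - c ax1 0) (c ax2 t - c ax2 0)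
    <= 1 * (arc_upto k c t - arc_upto k c 0)).
  { apply (chord_le_arc k r hr rho_pos n); try assumption; try lra.
    intros u hu; rewrite Rmult_1_l; apply conf_bounds, hc; lra. }
  assert (0 <= arc_upto k c 1 - arc_upto k c t); [|lra].
  rewrite (arc_upto_diff k r hr rho_pos n) by (assumption || lra).
  apply RInt_ge_0; [lra|apply (ex_RInt_speed k r hr rho_pos n); (assumption || lra)|].
  intros u hu; apply (speed_nonneg k r hr rho_pos n); [assumption|lra].
Qed.

Lemma arc_length_nonneg n c : C1_arc S n c -> 0 <= arc_length S n c.
Proof.
  intros hc; rewrite <- (Rplus_0_r (arc_length _ _ _)).
  eapply curve_of_length_nonneg, curve_cons; [exact hc|apply curve_nil].
Qed.

Lemma intrinsic_dist_curve p p' l : curve_of_length S p p' l ->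
  eucl (px p) (py p) + 2 * l <= eps ->
  Rbar_le (intrinsic_dist A (Theta (px p) (py p)) (Theta (px p') (py p'))) (C * l).
Proof.
  induction 1 as [p|n c p' l hc hcur IH]; intros hl.
  - eapply Rbar_le_trans; [apply intrinsic_dist_crude; apply in_disc_px_py|].
    unfold Rminus; rewrite !Rplus_opp_r, eucl_0; simpl; lra.
  - pose proof (curve_of_length_nonneg _ _ _ hcur) as l0.
    pose proof (arc_length_nonneg n c hc) as a0.
    assert (d0 : in_disc r (c ax1 0) (c ax2 0)) by (apply hc; lra).
    assert (d1 : in_disc r (c ax1 1) (c ax2 1)) by (apply hc; lra).
    simpl in hl, IH |- *; revert hl IH.
    rewrite (px_disc_par r hr (c ax1 0)), (py_disc_par r hr (c ax1 0)) by assumption.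
    rewrite (px_disc_par r hr (c ax1 1)), (py_disc_par r hr (c ax1 1)) by assumption.
    intros hl IH.
    rewrite Rmult_plus_distr_l.
    apply intrinsic_dist_triangle with (Theta (c ax1 1) (c ax2 1)); [assumption| |].
    + apply intrinsic_dist_arc; [assumption|].
      intros t ht; pose proof (arc_confined n c t hc ht); lra.
    + apply IH.
      pose proof (arc_confined n c 1 hc ltac:(lra)); lra.
Qed.

(** A rectifiable curve of [A] need not be piecewise C^1 in the chart, but the
    polygon of segments through finely spaced points of it is, and each segment
    is no longer, up to [C], than the chord of the curve. *)
Lemma riemannian_dist_lifted_curve p p' l gam (X Y : R -> R) :
  curve_from_to A p p' l gam ->
  (forall t, 0 <= t <= 1 -> eucl (X t) (Y t) <= eps /\ Theta (X t) (Y t) = gam t) ->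
  Rbar_le (riemannian_dist S (disc_par r hr (X 0) (Y 0)) (disc_par r hr (X 1) (Y 1)))
    (C * l).
Proof.
  intros (cg & hg & _ & _ & len) hXY.
  assert (inr : forall t, 0 <= t <= 1 -> in_disc r (X t) (Y t)).
  { intros t ht; apply in_disc_eucl; [assumption|].
    destruct (hXY t ht); lra. }
  destruct (hdist_mesh gam (d / 4) cg (fun t ht => hA _ (hg t ht)) ltac:(lra))
    as (d' & hd' & hm).
  destruct (INR_unbounded (/ d')) as [n hn].
  pose (N := INR (Datatypes.S n)).
  assert (hN : 0 < N) by (apply lt_0_INR; lia).
  assert (hNd : / N < d').
  { unfold N in *; rewrite S_INR in *.
    rewrite <- (Rinv_inv d').
    apply Rinv_lt_contravar; [|lra].
    apply Rmult_lt_0_compat; [now apply Rinv_0_lt_compat|assumption]. }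
  pose (t := fun i => Rmin 1 (INR i / N)).
  assert (t0 : t 0%nat = 0).
  { unfold t; simpl; unfold Rdiv; rewrite Rmult_0_l; apply Rmin_right; lra. }
  assert (t1 : t (Datatypes.S n) = 1).
  { unfold t; fold N; rewrite Rmin_left; [reflexivity|right; field; lra]. }
  assert (step : forall i, t i <= t (Datatypes.S i) <= t i + / N).
  { intros i; unfold t.
    replace (INR (Datatypes.S i) / N) with (INR i / N + / N)
      by (rewrite S_INR; field; lra).
    pose proof (Rinv_0_lt_compat _ hN).
    unfold Rmin; repeat destruct Rle_dec; lra. }
  assert (part : partition01 t).
  { split; [lra|split; intros i; [apply step|apply Rmin_l]]. }
  destruct (curve_of_length_chain S (fun i => disc_par r hr (X (t i)) (Y (t i)))
    (fun i => C * hdist (gam (t i)) (gam (t (Datatypes.S i)))) n) as (L & hL & hb).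
  { intros i _.
    pose proof (partition01_range t i part) as ri.
    pose proof (partition01_range t (Datatypes.S i) part) as ri'.
    destruct (hXY (t i) ri) as [e1 g1].
    destruct (hXY (t (Datatypes.S i)) ri') as [e2 g2].
    eexists; split; [apply segment_curve; apply inr; assumption|].
    rewrite <- g1, <- g2.
    assert (near : eucl (X (t (Datatypes.S i)) - X (t i))
      (Y (t (Datatypes.S i)) - Y (t i)) < d).
    { destruct (Theta_crude _ _ _ _ (inr _ ri) (inr _ ri')) as [h _].
      eapply Rle_lt_trans; [exact h|].
      rewrite g1, g2.
      assert (hdist (gam (t i)) (gam (t (Datatypes.S i))) < d / 4); [|lra].
      apply hm; try assumption.
      destruct (step i); rewrite Rabs_minus_sym, Rabs_pos_eq; lra. }
    apply segment_length_le; try assumption; try (apply inr; assumption).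
    intros u hu.
    set (x := X (t i)) in *; set (y := Y (t i)) in *.
    set (x' := X (t (Datatypes.S i))) in *; set (y' := Y (t (Datatypes.S i))) in *.
    apply close; try assumption.
    - replace (x + u * (x' - x)) with ((1 - u) * x + u * x') by ring.
      replace (y + u * (y' - y)) with ((1 - u) * y + u * y') by ring.
      eapply Rle_trans; [apply eucl_triangle|].
      rewrite !eucl_scal by lra; nra.
    - replace (x + u * (x' - x) - x) with (u * (x' - x)) by ring.
      replace (y + u * (y' - y) - y) with (u * (y' - y)) by ring.
      rewrite eucl_scal by lra.
      pose proof (eucl_nonneg (x' - x) (y' - y)); nra. }
  rewrite t0, t1 in hL.
  eapply Rbar_le_trans; [apply riemannian_dist_le, hL|].
  simpl; eapply Rle_trans; [exact hb|].
  pose proof (curve_length_ge gam l n t len part) as hl.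
  change (sum_n (fun i => scal C (hdist (gam (t i)) (gam (t (Datatypes.S i))))) n
    <= C * l).
  rewrite sum_n_scal_l.
  apply Rmult_le_compat_l; [lra|exact hl].
Qed.

End Scale.

Definition ball_at (eps : R) (p : E3) : Prop :=
  A p /\ Rbar_lt (intrinsic_dist A q p) eps.

Lemma ball_at_hdist eps p : ball_at eps p -> hdist q p < eps.
Proof.
  intros [_ h].
  pose proof (Rbar_le_lt_trans _ _ _ (intrinsic_dist_ge_hdist A q p) h) as h'.
  exact h'.
Qed.

Lemma near_eucl eps x y : in_disc r x y -> hdist q (Theta x y) <= eps ->
  eucl x y <= 4 * eps.
Proof.
  intros h hp.
  destruct (Theta_crude 0 0 x y (in_disc_0 r hr) h) as [h1 _].
  rewrite Theta_0, !Rminus_0_r in h1; lra.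
Qed.

Lemma ball_at_open eps :
  open_in S (fun m => ball_at eps (Theta (px m) (py m))).
Proof.
  apply (open_in_disc k r hr (fun x y => ball_at eps (Theta x y))).
  intros x y hxy [_ hlt].
  pose proof (intrinsic_dist_crude 0 0 x y (in_disc_0 r hr) hxy) as h.
  rewrite Theta_0 in h.
  destruct (Rbar_finite _ _ _ (intrinsic_dist_ge_hdist A q (Theta x y)) h)
    as (D & hD & _).
  rewrite hD in hlt; simpl in hlt.
  generalize (locally_2d_and _ _ _ _
    (locally_2d_eucl_lt x y ((eps - D) / 4) ltac:(lra))
    (locally_2d_in_disc r x y hr hxy)).
  apply locally_2d_impl, locally_2d_forall; intros a b [h1 h2].
  split; [now apply Theta_in|].
  apply Rbar_le_lt_trans with (D + 4 * eucl (a - x) (b - y)); [|simpl; lra].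
  apply intrinsic_dist_triangle with (Theta x y); [assumption| |].
  - rewrite hD; apply Rbar_le_refl.
  - now apply intrinsic_dist_crude.
Qed.

(** Points of the ball have coordinates of norm at most [4 eps], hence mutual
    distances at most [32 eps] on both sides. Curves that nearly realize such a
    distance, of length less than [33 eps], stay at [hdist] less than [34 eps]
    from [q], hence in the disc of radius [140 eps], where chords compare with the
    constant [C]. *)
Lemma ball_biLipschitz eps C d : 0 < eps -> 140 * eps < r -> 34 * eps < r0 ->
  0 < C -> 0 < d -> chordwise_close (140 * eps) C d ->
  exists (f : E3 -> carrier S) (g : carrier S -> E3),
    (forall p, ball_at eps p -> ball_at eps (Theta (px (f p)) (py (f p))) /\ g (f p) = p) /\
    (forall m, ball_at eps (Theta (px m) (py m)) -> ball_at eps (g m) /\ f (g m) = m) /\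
    lipschitz_on (ball_at eps) (intrinsic_dist A) (riemannian_dist S) C f /\
    lipschitz_on (fun m => ball_at eps (Theta (px m) (py m)))
      (riemannian_dist S) (intrinsic_dist A) C g.
Proof.
  intros he hr1 hr2 hC hd close.
  pose (th := fun m : disc_point r => Theta (px m) (py m)).
  pose (f := fun p => epsilon (inhabits (disc_par r hr 0 0)) (fun m => th m = p)).
  assert (lift : forall p, A p -> hdist q p < r0 -> th (f p) = p).
  { intros p hp hq; unfold f; apply epsilon_spec.
    destruct (Theta_onto p hp hq) as (x & y & hxy & E).
    exists (disc_par r hr x y); unfold th.
    now rewrite px_disc_par, py_disc_par. }
  assert (inj : forall m m', th m = th m' -> m = m').
  { intros m m' E.
    destruct (Theta_crude _ _ _ _ (in_disc_px_py r m) (in_disc_px_py r m')) as [h _].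
    unfold th in E; rewrite E, hdist_refl in h.
    pose proof (eucl_nonneg (px m' - px m) (py m' - py m)).
    destruct (eucl_eq_0 (px m' - px m) (py m' - py m)); [lra|].
    apply disc_point_eq; lra. }
  assert (lift_ball : forall p, ball_at eps p -> th (f p) = p).
  { intros p hp; apply lift; [apply hp|].
    pose proof (ball_at_hdist _ _ hp); lra. }
  assert (small : forall m, ball_at eps (th m) -> eucl (px m) (py m) <= 4 * eps).
  { intros m hm; apply near_eucl; [apply in_disc_px_py|].
    apply Rlt_le, ball_at_hdist, hm. }
  assert (diff : forall m m', ball_at eps (th m) -> ball_at eps (th m') ->
    eucl (px m' - px m) (py m' - py m) <= 8 * eps).
  { intros m m' hm hm'.
    pose proof (small m hm); pose proof (small m' hm').
    pose proof (eucl_triangle (px m') (py m') (- px m) (- py m)) as t.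
    rewrite eucl_opp in t; unfold Rminus; lra. }
  exists f, th.
  split; [|split; [|split]].
  - intros p hp; split; [|now apply lift_ball].
    change (ball_at eps (th (f p))); now rewrite lift_ball.
  - intros m hm; split; [exact hm|].
    apply inj, lift_ball, hm.
  - intros p p' hp hp'.
    pose proof (lift_ball p hp) as E; pose proof (lift_ball p' hp') as E'.
    set (m := f p) in *; set (m' := f p') in *.
    assert (bm : ball_at eps (th m)) by now rewrite E.
    assert (bm' : ball_at eps (th m')) by now rewrite E'.
    pose proof (diff m m' bm bm') as hdiff.
    destruct (Rbar_finite (intrinsic_dist A p p') (hdist p p')
      (4 * eucl (px m' - px m) (py m' - py m))) as (D & hD & hD1 & hD2).
    { apply intrinsic_dist_ge_hdist. }
    { rewrite <- E, <- E'; apply intrinsic_dist_crude; apply in_disc_px_py. }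
    rewrite hD; change (Rbar_mult C D) with (Finite (C * D)).
    apply Rbar_le_limit with eps; try assumption.
    intros b hb.
    destruct (intrinsic_dist_approx A p p' D b) as (l & gam & hl & cur);
      [rewrite hD; apply Rbar_le_refl|lra|].
    pose proof cur as (cg & hg & g0 & g1 & len).
    assert (hin : forall t, 0 <= t <= 1 -> hdist q (gam t) < 34 * eps).
    { intros t ht.
      pose proof (curve_length_hdist gam l t len ht) as h.
      rewrite g0 in h.
      pose proof (ball_at_hdist _ _ hp).
      pose proof (hdist_triangle q p (gam t)) as tr.
      assert (H3 q).
      { rewrite <- Theta_0; apply hA, Theta_in, in_disc_0, hr. }
      assert (H3 p) by apply hA, hp.
      assert (H3 (gam t)) by apply hA, hg, ht.
      specialize (tr ltac:(assumption) ltac:(assumption) ltac:(assumption)).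
      lra. }
    assert (th_gam : forall t, 0 <= t <= 1 -> th (f (gam t)) = gam t).
    { intros t ht; apply lift; [now apply hg|].
      specialize (hin t ht); lra. }
    apply Rbar_le_trans with (C * l); [|simpl; apply Rmult_le_compat_l; lra].
    pose proof (riemannian_dist_lifted_curve (140 * eps) C d ltac:(lra) hC hd close
      p p' l gam (fun t => px (f (gam t))) (fun t => py (f (gam t))) cur) as fin.
    cbv beta in fin; rewrite !disc_par_px_py, g0, g1 in fin.
    apply fin; intros t ht; split; [|apply (th_gam t ht)].
    replace (140 * eps) with (4 * (35 * eps)) by ring.
    apply near_eucl; [apply in_disc_px_py|].
    change (hdist q (th (f (gam t))) <= 35 * eps).
    rewrite th_gam by assumption; specialize (hin t ht); lra.
  - intros m m' hm hm'.
    pose proof (diff m m' hm hm') as hdiff; pose proof (small m hm) as hs.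
    destruct (Rbar_finite (riemannian_dist S m m') 0
      (2 * eucl (px m' - px m) (py m' - py m))) as (D & hD & hD1 & hD2).
    { apply riemannian_dist_glb; intros l hl.
      exact (curve_of_length_nonneg _ _ _ hl). }
    { rewrite <- (disc_par_px_py r hr m) at 1.
      rewrite <- (disc_par_px_py r hr m') at 1.
      apply riemannian_dist_crude; apply in_disc_px_py. }
    rewrite hD; change (Rbar_mult C D) with (Finite (C * D)).
    apply Rbar_le_limit with eps; try assumption.
    intros b hb.
    destruct (Glb_Rbar_approx (curve_of_length S m m') D b) as (l & cur & hl).
    { change (Rbar_le (riemannian_dist S m m') D); rewrite hD; apply Rbar_le_refl. }
    { lra. }
    apply Rbar_le_trans with (C * l); [|simpl; apply Rmult_le_compat_l; lra].
    apply (intrinsic_dist_curve (140 * eps) C d); try assumption.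
    lra.
Qed.

Hypothesis Theta_fine : forall eta, 0 < eta -> exists eps0, 0 < eps0 /\
  forall eps, 0 < eps < eps0 -> exists d, 0 < d /\
    chordwise_close eps (1 + eta * eps ^ 2) d.

Theorem biLipschitz_of_chart :
  exists rem : R -> R,
    filterlim (fun eps => rem eps / eps ^ 2) (at_right 0) (locally 0) /\
    exists eps0 : R, 0 < eps0 /\
      forall eps, 0 < eps < eps0 ->
        exists U : carrier S -> Prop,
          open_in S U /\
          biLipschitz_lt (ball_at eps) (intrinsic_dist A)
                         U (riemannian_dist S) (1 + rem eps).
Proof.
  pose (Q := fun eta eps => exists U : carrier S -> Prop, open_in S U /\
    biLipschitz_lt (ball_at eps) (intrinsic_dist A) U (riemannian_dist S)
      (1 + eta * eps ^ 2)).
  destruct (vanishing_constant Q) as (c & hc & eps0 & he0 & hQ).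
  - intros eta eta' eps hle (U & hU & f & g & L & h1 & h2 & [h3 h4] & h5).
    exists U; split; [assumption|].
    exists f, g, L; repeat split; try apply h1; try apply h2; try apply h5;
      try assumption.
    pose proof (pow2_ge_0 eps); nra.
  - intros eta he.
    (* the factor 2 makes the inequality between the constants strict *)
    pose (eta' := eta / (2 * 140 ^ 2)).
    assert (he' : 0 < eta') by (unfold eta'; lra).
    destruct (Theta_fine eta' he') as (e1 & he1 & hf).
    exists (Rmin (e1 / 140) (Rmin (r / 140) (r0 / 140))); split.
    { repeat apply Rmin_glb_lt; lra. }
    intros eps [hp hlt].
    pose proof (Rlt_le_trans _ _ _ hlt (Rmin_l _ _)) as l1.
    pose proof (Rlt_le_trans _ _ _ hlt (Rmin_r _ _)) as l2.
    pose proof (Rlt_le_trans _ _ _ l2 (Rmin_l _ _)) as l3.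
    pose proof (Rlt_le_trans _ _ _ l2 (Rmin_r _ _)) as l4.
    destruct (hf (140 * eps)) as (d & hd & close); [lra|].
    assert (hpos : 0 < eps ^ 2) by now apply pow_lt.
    replace (1 + eta' * (140 * eps) ^ 2) with (1 + eta / 2 * eps ^ 2) in close
      by (unfold eta'; field).
    destruct (ball_biLipschitz eps (1 + eta / 2 * eps ^ 2) d)
      as (f & g & h1 & h2 & h3 & h4); try assumption; try lra; try nra.
    exists (fun m => ball_at eps (Theta (px m) (py m))).
    split; [apply ball_at_open|].
    exists f, g, (1 + eta / 2 * eps ^ 2).
    split; [exact h1|]; split; [exact h2|]; split; [nra|split; assumption].
  - exists (fun eps => c eps * eps ^ 2); split.
    + apply (filterlim_ext_loc c); [|exact hc].
      exists (mkposreal 1 Rlt_0_1); intros y _ hy.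
      field; lra.
    + exists eps0; split; [assumption|exact hQ].
Qed.

End Transfer.

(** * Orders of magnitude along a filter *)

(** The filters used here run over configurations of several variables, whose
    size is controlled by one of them, [eps]: orders are measured in [eps]. *)
Definition bigO {T} (F : (T -> Prop) -> Prop) (eps : T -> R) (n : nat) (f : T -> R) :=
  exists C, F (fun t => Rabs (f t) <= C * eps t ^ n).

Definition litO {T} (F : (T -> Prop) -> Prop) (eps : T -> R) (n : nat) (f : T -> R) :=
  forall eta, 0 < eta -> F (fun t => Rabs (f t) <= eta * eps t ^ n).

Section Orders.

Context {T : Type} {F : (T -> Prop) -> Prop} {FF : Filter F} {eps : T -> R}.
Hypothesis eps_small : forall e, 0 < e -> F (fun t => 0 < eps t < e).

Lemma bigO_ext n (f g : T -> R) : F (fun t => f t = g t) ->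
  bigO F eps n f -> bigO F eps n g.
Proof.
  intros h [C hC]; exists C.
  generalize (filter_and _ _ h hC); apply filter_imp.
  now intros t [<- ?].
Qed.

Lemma litO_ext n (f g : T -> R) : F (fun t => f t = g t) ->
  litO F eps n f -> litO F eps n g.
Proof.
  intros h hf eta he.
  generalize (filter_and _ _ h (hf eta he)); apply filter_imp.
  now intros t [<- ?].
Qed.

Lemma bigO_weaken m n f : (n <= m)%nat -> bigO F eps m f -> bigO F eps n f.
Proof.
  intros hmn [C hC]; exists (Rabs C).
  generalize (filter_and _ _ hC (eps_small 1 Rlt_0_1)); apply filter_imp.
  intros t [h [e0 e1]].
  apply Rle_trans with (1 := h).
  apply Rle_trans with (Rabs C * eps t ^ m).
  - apply Rmult_le_compat_r; [apply pow_le; lra|apply Rle_abs].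
  - apply Rmult_le_compat_l; [apply Rabs_pos|].
    replace m with (n + (m - n))%nat by lia; rewrite pow_add.
    rewrite <- (Rmult_1_r (eps t ^ n)) at 2.
    apply Rmult_le_compat_l; [apply pow_le; lra|].
    rewrite <- (pow1 (m - n)); apply pow_incr; lra.
Qed.

Lemma bigO_const c : bigO F eps 0 (fun _ => c).
Proof.
  exists (Rabs c); apply filter_forall; intros t; simpl; lra.
Qed.

Lemma bigO_opp n f : bigO F eps n f -> bigO F eps n (fun t => - f t).
Proof.
  intros [C hC]; exists C; revert hC; apply filter_imp; intros t.
  now rewrite Rabs_Ropp.
Qed.

Lemma bigO_plus_same n f g : bigO F eps n f -> bigO F eps n g ->
  bigO F eps n (fun t => f t + g t).
Proof.
  intros [C hC] [D hD]; exists (C + D).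
  generalize (filter_and _ _ hC hD); apply filter_imp; intros t [h1 h2].
  eapply Rle_trans; [apply Rabs_triang|lra].
Qed.

Lemma bigO_plus n m f g : bigO F eps n f -> bigO F eps m g ->
  bigO F eps (Nat.min n m) (fun t => f t + g t).
Proof.
  intros hf hg; apply bigO_plus_same.
  - apply bigO_weaken with n; [lia|assumption].
  - apply bigO_weaken with m; [lia|assumption].
Qed.

Lemma bigO_minus n m f g : bigO F eps n f -> bigO F eps m g ->
  bigO F eps (Nat.min n m) (fun t => f t - g t).
Proof.
  intros hf hg; apply (bigO_plus n m f (fun t => - g t)); [assumption|].
  now apply bigO_opp.
Qed.

Lemma bigO_mult n m f g : bigO F eps n f -> bigO F eps m g ->
  bigO F eps (n + m) (fun t => f t * g t).
Proof.
  intros [C hC] [D hD]; exists (C * D).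
  generalize (filter_and _ _ hC hD); apply filter_imp; intros t [h1 h2].
  rewrite Rabs_mult, pow_add.
  replace (C * D * (eps t ^ n * eps t ^ m))
    with (C * eps t ^ n * (D * eps t ^ m)) by ring.
  apply Rmult_le_compat; (apply Rabs_pos || assumption).
Qed.

Lemma bigO_pow2 n f : bigO F eps n f -> bigO F eps (n + n) (fun t => f t ^ 2).
Proof.
  intros h; apply (bigO_ext _ (fun t => f t * f t)).
  - apply filter_forall; intros t; ring.
  - now apply bigO_mult.
Qed.

Lemma bigO_pow3 n f : bigO F eps n f ->
  bigO F eps (n + (n + n)) (fun t => f t ^ 3).
Proof.
  intros h; apply (bigO_ext _ (fun t => f t * (f t * f t))).
  - apply filter_forall; intros t; ring.
  - now repeat apply bigO_mult.
Qed.

Lemma litO_of_bigO n m f : (n < m)%nat -> bigO F eps m f -> litO F eps n f.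
Proof.
  intros hnm hf eta he.
  destruct (bigO_weaken m (S n) f hnm hf) as [C hC].
  pose proof (Rabs_pos C) as c0.
  assert (hq : 0 < eta / (Rabs C + 1)) by (apply Rdiv_lt_0_compat; lra).
  generalize (filter_and _ _ hC (eps_small _ hq)); apply filter_imp.
  intros t [h [e0 e1]].
  apply Rle_trans with (1 := h).
  rewrite <- tech_pow_Rmult, <- Rmult_assoc.
  apply Rmult_le_compat_r; [apply pow_le; lra|].
  apply (Rmult_lt_compat_r (Rabs C + 1)) in e1; [|lra].
  replace (eta / (Rabs C + 1) * (Rabs C + 1)) with eta in e1 by (field; lra).
  pose proof (Rle_abs C); nra.
Qed.

Lemma bigO_of_litO n f : litO F eps n f -> bigO F eps n f.
Proof. intros h; exists 1; apply h, Rlt_0_1. Qed.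

Lemma litO_plus n f g : litO F eps n f -> litO F eps n g ->
  litO F eps n (fun t => f t + g t).
Proof.
  intros hf hg eta he.
  assert (he2 : 0 < eta / 2) by lra.
  generalize (filter_and _ _ (hf _ he2) (hg _ he2)).
  apply filter_imp; intros t [h1 h2].
  eapply Rle_trans; [apply Rabs_triang|lra].
Qed.

Lemma litO_mult n m f g : litO F eps n f -> bigO F eps m g ->
  litO F eps (n + m) (fun t => f t * g t).
Proof.
  intros hf [C hC] eta he.
  pose proof (Rabs_pos C) as c0.
  assert (hq : 0 < eta / (Rabs C + 1)) by (apply Rdiv_lt_0_compat; lra).
  generalize (filter_and _ _ (filter_and _ _ hC (hf _ hq)) (eps_small 1 Rlt_0_1)).
  apply filter_imp; intros t [[h1 h2] [e0 _]].
  rewrite Rabs_mult, pow_add.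
  assert (0 < eps t ^ n) by now apply pow_lt.
  assert (0 < eps t ^ m) by now apply pow_lt.
  apply Rle_trans with
    (eta / (Rabs C + 1) * eps t ^ n * ((Rabs C + 1) * eps t ^ m)).
  - apply Rmult_le_compat; try apply Rabs_pos; [assumption|].
    apply Rle_trans with (1 := h1).
    apply Rmult_le_compat_r; [lra|]; pose proof (Rle_abs C); lra.
  - right; field; lra.
Qed.

Lemma bigO_bound f : litO F eps 0 f -> forall e, 0 < e ->
  F (fun t => Rabs (f t) <= e).
Proof.
  intros h e he; generalize (h e he); apply filter_imp; intros t; simpl; lra.
Qed.

Lemma bigO_taylor n (phi : R -> R) f :
  (forall x, Rabs x <= / 2 -> Rabs (phi x) <= 2 * x ^ 2) ->
  (0 < n)%nat -> bigO F eps n f -> bigO F eps (n + n) (fun t => phi (f t)).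
Proof.
  intros hphi hn hf.
  assert (hp : 0 < / 2) by lra.
  pose proof (bigO_bound f (litO_of_bigO 0 n f hn hf) _ hp) as hb.
  destruct (bigO_pow2 n f hf) as [C hC].
  exists (2 * C).
  generalize (filter_and _ _ hb hC); apply filter_imp; intros t [h1 h2].
  apply Rle_trans with (1 := hphi _ h1).
  pose proof (Rle_abs (f t ^ 2)); lra.
Qed.

End Orders.

Lemma inv_taylor x : Rabs x <= / 2 -> Rabs (/ (1 + x) - (1 - x)) <= 2 * x ^ 2.
Proof.
  intros h; apply Rabs_le_between in h.
  replace (/ (1 + x) - (1 - x)) with (x ^ 2 * / (1 + x)) by (field; lra).
  assert (0 < / (1 + x) <= 2).
  { split; [apply Rinv_0_lt_compat; lra|].
    rewrite <- (Rinv_inv 2); apply Rinv_le_contravar; lra. }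
  pose proof (pow2_ge_0 x).
  rewrite Rabs_pos_eq; [nra|apply Rmult_le_pos; lra].
Qed.

Lemma exp_taylor x : Rabs x <= / 2 -> Rabs (exp x - (1 + x)) <= 2 * x ^ 2.
Proof.
  intros h; apply Rabs_le_between in h.
  pose proof (exp_ineq1_le x) as h1.
  pose proof (exp_ineq1_le (- x)) as h2.
  rewrite exp_Ropp in h2.
  pose proof (exp_pos x) as h3.
  assert (h4 : exp x * (1 - x) <= 1).
  { apply (Rmult_le_compat_l (exp x)) in h2; [|lra].
    rewrite Rinv_r in h2 by lra; lra. }
  apply Rabs_le; split; nra.
Qed.

(** Degrees of sums and products of functions whose orders are in the context
    are computed; [bigO_tac] closes the goal by comparing degrees. *)
Ltac bigO_infer :=
  first [eassumption | lazymatch goal with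
  | |- bigO _ _ _ (fun t => @?f t + @?g t) =>
      eapply (bigO_plus ltac:(eassumption)); [bigO_infer|bigO_infer]
  | |- bigO _ _ _ (fun t => @?f t - @?g t) =>
      eapply (bigO_minus ltac:(eassumption)); [bigO_infer|bigO_infer]
  | |- bigO _ _ _ (fun t => @?f t * @?g t) =>
      eapply bigO_mult; [bigO_infer|bigO_infer]
  | |- bigO _ _ _ (fun t => - @?f t) => eapply bigO_opp; bigO_infer
  | |- bigO _ _ _ (fun t => @?f t ^ 2) => eapply bigO_pow2; bigO_infer
  | |- bigO _ _ _ (fun t => @?f t ^ 3) => eapply bigO_pow3; bigO_infer
  | |- bigO _ _ _ (fun _ => ?c) => apply bigO_const
  end].

Ltac bigO_tac :=
  eapply bigO_weaken; [eassumption| |bigO_infer]; lia.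

(** * Gradients of convex functions *)

Definition quad (a b c x y : R) : R := a * x ^ 2 + 2 * b * x * y + c * y ^ 2.

Definition bilin (a b c x y v w : R) : R := (a * x + b * y) * v + (b * x + c * y) * w.

Definition quad_bound (a b c : R) : R := Rabs a + 2 * Rabs b + Rabs c.

Lemma quad_bound_nonneg a b c : 0 <= quad_bound a b c.
Proof.
  unfold quad_bound; pose proof (Rabs_pos a); pose proof (Rabs_pos b);
    pose proof (Rabs_pos c); lra.
Qed.

Lemma quad_le a b c x y : Rabs (quad a b c x y) <= quad_bound a b c * eucl x y ^ 2.
Proof.
  rewrite eucl_sqr; unfold quad, quad_bound.
  pose proof (pow2_ge_0 x) as hx; pose proof (pow2_ge_0 y) as hy.
  assert (hxy : Rabs (2 * (x * y)) <= x ^ 2 + y ^ 2).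
  { apply Rabs_le; pose proof (pow2_ge_0 (x + y)); pose proof (pow2_ge_0 (x - y)).
    split; lra. }
  replace (2 * b * x * y) with (b * (2 * (x * y))) by ring.
  eapply Rle_trans; [apply Rabs_triang|].
  eapply Rle_trans; [apply Rplus_le_compat_r, Rabs_triang|].
  rewrite !Rabs_mult, (Rabs_pos_eq (x ^ 2)), (Rabs_pos_eq (y ^ 2)) by assumption.
  rewrite Rabs_mult in hxy.
  pose proof (Rabs_pos a); pose proof (Rabs_pos b); pose proof (Rabs_pos c).
  assert (hb : Rabs b * (Rabs 2 * Rabs (x * y)) <= Rabs b * (x ^ 2 + y ^ 2))
    by now apply Rmult_le_compat_l.
  rewrite Rabs_mult in hb.
  nra.
Qed.

Lemma quad_step a b c x y s v w :
  quad a b c (x + s * v) (y + s * w)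
    = quad a b c x y + s * (2 * bilin a b c x y v w + s * quad a b c v w).
Proof. unfold quad, bilin; ring. Qed.

Definition convex_on_disc (r : R) (h : R -> R -> R) : Prop :=
  forall x y x' y' s,
    x ^ 2 + y ^ 2 < r ^ 2 -> x' ^ 2 + y' ^ 2 < r ^ 2 -> 0 <= s <= 1 ->
    h (s * x + (1 - s) * x') (s * y + (1 - s) * y')
      <= s * h x y + (1 - s) * h x' y'.

Section ConvexGradient.

Variables (h : R -> R -> R) (r a b c : R).
Hypothesis hr : 0 < r.
Hypothesis h_convex : convex_on_disc r h.
Let w x y := h x y - 1 - quad a b c x y.
Hypothesis h_quad : forall eta, 0 < eta -> exists del, 0 < del /\
  forall x y, x ^ 2 + y ^ 2 < del ^ 2 -> Rabs (w x y) <= eta * (x ^ 2 + y ^ 2).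

(** A chord of [h] is less steep than the next one in the same direction. Over a
    next chord of length [tau * eps], the error of order [o(eps^2)] in the values
    of [h] costs [o(eps) / tau] in the slope, and the curvature of the quadratic
    part costs [O(tau * eps)]. *)
Lemma convex_gradient_upper eta : 0 < eta -> exists eps0, 0 < eps0 /\
  forall eps x y x' y', 0 < eps < eps0 -> eucl x y <= eps -> eucl x' y' <= eps ->
    w x' y' - w x y
      <= eucl (x' - x) (y' - y)
         * (eta * eps + quad_bound a b c * eucl (x' - x) (y' - y)).
Proof.
  intros he.
  pose proof (quad_bound_nonneg a b c) as hC; set (C := quad_bound a b c) in *.
  pose (tau := Rmin 1 (eta / (2 * (C + 1)))).
  assert (tau0 : 0 < tau).
  { apply Rmin_glb_lt; [lra|apply Rdiv_lt_0_compat; lra]. }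
  assert (tau1 : tau <= 1) by apply Rmin_l.
  assert (tauC : C * tau <= eta / 2).
  { apply Rle_trans with ((C + 1) * tau); [nra|].
    apply Rle_trans with ((C + 1) * (eta / (2 * (C + 1)))).
    - apply Rmult_le_compat_l; [lra|apply Rmin_r].
    - right; field; lra. }
  pose (eta1 := eta * tau / 16).
  assert (he1 : 0 < eta1) by (unfold eta1; nra).
  destruct (h_quad eta1 he1) as (del & hdel & hw).
  exists (Rmin (del / 2) (r / 2)); split; [apply Rmin_glb_lt; lra|].
  intros eps x y x' y' [hp hlt] hx hx'.
  pose proof (Rlt_le_trans _ _ _ hlt (Rmin_l _ _)) as l1.
  pose proof (Rlt_le_trans _ _ _ hlt (Rmin_r _ _)) as l2.
  set (D := eucl (x' - x) (y' - y)).
  destruct (eucl_nonneg (x' - x) (y' - y)) as [D0|D0]; fold D in D0.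
  2: { rewrite <- D0, Rmult_0_l; symmetry in D0; apply eucl_eq_0 in D0 as [].
       replace x' with x by lra; replace y' with y by lra; lra. }
  pose (sig := tau * eps).
  assert (sig0 : 0 < sig) by now apply Rmult_lt_0_compat.
  assert (sig1 : sig <= eps) by (unfold sig; nra).
  pose (x2 := x' + sig / D * (x' - x)); pose (y2 := y' + sig / D * (y' - y)).
  assert (hx2 : eucl x2 y2 <= 2 * eps).
  { eapply Rle_trans; [apply eucl_triangle|].
    rewrite eucl_scal by (apply Rlt_le, Rdiv_lt_0_compat; assumption).
    fold D; replace (sig / D * D) with sig by (field; lra); lra. }
  assert (wb : forall v1 v2, eucl v1 v2 <= 2 * eps -> Rabs (w v1 v2) <= 4 * eta1 * eps ^ 2).
  { intros v1 v2 hv; pose proof (eucl_nonneg v1 v2).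
    eapply Rle_trans; [apply hw; apply eucl_lt; lra|].
    rewrite <- eucl_sqr.
    replace (4 * eta1 * eps ^ 2) with (eta1 * (2 * eps) ^ 2) by ring.
    apply Rmult_le_compat_l; [lra|apply pow_incr; lra]. }
  assert (inr : forall v1 v2, eucl v1 v2 <= 2 * eps -> v1 ^ 2 + v2 ^ 2 < r ^ 2).
  { intros v1 v2 hv; apply eucl_lt; lra. }
  assert (conv : h x' y' * (sig + D) <= sig * h x y + D * h x2 y2).
  { assert (hs : 0 <= sig / (sig + D) <= 1).
    { split; [apply Rlt_le, Rdiv_lt_0_compat; lra|].
      apply Rmult_le_reg_r with (sig + D); [lra|].
      replace (sig / (sig + D) * (sig + D)) with sig by (field; lra); lra. }
    pose proof (h_convex x y x2 y2 _ (inr x y ltac:(lra)) (inr x2 y2 hx2) hs) as cv.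
    replace (sig / (sig + D) * x + (1 - sig / (sig + D)) * x2) with x' in cv
      by (unfold x2; field; lra).
    replace (sig / (sig + D) * y + (1 - sig / (sig + D)) * y2) with y' in cv
      by (unfold y2; field; lra).
    apply (Rmult_le_compat_r (sig + D)) in cv; [|lra].
    apply Rle_trans with (1 := cv); right; field; lra. }
  pose proof (wb x2 y2 hx2) as w2; pose proof (wb x' y' ltac:(lra)) as w1.
  apply Rabs_le_between in w1, w2.
  pose proof (quad_le a b c (x' - x) (y' - y)) as q; fold C D in q.
  apply Rabs_le_between in q.
  assert (E2 : D * quad a b c x2 y2 = D * quad a b c x' y'
    + sig * (2 * bilin a b c x' y' (x' - x) (y' - y))
    + sig ^ 2 * (quad a b c (x' - x) (y' - y) / D)).
  { unfold x2, y2; rewrite quad_step; field; lra. }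
  assert (E1 : quad a b c x y = quad a b c x' y'
    - 2 * bilin a b c x' y' (x' - x) (y' - y) + quad a b c (x' - x) (y' - y)).
  { replace x with (x' + (-1) * (x' - x)) at 1 by ring.
    replace y with (y' + (-1) * (y' - y)) at 1 by ring.
    rewrite quad_step; ring. }
  assert (qD : quad a b c (x' - x) (y' - y) / D <= C * D).
  { apply Rmult_le_reg_r with D; [assumption|].
    replace (quad a b c (x' - x) (y' - y) / D * D)
      with (quad a b c (x' - x) (y' - y)) by (field; lra); nra. }
  assert (key : sig * (w x' y' - w x y)
    <= D * (w x2 y2 - w x' y') + sig ^ 2 * (C * D) + sig * (C * D ^ 2)).
  { unfold w in *.
    assert (sig ^ 2 * (quad a b c (x' - x) (y' - y) / D) <= sig ^ 2 * (C * D)).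
    { apply Rmult_le_compat_l; [apply pow2_ge_0|assumption]. }
    assert (sig * quad a b c (x' - x) (y' - y) <= sig * (C * D ^ 2)).
    { apply Rmult_le_compat_l; lra. }
    set (B := bilin _ _ _ _ _ _ _) in *; set (Q := quad a b c (x' - x) _) in *.
    nra. }
  apply Rmult_le_reg_l with sig; [assumption|].
  eapply Rle_trans; [exact key|].
  assert (D * (w x2 y2 - w x' y') <= D * (8 * eta1 * eps ^ 2)).
  { apply Rmult_le_compat_l; lra. }
  assert (8 * eta1 * eps ^ 2 = sig * (eta / 2 * eps)) by (unfold eta1, sig; field).
  assert (sig ^ 2 * (C * D) <= sig * D * (eta / 2 * eps)).
  { replace (sig ^ 2 * (C * D)) with (sig * D * (C * tau * eps))
      by (unfold sig; ring).
    apply Rmult_le_compat_l; nra. }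
  nra.
Qed.

Lemma convex_gradient eta : 0 < eta -> exists eps0, 0 < eps0 /\
  forall eps x y x' y', 0 < eps < eps0 -> eucl x y <= eps -> eucl x' y' <= eps ->
    Rabs (w x' y' - w x y)
      <= eucl (x' - x) (y' - y)
         * (eta * eps + quad_bound a b c * eucl (x' - x) (y' - y)).
Proof.
  intros he; destruct (convex_gradient_upper eta he) as (eps0 & h0 & hu).
  exists eps0; split; [assumption|]; intros eps x y x' y' hp hx hx'.
  pose proof (hu eps x y x' y' hp hx hx').
  pose proof (hu eps x' y' x y hp hx' hx) as h2.
  rewrite (eucl_sub_sym x y) in h2.
  apply Rabs_le; split; lra.
Qed.

End ConvexGradient.

(** * Chords of a horoconvex graph *)

Definition graph_pt (u : R -> R -> R) (x y : R) : E3 := (x, y, exp (- u x y)).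

Definition second_order (a b c : R) (u : R -> R -> R) : Prop :=
  forall eta, 0 < eta -> exists del, 0 < del /\
    forall x y, x ^ 2 + y ^ 2 < del ^ 2 ->
      Rabs (u x y - / 2 * quad a b c x y) <= eta * (x ^ 2 + y ^ 2).

(** [exp (- 2 u)] is [1 - 2 u + O(u^2)] with [u = O(|x|^2)]. *)
Lemma horoconvex_quad a b c u : second_order a b c u ->
  forall eta, 0 < eta -> exists del, 0 < del /\
    forall x y, x ^ 2 + y ^ 2 < del ^ 2 ->
      Rabs (exp (- 2 * u x y) + (x ^ 2 + y ^ 2) - 1 - quad (1 - a) (- b) (1 - c) x y)
        <= eta * (x ^ 2 + y ^ 2).
Proof.
  intros hu eta he.
  pose (eta1 := Rmin 1 (eta / 4)).
  assert (he1 : 0 < eta1) by (apply Rmin_glb_lt; lra).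
  assert (e1 : eta1 <= 1) by apply Rmin_l.
  assert (e2 : eta1 <= eta / 4) by apply Rmin_r.
  destruct (hu eta1 he1) as (del & hdel & h).
  pose proof (quad_bound_nonneg a b c) as hC; set (C := quad_bound a b c) in *.
  pose (K := C + 1).
  assert (hK : 0 < K) by (unfold K; lra).
  pose (m := Rmin (/ (4 * K)) (eta / (16 * K ^ 2))).
  assert (hK2 : 0 < K ^ 2) by now apply pow_lt.
  assert (hm : 0 < m).
  { apply Rmin_glb_lt; [apply Rinv_0_lt_compat; lra|apply Rdiv_lt_0_compat; lra]. }
  assert (m1 : m <= / (4 * K)) by apply Rmin_l.
  assert (m2 : m <= eta / (16 * K ^ 2)) by apply Rmin_r.
  clearbody m.
  exists (Rmin del (Rmin 1 m)); split; [repeat apply Rmin_glb_lt; lra|].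
  intros x y hxy.
  set (s := x ^ 2 + y ^ 2) in *.
  assert (s0 : 0 <= s) by apply sum_sqr_nonneg.
  assert (hd : Rmin del (Rmin 1 m) <= del) by apply Rmin_l.
  assert (h1 : Rmin del (Rmin 1 m) <= 1)
    by (eapply Rle_trans; [apply Rmin_r|apply Rmin_l]).
  assert (h2 : Rmin del (Rmin 1 m) <= m)
    by (eapply Rle_trans; [apply Rmin_r|apply Rmin_r]).
  assert (h3 : 0 < Rmin del (Rmin 1 m)) by (repeat apply Rmin_glb_lt; lra).
  set (d := Rmin del (Rmin 1 m)) in *.
  assert (sm : s <= m) by nra.
  assert (hxy' : s < del ^ 2).
  { eapply Rlt_le_trans; [exact hxy|]; apply pow_incr; lra. }
  specialize (h x y hxy'); fold s in h.
  pose proof (quad_le a b c x y) as hq; rewrite eucl_sqr in hq; fold C s in hq.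
  assert (su : Rabs (u x y) <= K * s).
  { replace (u x y) with (u x y - / 2 * quad a b c x y + / 2 * quad a b c x y) by ring.
    eapply Rle_trans; [apply Rabs_triang|].
    rewrite (Rabs_mult (/ 2)), (Rabs_pos_eq (/ 2)) by lra.
    unfold K; nra. }
  assert (sm1 : K * s <= / 4).
  { apply Rle_trans with (K * / (4 * K)).
    - apply Rmult_le_compat_l; [lra|].
      lra.
    - right; field; lra. }
  assert (sm2 : 16 * K ^ 2 * s <= eta).
  { apply Rle_trans with (16 * K ^ 2 * (eta / (16 * K ^ 2))).
    - apply Rmult_le_compat_l; [lra|].
      lra.
    - right; field; lra. }
  assert (ht : Rabs (exp (- 2 * u x y) - (1 + - 2 * u x y)) <= 2 * (- 2 * u x y) ^ 2).
  { apply exp_taylor; rewrite Rabs_mult, Rabs_left by lra; lra. }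
  assert (u2 : u x y ^ 2 <= (K * s) ^ 2).
  { rewrite <- pow2_abs; apply pow_incr; split; [apply Rabs_pos|assumption]. }
  replace (exp (- 2 * u x y) + s - 1 - quad (1 - a) (- b) (1 - c) x y)
    with ((exp (- 2 * u x y) - (1 + - 2 * u x y))
          + (- 2) * (u x y - / 2 * quad a b c x y))
    by (unfold quad, s; field).
  eapply Rle_trans; [apply Rabs_triang|].
  rewrite (Rabs_mult (- 2)), (Rabs_left (- 2)) by lra.
  assert (8 * (K * s) ^ 2 <= eta / 2 * s).
  { replace (8 * (K * s) ^ 2) with (/ 2 * (16 * K ^ 2 * s) * s) by field.
    apply Rmult_le_compat_r; lra. }
  assert (eta1 * s <= eta / 4 * s) by now apply Rmult_le_compat_r.
  lra.
Qed.

Section Chart.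

Context {T : Type} {F : (T -> Prop) -> Prop} {FF : Filter F} {eps : T -> R}.
Hypothesis eps_small : forall e, 0 < e -> F (fun t => 0 < eps t < e).

Lemma bigO_in_disc (x y : T -> R) : bigO F eps 1 x -> bigO F eps 1 y ->
  exists C, 0 < C /\ F (fun t => eucl (x t) (y t) <= C * eps t).
Proof.
  intros [C hC] [D hD].
  exists (Rabs C + Rabs D + 1); split.
  { pose proof (Rabs_pos C); pose proof (Rabs_pos D); lra. }
  generalize (filter_and _ _ (filter_and _ _ hC hD) (eps_small 1 Rlt_0_1)).
  apply filter_imp; intros t [[h1 h2] [e0 _]].
  eapply Rle_trans; [apply eucl_le_Rabs|].
  pose proof (Rle_abs C); pose proof (Rle_abs D); simpl in h1, h2; nra.
Qed.

Lemma litO_second_order (w : R -> R -> R) (x y : T -> R) :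
  (forall eta, 0 < eta -> exists del, 0 < del /\ forall x y,
     x ^ 2 + y ^ 2 < del ^ 2 -> Rabs (w x y) <= eta * (x ^ 2 + y ^ 2)) ->
  bigO F eps 1 x -> bigO F eps 1 y -> litO F eps 2 (fun t => w (x t) (y t)).
Proof.
  intros hw hx hy eta he.
  destruct (bigO_in_disc x y hx hy) as (C & hC & h).
  assert (hC2 : 0 < C ^ 2) by now apply pow_lt.
  destruct (hw (eta / C ^ 2) (Rdiv_lt_0_compat _ _ he hC2)) as (del & hdel & hb).
  generalize (filter_and _ _ h (eps_small (del / C) (Rdiv_lt_0_compat _ _ hdel hC))).
  apply filter_imp; intros t [h1 [e0 e1]].
  apply (Rmult_lt_compat_l C) in e1; [|assumption].
  replace (C * (del / C)) with del in e1 by (field; lra).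
  eapply Rle_trans; [apply hb; apply eucl_lt; lra|].
  rewrite <- eucl_sqr.
  apply Rle_trans with (eta / C ^ 2 * (C * eps t) ^ 2).
  - apply Rmult_le_compat_l; [apply Rlt_le, Rdiv_lt_0_compat; assumption|].
    apply pow_incr; split; [apply eucl_nonneg|assumption].
  - right; field; lra.
Qed.

Variables (u : R -> R -> R) (r a b c : R).
Hypothesis hr : 0 < r.
Hypothesis u_horoconvex : horoconvex r u.
Hypothesis u_second_order : second_order a b c u.

Lemma quad_bigO (v w : T -> R) n : bigO F eps n v -> bigO F eps n w ->
  bigO F eps (n + n) (fun t => quad a b c (v t) (w t)).
Proof. intros hv hw; unfold quad; bigO_tac. Qed.

Lemma bilin_bigO (v w v' w' : T -> R) n n' : bigO F eps n v -> bigO F eps n w ->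
  bigO F eps n' v' -> bigO F eps n' w' ->
  bigO F eps (n + n') (fun t => bilin a b c (v t) (w t) (v' t) (w' t)).
Proof. intros hv hw hv' hw'; unfold bilin; bigO_tac. Qed.

Lemma bigO_of_litO_diff n (f g : T -> R) : litO F eps n (fun t => f t - g t) ->
  bigO F eps n g -> bigO F eps n f.
Proof.
  intros h hg; apply (bigO_ext n (fun t => (f t - g t) + g t)).
  - apply filter_forall; intros t; ring.
  - apply bigO_plus_same; [now apply bigO_of_litO|assumption].
Qed.

Variables (m : nat) (x y p1 p2 s : T -> R).
Hypothesis hm : (1 <= m)%nat.
Hypothesis hx : bigO F eps 1 x.
Hypothesis hy : bigO F eps 1 y.
Hypothesis hp1 : bigO F eps 0 p1.
Hypothesis hp2 : bigO F eps 0 p2.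
Hypothesis hs : bigO F eps m s.
Hypothesis s_pos : F (fun t => 0 < s t).

Let x' t := x t + s t * p1 t.
Let y' t := y t + s t * p2 t.
Let U t := u (x t) (y t).
Let U' t := u (x' t) (y' t).

Lemma x'_bigO : bigO F eps 1 x'.
Proof. unfold x'; bigO_tac. Qed.

Lemma y'_bigO : bigO F eps 1 y'.
Proof. unfold y'; bigO_tac. Qed.

Lemma U_quad : litO F eps 2 (fun t => U t - / 2 * quad a b c (x t) (y t)).
Proof.
  exact (litO_second_order (fun x y => u x y - / 2 * quad a b c x y) x y
    u_second_order hx hy).
Qed.

Lemma U'_quad : litO F eps 2 (fun t => U' t - / 2 * quad a b c (x' t) (y' t)).
Proof.
  exact (litO_second_order (fun x y => u x y - / 2 * quad a b c x y) x' y'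
    u_second_order x'_bigO y'_bigO).
Qed.

Lemma U_bigO : bigO F eps 2 U.
Proof.
  apply (bigO_of_litO_diff _ _ _ U_quad).
  pose proof (quad_bigO x y 1 hx hy) as h; bigO_tac.
Qed.

Lemma U'_bigO : bigO F eps 2 U'.
Proof.
  apply (bigO_of_litO_diff _ _ _ U'_quad).
  pose proof (quad_bigO x' y' 1 x'_bigO y'_bigO) as h; bigO_tac.
Qed.

Lemma quad_increment_bigO : bigO F eps (S m)
  (fun t => quad a b c (x' t) (y' t) - quad a b c (x t) (y t)).
Proof.
  pose proof (bilin_bigO x y p1 p2 1 0 hx hy hp1 hp2) as h1.
  pose proof (quad_bigO p1 p2 0 hp1 hp2) as h2.
  apply (bigO_ext _ (fun t => s t * (2 * bilin a b c (x t) (y t) (p1 t) (p2 t)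
    + s t * quad a b c (p1 t) (p2 t)))).
  - apply filter_forall; intros t; unfold x', y'; rewrite quad_step; ring.
  - bigO_tac.
Qed.

Lemma inverse_heights : bigO F eps 2 (fun t => exp (U t + U' t) - 1).
Proof.
  pose proof U_bigO as h1; pose proof U'_bigO as h2.
  assert (h : bigO F eps 2 (fun t => U t + U' t)) by bigO_tac.
  pose proof (bigO_taylor eps_small 2 (fun x => exp x - (1 + x)) _ exp_taylor
    ltac:(lia) h) as h3.
  apply (bigO_ext _ (fun t => (exp (U t + U' t) - (1 + (U t + U' t))) + (U t + U' t))).
  - apply filter_forall; intros t; ring.
  - bigO_tac.
Qed.

Lemma inverse_heights_quad : (2 <= m)%nat ->
  litO F eps 2 (fun t => exp (U t + U' t) - (1 + quad a b c (x t) (y t))).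
Proof.
  intros hm2.
  pose proof U_bigO as h1; pose proof U'_bigO as h2.
  assert (h : bigO F eps 2 (fun t => U t + U' t)) by bigO_tac.
  pose proof (bigO_taylor eps_small 2 (fun x => exp x - (1 + x)) _ exp_taylor
    ltac:(lia) h) as h3.
  pose proof quad_increment_bigO as h4.
  apply (litO_ext _ (fun t => ((U t - / 2 * quad a b c (x t) (y t))
    + (U' t - / 2 * quad a b c (x' t) (y' t)))
    + ((exp (U t + U' t) - (1 + (U t + U' t)))
       + / 2 * (quad a b c (x' t) (y' t) - quad a b c (x t) (y t))))).
  - apply filter_forall; intros t; field.
  - apply litO_plus; [apply litO_plus; [apply U_quad|apply U'_quad]|].
    apply (litO_of_bigO eps_small 2 3); [lia|].
    assert (h5 : bigO F eps 3
      (fun t => quad a b c (x' t) (y' t) - quad a b c (x t) (y t)))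
      by (apply (bigO_weaken eps_small (S m)); [lia|exact h4]).
    clear h4.
    apply (bigO_weaken eps_small (Nat.min 4 3)); [lia|].
    apply (bigO_plus eps_small); [exact h3|].
    apply (bigO_mult 0 3); [apply bigO_const|exact h5].
Qed.

(* The difference between [exp (- 2 u) + |x|^2], which is convex, and its
   quadratic part: the two squares |x|^2 cancel. *)
Let W t := exp (- 2 * U t) - 1 + quad a b c (x t) (y t).
Let W' t := exp (- 2 * U' t) - 1 + quad a b c (x' t) (y' t).

Lemma remainder_slope : exists C, 0 < C /\ forall eta, 0 < eta ->
  F (fun t => Rabs ((W' t - W t) / s t) <= eta * eps t + C * Rabs (s t)).
Proof.
  destruct (bigO_in_disc x y hx hy) as (C1 & hC1 & h1).
  destruct (bigO_in_disc x' y' x'_bigO y'_bigO) as (C2 & hC2 & h2).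
  assert (h3 : exists P, 0 < P /\ F (fun t => eucl (p1 t) (p2 t) <= P)).
  { destruct hp1 as [D1 g1], hp2 as [D2 g2].
    exists (Rabs D1 + Rabs D2 + 1); split.
    { pose proof (Rabs_pos D1); pose proof (Rabs_pos D2); lra. }
    generalize (filter_and _ _ g1 g2); apply filter_imp; intros t [k1 k2].
    eapply Rle_trans; [apply eucl_le_Rabs|].
    pose proof (Rle_abs D1); pose proof (Rle_abs D2); simpl in k1, k2; lra. }
  destruct h3 as (P & hP & h3).
  pose proof (quad_bound_nonneg (1 - a) (- b) (1 - c)) as hB.
  set (B := quad_bound (1 - a) (- b) (1 - c)) in *.
  exists (P ^ 2 * (B + 1)); split.
  { apply Rmult_lt_0_compat; [now apply pow_lt|lra]. }
  intros eta he.
  pose (K := C1 + C2).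
  assert (hK : 0 < K) by (unfold K; lra).
  pose (eta1 := eta / (P * K)).
  assert (he1 : 0 < eta1) by (apply Rdiv_lt_0_compat; [|apply Rmult_lt_0_compat]; assumption).
  destruct (convex_gradient (fun x y => exp (- 2 * u x y) + (x ^ 2 + y ^ 2)) r
    (1 - a) (- b) (1 - c) hr u_horoconvex (horoconvex_quad a b c u u_second_order)
    eta1 he1) as (e0 & he0 & hg).
  generalize (filter_and _ _ (filter_and _ _ h1 h2) (filter_and _ _ (filter_and _ _ h3 s_pos)
    (eps_small (e0 / K) (Rdiv_lt_0_compat _ _ he0 hK)))).
  apply filter_imp; intros t [[k1 k2] [[k3 ks] [ke ke']]].
  apply (Rmult_lt_compat_l K) in ke'; [|assumption].
  replace (K * (e0 / K)) with e0 in ke' by (field; lra).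
  assert (ke2 : 0 < K * eps t) by now apply Rmult_lt_0_compat.
  assert (b1 : eucl (x t) (y t) <= K * eps t) by (unfold K; nra).
  assert (b2 : eucl (x' t) (y' t) <= K * eps t) by (unfold K; nra).
  specialize (hg (K * eps t) _ _ _ _ (conj ke2 ke') b1 b2); fold B in hg.
  replace (eucl (x' t - x t) (y' t - y t)) with (s t * eucl (p1 t) (p2 t)) in hg.
  2: { unfold x', y'; rewrite <- eucl_scal by lra; f_equal; ring. }
  unfold Rdiv; rewrite Rabs_mult, Rabs_inv, (Rabs_pos_eq (s t)) by lra.
  apply Rmult_le_reg_r with (s t); [assumption|].
  rewrite Rmult_assoc, Rinv_l, Rmult_1_r by lra.
  replace (W' t - W t) with
    (exp (- 2 * u (x' t) (y' t)) + (x' t ^ 2 + y' t ^ 2) - 1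
       - quad (1 - a) (- b) (1 - c) (x' t) (y' t)
     - (exp (- 2 * u (x t) (y t)) + (x t ^ 2 + y t ^ 2) - 1
       - quad (1 - a) (- b) (1 - c) (x t) (y t)))
    by (unfold W, W', U, U', quad; ring).
  eapply Rle_trans; [exact hg|].
  set (e := eucl (p1 t) (p2 t)) in *.
  assert (e0' : 0 <= e) by apply eucl_nonneg.
  assert (E : eta1 * (K * eps t) * P = eta * eps t)
    by (unfold eta1; field; split; lra).
  assert (f1 : e * (eta1 * (K * eps t)) <= eta * eps t).
  { rewrite <- E, Rmult_comm; apply Rmult_le_compat_l; [|assumption].
    apply Rmult_le_pos; lra. }
  assert (f2 : e * (B * (s t * e)) <= P ^ 2 * (B + 1) * s t).
  { replace (e * (B * (s t * e))) with (e ^ 2 * B * s t) by ring.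
    apply Rmult_le_compat_r; [lra|].
    apply Rmult_le_compat; try lra; [apply pow2_ge_0|apply pow_incr; lra]. }
  replace (s t * e * (eta1 * (K * eps t) + B * (s t * e)))
    with ((e * (eta1 * (K * eps t)) + e * (B * (s t * e))) * s t) by ring.
  apply Rmult_le_compat_r; lra.
Qed.

Lemma remainder_slope_bigO : bigO F eps 1 (fun t => (W' t - W t) / s t).
Proof.
  destruct remainder_slope as (C & hC & h).
  destruct (bigO_weaken eps_small m 1 s hm hs) as [D hD].
  exists (1 + C * D).
  generalize (filter_and _ _ (h 1 Rlt_0_1) hD); apply filter_imp; intros t [h1 h2].
  simpl in *; nra.
Qed.

Lemma remainder_slope_litO : (2 <= m)%nat ->
  litO F eps 1 (fun t => (W' t - W t) / s t).
Proof.
  intros hm2 eta he.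
  destruct remainder_slope as (C & hC & h).
  assert (he2 : 0 < eta / 2) by lra.
  assert (he3 : 0 < eta / (2 * C)) by (apply Rdiv_lt_0_compat; lra).
  pose proof (litO_of_bigO eps_small 1 m s hm2 hs _ he3) as h3.
  generalize (filter_and _ _ (h _ he2) h3); apply filter_imp; intros t [h1 h2].
  apply (Rmult_le_compat_l C) in h2; [|lra].
  replace (C * (eta / (2 * C) * eps t ^ 1)) with (eta / 2 * eps t ^ 1) in h2
    by (field; lra).
  simpl in *; lra.
Qed.

(* The slope of the heights is that of their squares divided by their sum: the
   squares have the convex remainder, and the sum is 2 + O(eps^2). *)
Let Z t := exp (- U t).
Let Z' t := exp (- U' t).

Lemma heights_sum : bigO F eps 2 (fun t => / (Z t + Z' t) - / 2).
Proof.
  assert (ex : forall V, bigO F eps 2 V -> bigO F eps 2 (fun t => exp (- V t) - 1)).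
  { intros V hV.
    pose proof (bigO_taylor eps_small 2 (fun x => exp x - (1 + x)) _ exp_taylor
      ltac:(lia) (bigO_opp _ _ hV)) as h.
    apply (bigO_ext _ (fun t => (exp (- V t) - (1 + - V t)) - V t)).
    - apply filter_forall; intros t; ring.
    - bigO_tac. }
  pose proof (ex _ U_bigO) as h1; pose proof (ex _ U'_bigO) as h2.
  assert (hv : bigO F eps 2 (fun t => / 2 * ((Z t - 1) + (Z' t - 1)))).
  { unfold Z, Z'; bigO_tac. }
  pose proof (bigO_taylor eps_small 2 (fun x => / (1 + x) - (1 - x)) _ inv_taylor
    ltac:(lia) hv) as h3.
  apply (bigO_ext _ (fun t => / 2 *
    ((/ (1 + / 2 * ((Z t - 1) + (Z' t - 1))) - (1 - / 2 * ((Z t - 1) + (Z' t - 1))))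
     - / 2 * ((Z t - 1) + (Z' t - 1))))).
  - apply filter_forall; intros t.
    assert (0 < Z t) by apply exp_pos; assert (0 < Z' t) by apply exp_pos.
    field; lra.
  - bigO_tac.
Qed.

Let zeta t := (Z' t - Z t) / s t.

Lemma zeta_eq : F (fun t => zeta t =
  ((W' t - W t) / s t - (2 * bilin a b c (x t) (y t) (p1 t) (p2 t)
     + s t * quad a b c (p1 t) (p2 t))) * / (Z t + Z' t)).
Proof.
  generalize s_pos; apply filter_imp; intros t h.
  assert (hZ : 0 < Z t) by apply exp_pos; assert (hZ' : 0 < Z' t) by apply exp_pos.
  assert (E : Z' t ^ 2 - Z t ^ 2 = (W' t - W t)
    - s t * (2 * bilin a b c (x t) (y t) (p1 t) (p2 t)
     + s t * quad a b c (p1 t) (p2 t))).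
  { unfold W, W', x', y'; rewrite quad_step.
    unfold Z, Z'; simpl; rewrite !Rmult_1_r, <- !exp_plus.
    replace (- U t + - U t) with (- 2 * U t) by ring.
    replace (- U' t + - U' t) with (- 2 * U' t) by ring.
    ring. }
  unfold zeta; apply Rmult_eq_reg_r with (s t * (Z t + Z' t));
    [|apply Rgt_not_eq, Rmult_lt_0_compat; lra].
  transitivity (Z' t ^ 2 - Z t ^ 2); [field; lra|rewrite E; field; lra].
Qed.

Lemma zeta_bigO : bigO F eps 1 zeta.
Proof.
  pose proof (bilin_bigO x y p1 p2 1 0 hx hy hp1 hp2) as h1.
  pose proof (quad_bigO p1 p2 0 hp1 hp2) as h2.
  pose proof remainder_slope_bigO as h3.
  assert (h4 : bigO F eps 0 (fun t => / (Z t + Z' t))).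
  { pose proof heights_sum as h.
    apply (bigO_ext _ (fun t => (/ (Z t + Z' t) - / 2) + / 2)).
    - apply filter_forall; intros t; ring.
    - bigO_tac. }
  eapply bigO_ext; [generalize zeta_eq; apply filter_imp; intros t E;
    symmetry; exact E|].
  bigO_tac.
Qed.

Lemma zeta_litO : (2 <= m)%nat ->
  litO F eps 1 (fun t => zeta t + bilin a b c (x t) (y t) (p1 t) (p2 t)).
Proof.
  intros hm2.
  pose proof (bilin_bigO x y p1 p2 1 0 hx hy hp1 hp2) as h1.
  pose proof (quad_bigO p1 p2 0 hp1 hp2) as h2.
  pose proof (remainder_slope_litO hm2) as h3.
  pose proof heights_sum as h4.
  assert (h5 : bigO F eps 0 (fun t => / (Z t + Z' t))).
  { apply (bigO_ext _ (fun t => (/ (Z t + Z' t) - / 2) + / 2)).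
    - apply filter_forall; intros t; ring.
    - bigO_tac. }
  apply (litO_ext _ (fun t => (W' t - W t) / s t * / (Z t + Z' t)
    + (- (2 * bilin a b c (x t) (y t) (p1 t) (p2 t)) * (/ (Z t + Z' t) - / 2)
       - s t * quad a b c (p1 t) (p2 t) * / (Z t + Z' t)))).
  - generalize (filter_and _ _ zeta_eq s_pos); apply filter_imp.
    intros t [-> hst].
    assert (0 < Z t) by apply exp_pos; assert (0 < Z' t) by apply exp_pos.
    field; lra.
  - apply litO_plus.
    + exact (litO_mult eps_small 1 0 _ _ h3 h5).
    + apply (litO_of_bigO eps_small 1 2); [lia|bigO_tac].
Qed.

Let ratio t := chord (graph_pt u (x t) (y t)) (graph_pt u (x' t) (y' t)) / s t ^ 2.

Lemma ratio_eq : F (fun t => ratio t =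
  (p1 t ^ 2 + p2 t ^ 2 + zeta t ^ 2) * exp (U t + U' t)).
Proof.
  generalize s_pos; apply filter_imp; intros t h.
  unfold ratio, chord, edist2, graph_pt, cx, cy, cz; simpl fst; simpl snd.
  fold (U t) (U' t) (Z t) (Z' t).
  assert (hZ : 0 < Z t) by apply exp_pos; assert (hZ' : 0 < Z' t) by apply exp_pos.
  assert (E : exp (U t + U' t) = / (Z t * Z' t)).
  { unfold Z, Z'; rewrite <- exp_plus, <- exp_Ropp; f_equal; ring. }
  rewrite E; unfold zeta, x', y'; field; lra.
Qed.

Lemma chord_crude : bigO F eps 2 (fun t => ratio t - (p1 t ^ 2 + p2 t ^ 2)).
Proof.
  pose proof zeta_bigO as h1; pose proof inverse_heights as h2.
  apply (bigO_ext _ (fun t => (p1 t ^ 2 + p2 t ^ 2) * (exp (U t + U' t) - 1)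
    + zeta t ^ 2 * ((exp (U t + U' t) - 1) + 1))).
  - generalize ratio_eq; apply filter_imp; intros t ->; ring.
  - bigO_tac.
Qed.

(** The conformal factor [exp (2 u)] is [1 + <A x, x> + o(|x|^2)] and the height
    varies at the rate [- <A x, dx> + o(|x|) |dx|], so that, in the sense of chords,
    the metric of the graph is
    [(1 + <A x, x>) |dx|^2 + <A x, dx>^2 + o(|x|^2) |dx|^2]. *)
Lemma chord_fine : (2 <= m)%nat ->
  litO F eps 2 (fun t => ratio t -
    ((p1 t ^ 2 + p2 t ^ 2) * (1 + quad a b c (x t) (y t))
     + bilin a b c (x t) (y t) (p1 t) (p2 t) ^ 2)).
Proof.
  intros hm2.
  pose proof (bilin_bigO x y p1 p2 1 0 hx hy hp1 hp2) as h1.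
  pose proof zeta_bigO as h2; pose proof (zeta_litO hm2) as h3.
  pose proof inverse_heights as h4; pose proof (inverse_heights_quad hm2) as h5.
  apply (litO_ext _ (fun t =>
    (exp (U t + U' t) - (1 + quad a b c (x t) (y t))) * (p1 t ^ 2 + p2 t ^ 2)
    + ((zeta t + bilin a b c (x t) (y t) (p1 t) (p2 t))
       * (zeta t - bilin a b c (x t) (y t) (p1 t) (p2 t))
       + zeta t ^ 2 * (exp (U t + U' t) - 1)))).
  - generalize ratio_eq; apply filter_imp; intros t ->; ring.
  - apply litO_plus; [|apply litO_plus].
    + apply (litO_mult eps_small 2 0); [exact h5|bigO_tac].
    + apply (litO_mult eps_small 1 1); [exact h3|bigO_tac].
    + apply (litO_of_bigO eps_small 2 4); [lia|bigO_tac].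
Qed.

End Chart.

(** * Coordinates of constant curvature *)

Definition cubic (a b c d x y : R) : R :=
  a * x ^ 3 + b * x ^ 2 * y + c * x * y ^ 2 + d * y ^ 3.

Definition dcubic (a b c d x y v w : R) : R :=
  (3 * a * x ^ 2 + 2 * b * x * y + c * y ^ 2) * v
  + (b * x ^ 2 + 2 * c * x * y + 3 * d * y ^ 2) * w.

Definition ddcubic (a b c d x y v w : R) : R :=
  (3 * a * x + b * y) * v ^ 2 + 2 * (b * x + c * y) * v * w
  + (c * x + 3 * d * y) * w ^ 2.

(** The difference quotient of the cubic form along [(v, w)], for the step
    [s]. *)
Definition cubic_slope (a b c d x y v w s : R) : R :=
  dcubic a b c d x y v w + s * (ddcubic a b c d x y v w + s * cubic a b c d v w).

Lemma cubic_step a b c d x y v w s :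
  cubic a b c d (x + s * v) (y + s * w)
    = cubic a b c d x y + s * cubic_slope a b c d x y v w s.
Proof. unfold cubic_slope, dcubic, ddcubic, cubic; ring. Qed.

Definition curvature (a b c : R) : R := a * c - b ^ 2 - (a + c).

Section Coordinates.

Variables a b c : R.

Let k := curvature a b c.

(** The cubic terms for which the metric
    [(1 + <A x, x>) |dx|^2 + <A x, dx>^2] becomes [(1 - k |X|^2 / 2) |dX|^2] up to
    [o(|X|^2)] in the coordinates [X]: a linear system for their derivatives,
    which is solvable only for this value of [k]. The second component is
    evaluated at the new first coordinate, which changes it at order 5 only and
    makes the map triangular, so that it is inverted one variable at a time. *)
Definition cubic1 : R -> R -> R :=
  cubic (- (k / 2 + a + a ^ 2) / 6) (- (b + a * b) / 2)
        (- (k / 2 + c + b ^ 2) / 2) (- (b * c - b) / 6).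

Definition cubic2 : R -> R -> R :=
  cubic (- (a * b - b) / 6) (- (k / 2 + a + b ^ 2) / 2)
        (- (b + b * c) / 2) (- (k / 2 + c + c ^ 2) / 6).

Definition coord1 (X Y : R) : R := X + cubic1 X Y.

Definition coord2 (X Y : R) : R := Y + cubic2 (coord1 X Y) Y.

Definition slope1 : R -> R -> R -> R -> R -> R :=
  cubic_slope (- (k / 2 + a + a ^ 2) / 6) (- (b + a * b) / 2)
              (- (k / 2 + c + b ^ 2) / 2) (- (b * c - b) / 6).

Definition slope2 : R -> R -> R -> R -> R -> R :=
  cubic_slope (- (a * b - b) / 6) (- (k / 2 + a + b ^ 2) / 2)
              (- (b + b * c) / 2) (- (k / 2 + c + c ^ 2) / 6).

Definition dcubic1 : R -> R -> R -> R -> R :=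
  dcubic (- (k / 2 + a + a ^ 2) / 6) (- (b + a * b) / 2)
         (- (k / 2 + c + b ^ 2) / 2) (- (b * c - b) / 6).

Definition dcubic2 : R -> R -> R -> R -> R :=
  dcubic (- (a * b - b) / 6) (- (k / 2 + a + b ^ 2) / 2)
         (- (b + b * c) / 2) (- (k / 2 + c + c ^ 2) / 6).

Definition dcoord1 (X Y v w s : R) : R := v + slope1 X Y v w s.

Definition dcoord2 (X Y v w s : R) : R :=
  w + slope2 (coord1 X Y) Y (dcoord1 X Y v w s) w s.

Lemma coord1_step X Y v w s :
  coord1 (X + s * v) (Y + s * w) = coord1 X Y + s * dcoord1 X Y v w s.
Proof.
  unfold coord1, dcoord1, cubic1, slope1; rewrite cubic_step; ring.
Qed.

Lemma coord2_step X Y v w s :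
  coord2 (X + s * v) (Y + s * w) = coord2 X Y + s * dcoord2 X Y v w s.
Proof.
  unfold coord2, dcoord2, cubic2, slope2.
  rewrite coord1_step, cubic_step; ring.
Qed.

(** The equation which the choice of the cubic terms and of [k] solves. *)
Lemma metric_normal_form X Y v w : v ^ 2 + w ^ 2 = 1 ->
  2 * (v * dcubic1 X Y v w + w * dcubic2 X Y v w) + quad a b c X Y
    + bilin a b c X Y v w ^ 2
  = - (k / 2) * (X ^ 2 + Y ^ 2).
Proof.
  intros h.
  transitivity (2 * (v * dcubic1 X Y v w + w * dcubic2 X Y v w)
    + quad a b c X Y * (v ^ 2 + w ^ 2) + bilin a b c X Y v w ^ 2); [rewrite h; ring|].
  transitivity (- (k / 2) * (X ^ 2 + Y ^ 2) * (v ^ 2 + w ^ 2)); [|rewrite h; ring].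
  unfold dcubic1, dcubic2, dcubic, quad, bilin, k, curvature; field.
Qed.

(** A point of the disc of radius [c_eps], a unit vector [(c_v, c_w)] and a step
    [c_s], standing for the pair formed by the point and its translate by the
    step. *)
Record config := Config {
  c_eps : R; c_x : R; c_y : R; c_v : R; c_w : R; c_s : R }.

(** For [m = 1] all pairs of points of the disc are reached. For [m = 3] they are
    so close to each other that the variation of a metric between them is
    [o(c_eps^2)], and chords compare with the metric itself. *)
Definition near_0 (m : nat) (P : config -> Prop) : Prop :=
  exists eps0, 0 < eps0 /\ forall t,
    0 < c_eps t < eps0 -> eucl (c_x t) (c_y t) <= c_eps t ->
    c_v t ^ 2 + c_w t ^ 2 = 1 -> 0 < c_s t <= 2 * c_eps t ^ m -> P t.

#[local] Instance near_0_filter m : Filter (near_0 m).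
Proof.
  split.
  - exists 1; split; [lra|auto].
  - intros P Q (e1 & h1 & hP) (e2 & h2 & hQ).
    exists (Rmin e1 e2); split; [now apply Rmin_glb_lt|].
    intros t [p0 p1]; pose proof (Rmin_l e1 e2); pose proof (Rmin_r e1 e2).
    split; [apply hP|apply hQ]; try assumption; lra.
  - intros P Q hPQ (e1 & h1 & hP); exists e1; split; [assumption|auto].
Qed.

Lemma near_0_all m (P : config -> Prop) :
  (forall t, 0 < c_eps t -> eucl (c_x t) (c_y t) <= c_eps t ->
    c_v t ^ 2 + c_w t ^ 2 = 1 -> 0 < c_s t <= 2 * c_eps t ^ m -> P t) ->
  near_0 m P.
Proof.
  intros h; exists 1; split; [lra|]; intros t ht; apply h; lra.
Qed.

Lemma near_0_eps m e : 0 < e -> near_0 m (fun t => 0 < c_eps t < e).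
Proof. intros he; exists e; split; [assumption|auto]. Qed.

Lemma near_0_x m : bigO (near_0 m) c_eps 1 c_x.
Proof.
  exists 1; apply near_0_all; intros t _ h _ _.
  pose proof (Rabs_le_eucl_l (c_x t) (c_y t)); lra.
Qed.

Lemma near_0_y m : bigO (near_0 m) c_eps 1 c_y.
Proof.
  exists 1; apply near_0_all; intros t _ h _ _.
  pose proof (Rabs_le_eucl_r (c_x t) (c_y t)); lra.
Qed.

Lemma near_0_v m : bigO (near_0 m) c_eps 0 c_v.
Proof.
  exists 1; apply near_0_all; intros t _ _ h _.
  apply sqr_le_inv; [simpl; lra|]; rewrite pow2_abs.
  pose proof (pow2_ge_0 (c_w t)); simpl in *; lra.
Qed.

Lemma near_0_w m : bigO (near_0 m) c_eps 0 c_w.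
Proof.
  exists 1; apply near_0_all; intros t _ _ h _.
  apply sqr_le_inv; [simpl; lra|]; rewrite pow2_abs.
  pose proof (pow2_ge_0 (c_v t)); simpl in *; lra.
Qed.

Lemma near_0_s m : bigO (near_0 m) c_eps m c_s.
Proof.
  exists 2; apply near_0_all; intros t _ _ _ h.
  rewrite Rabs_pos_eq; lra.
Qed.

Section Expansion.

Variable m : nat.
Hypothesis hm : (1 <= m)%nat.

(* These orders are used from the context by [bigO_tac]. *)
Let eps_small := near_0_eps m.
Let ox := near_0_x m.
Let oy := near_0_y m.
Let ov := near_0_v m.
Let ow := near_0_w m.
Let os := near_0_s m.

Let x t := coord1 (c_x t) (c_y t).
Let y t := coord2 (c_x t) (c_y t).
Let p1 t := dcoord1 (c_x t) (c_y t) (c_v t) (c_w t) (c_s t).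
Let p2 t := dcoord2 (c_x t) (c_y t) (c_v t) (c_w t) (c_s t).
Let D1 t := dcubic1 (c_x t) (c_y t) (c_v t) (c_w t).
Let D2 t := dcubic2 (c_x t) (c_y t) (c_v t) (c_w t).

Lemma coord1_expansion : bigO (near_0 m) c_eps 3 (fun t => x t - c_x t).
Proof.
  apply (bigO_ext _ (fun t => cubic1 (c_x t) (c_y t))).
  - apply filter_forall; intros t; unfold x, coord1; ring.
  - unfold cubic1, cubic; bigO_tac.
Qed.

Lemma x_bigO : bigO (near_0 m) c_eps 1 x.
Proof.
  pose proof coord1_expansion as h.
  apply (bigO_ext _ (fun t => (x t - c_x t) + c_x t)).
  - apply filter_forall; intros t; ring.
  - bigO_tac.
Qed.

Lemma coord2_expansion : bigO (near_0 m) c_eps 3 (fun t => y t - c_y t).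
Proof.
  pose proof x_bigO as h.
  apply (bigO_ext _ (fun t => cubic2 (x t) (c_y t))).
  - apply filter_forall; intros t; unfold y, coord2; fold (x t); ring.
  - unfold cubic2, cubic; bigO_tac.
Qed.

Lemma y_bigO : bigO (near_0 m) c_eps 1 y.
Proof.
  pose proof coord2_expansion as h.
  apply (bigO_ext _ (fun t => (y t - c_y t) + c_y t)).
  - apply filter_forall; intros t; ring.
  - bigO_tac.
Qed.

Lemma D1_bigO : bigO (near_0 m) c_eps 2 D1.
Proof. unfold D1, dcubic1, dcubic; bigO_tac. Qed.

Lemma D2_bigO : bigO (near_0 m) c_eps 2 D2.
Proof. unfold D2, dcubic2, dcubic; bigO_tac. Qed.

Lemma dcoord1_expansion :
  bigO (near_0 m) c_eps (S m) (fun t => p1 t - c_v t - D1 t).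
Proof.
  apply (bigO_ext _ (fun t => c_s t *
    (ddcubic (- (k / 2 + a + a ^ 2) / 6) (- (b + a * b) / 2)
        (- (k / 2 + c + b ^ 2) / 2) (- (b * c - b) / 6) (c_x t) (c_y t) (c_v t) (c_w t)
     + c_s t * cubic (- (k / 2 + a + a ^ 2) / 6) (- (b + a * b) / 2)
        (- (k / 2 + c + b ^ 2) / 2) (- (b * c - b) / 6) (c_v t) (c_w t)))).
  - apply filter_forall; intros t.
    unfold p1, D1, dcoord1, slope1, dcubic1, cubic_slope; ring.
  - unfold ddcubic, cubic; bigO_tac.
Qed.

Lemma p1_bigO : bigO (near_0 m) c_eps 0 p1.
Proof.
  pose proof dcoord1_expansion as h; pose proof D1_bigO as h'.
  apply (bigO_ext _ (fun t => (p1 t - c_v t - D1 t) + (c_v t + D1 t))).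
  - apply filter_forall; intros t; ring.
  - bigO_tac.
Qed.

Lemma dcoord2_expansion :
  bigO (near_0 m) c_eps (S (Nat.min m 3)) (fun t => p2 t - c_w t - D2 t).
Proof.
  pose proof x_bigO as h1; pose proof coord1_expansion as h2.
  pose proof p1_bigO as h3; pose proof dcoord1_expansion as h4.
  pose proof D1_bigO as h5.
  apply (bigO_ext _ (fun t =>
    ((3 * (- (a * b - b) / 6) * (x t - c_x t) * (x t + c_x t)
        + 2 * (- (k / 2 + a + b ^ 2) / 2) * (x t - c_x t) * c_y t) * p1 t
     + ((- (k / 2 + a + b ^ 2) / 2) * (x t - c_x t) * (x t + c_x t)
        + 2 * (- (b + b * c) / 2) * (x t - c_x t) * c_y t) * c_w t)
    + (3 * (- (a * b - b) / 6) * c_x t ^ 2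
        + 2 * (- (k / 2 + a + b ^ 2) / 2) * c_x t * c_y t
        + (- (b + b * c) / 2) * c_y t ^ 2) * ((p1 t - c_v t - D1 t) + D1 t)
    + c_s t *
    (ddcubic (- (a * b - b) / 6) (- (k / 2 + a + b ^ 2) / 2)
        (- (b + b * c) / 2) (- (k / 2 + c + c ^ 2) / 6) (x t) (c_y t) (p1 t) (c_w t)
     + c_s t * cubic (- (a * b - b) / 6) (- (k / 2 + a + b ^ 2) / 2)
        (- (b + b * c) / 2) (- (k / 2 + c + c ^ 2) / 6) (p1 t) (c_w t)))).
  - apply filter_forall; intros t.
    unfold p2, D2, dcoord2, slope2, dcubic2, cubic_slope, dcubic.
    fold (x t) (p1 t); ring.
  - unfold ddcubic, cubic; bigO_tac.
Qed.

Lemma p2_bigO : bigO (near_0 m) c_eps 0 p2.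
Proof.
  pose proof dcoord2_expansion as h; pose proof D2_bigO as h'.
  apply (bigO_ext _ (fun t => (p2 t - c_w t - D2 t) + (c_w t + D2 t))).
  - apply filter_forall; intros t; ring.
  - bigO_tac.
Qed.

Let P t := p1 t ^ 2 + p2 t ^ 2 - 1 - 2 * (c_v t * D1 t + c_w t * D2 t).

Lemma speed_expansion : bigO (near_0 m) c_eps (S (Nat.min m 3)) P.
Proof.
  pose proof dcoord1_expansion as h1; pose proof dcoord2_expansion as h2.
  pose proof D1_bigO as h3; pose proof D2_bigO as h4.
  apply (bigO_ext _ (fun t =>
    2 * (c_v t * (p1 t - c_v t - D1 t) + c_w t * (p2 t - c_w t - D2 t))
    + ((p1 t - c_v t - D1 t) + D1 t) ^ 2 + ((p2 t - c_w t - D2 t) + D2 t) ^ 2)).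
  - apply near_0_all; intros t _ _ h _; unfold P; rewrite <- h; ring.
  - bigO_tac.
Qed.

Lemma speed_crude : bigO (near_0 m) c_eps 2 (fun t => p1 t ^ 2 + p2 t ^ 2 - 1).
Proof.
  pose proof speed_expansion as h; pose proof D1_bigO as h3; pose proof D2_bigO as h4.
  apply (bigO_ext _ (fun t => P t + 2 * (c_v t * D1 t + c_w t * D2 t))).
  - apply filter_forall; intros t; unfold P; ring.
  - bigO_tac.
Qed.

Lemma metric_expansion : (3 <= m)%nat -> bigO (near_0 m) c_eps 3 (fun t =>
  (p1 t ^ 2 + p2 t ^ 2) * (1 + quad a b c (x t) (y t))
    + bilin a b c (x t) (y t) (p1 t) (p2 t) ^ 2
  - (1 - k / 2 * (c_x t ^ 2 + c_y t ^ 2))).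
Proof.
  intros hm3.
  pose proof x_bigO as h1; pose proof y_bigO as h2.
  pose proof coord1_expansion as h3; pose proof coord2_expansion as h4.
  pose proof p1_bigO as h5; pose proof p2_bigO as h6.
  pose proof D1_bigO as h7; pose proof D2_bigO as h8.
  pose proof dcoord1_expansion as h9; pose proof dcoord2_expansion as h10.
  pose proof speed_expansion as h11.
  pose (Q := fun t => quad a b c (c_x t) (c_y t)).
  pose (L := fun t => bilin a b c (c_x t) (c_y t) (c_v t) (c_w t)).
  pose (q := fun t => quad a b c (x t) (y t) - Q t).
  pose (l := fun t => bilin a b c (x t) (y t) (p1 t) (p2 t) - L t).
  assert (hQ : bigO (near_0 m) c_eps 2 Q) by (unfold Q, quad; bigO_tac).
  assert (hL : bigO (near_0 m) c_eps 1 L) by (unfold L, bilin; bigO_tac).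
  assert (hq : bigO (near_0 m) c_eps 4 q).
  { apply (bigO_ext _ (fun t => a * (x t - c_x t) * (x t + c_x t)
      + 2 * b * (x t - c_x t) * y t + 2 * b * c_x t * (y t - c_y t)
      + c * (y t - c_y t) * (y t + c_y t))).
    - apply filter_forall; intros t; unfold q, Q, quad; ring.
    - bigO_tac. }
  assert (hl : bigO (near_0 m) c_eps 3 l).
  { apply (bigO_ext _ (fun t =>
      (a * (x t - c_x t) + b * (y t - c_y t)) * p1 t
      + (b * (x t - c_x t) + c * (y t - c_y t)) * p2 t
      + (a * c_x t + b * c_y t) * ((p1 t - c_v t - D1 t) + D1 t)
      + (b * c_x t + c * c_y t) * ((p2 t - c_w t - D2 t) + D2 t))).
    - apply filter_forall; intros t; unfold l, L, bilin; ring.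
    - bigO_tac. }
  pose (M := fun t => 2 * (c_v t * D1 t + c_w t * D2 t)).
  assert (hM : bigO (near_0 m) c_eps 2 M) by (unfold M; bigO_tac).
  apply (bigO_ext _ (fun t => P t + q t + (M t + P t) * (Q t + q t)
    + 2 * L t * l t + l t ^ 2)).
  - apply near_0_all; intros t _ _ h _.
    pose proof (metric_normal_form (c_x t) (c_y t) _ _ h) as E.
    fold (D1 t) (D2 t) (Q t) (L t) (M t) in E.
    replace (p1 t ^ 2 + p2 t ^ 2) with (1 + M t + P t) by (unfold P, M; ring).
    replace (quad a b c (x t) (y t)) with (Q t + q t) by (unfold q; ring).
    replace (bilin a b c (x t) (y t) (p1 t) (p2 t)) with (L t + l t)
      by (unfold l; ring).
    replace (1 - k / 2 * (c_x t ^ 2 + c_y t ^ 2))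
      with (1 + (M t + Q t + L t ^ 2)) by (rewrite E; ring).
    ring.
  - bigO_tac.
Qed.

Lemma conf_expansion : bigO (near_0 m) c_eps 4 (fun t =>
  conf k (c_x t) (c_y t) ^ 2 - (1 - k / 2 * (c_x t ^ 2 + c_y t ^ 2))).
Proof.
  pose (f := fun t => k * (c_x t ^ 2 + c_y t ^ 2) * / 4).
  assert (hf : bigO (near_0 m) c_eps 2 f) by (unfold f; bigO_tac).
  pose proof (bigO_taylor eps_small 2 (fun x => / (1 + x) - (1 - x)) f inv_taylor
    ltac:(lia) hf) as h.
  cbv beta in h; change (2 + 2)%nat with 4%nat in h.
  apply (bigO_ext _ (fun t => (/ (1 + f t) - (1 - f t))
      * ((/ (1 + f t) - (1 - f t)) + 2 * (1 - f t)) + f t ^ 2)).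
  - apply filter_forall; intros t.
    unfold conf, rho, Rdiv; fold (f t).
    replace (k * / 2 * (c_x t ^ 2 + c_y t ^ 2)) with (2 * f t) by (unfold f; field).
    ring.
  - bigO_tac.
Qed.

Variables (u : R -> R -> R) (r : R).
Hypothesis hr : 0 < r.
Hypothesis u_horoconvex : horoconvex r u.
Hypothesis u_second_order : second_order a b c u.

Definition chart_pt (X Y : R) : E3 := graph_pt u (coord1 X Y) (coord2 X Y).

Let step t := hdist (chart_pt (c_x t) (c_y t))
  (chart_pt (c_x t + c_s t * c_v t) (c_y t + c_s t * c_w t)).

Let ratio t := chord (graph_pt u (x t) (y t))
  (graph_pt u (x t + c_s t * p1 t) (y t + c_s t * p2 t)) / c_s t ^ 2.

Lemma near_0_s_pos : near_0 m (fun t => 0 < c_s t).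
Proof. apply near_0_all; intros t _ _ _ h; lra. Qed.

Lemma ratio_crude : bigO (near_0 m) c_eps 2 (fun t => ratio t - 1).
Proof.
  pose proof (chord_crude eps_small u r a b c hr u_horoconvex u_second_order m x y
    p1 p2 c_s hm x_bigO y_bigO p1_bigO p2_bigO os near_0_s_pos) as h1.
  pose proof speed_crude as h2.
  apply (bigO_ext _ (fun t => (ratio t - (p1 t ^ 2 + p2 t ^ 2))
    + (p1 t ^ 2 + p2 t ^ 2 - 1))).
  - apply filter_forall; intros t; ring.
  - bigO_tac.
Qed.

Lemma step_ratio : bigO (near_0 m) c_eps (m + m) (fun t => step t ^ 2 / c_s t ^ 2 - ratio t).
Proof.
  pose proof ratio_crude as h.
  assert (h0 : bigO (near_0 m) c_eps (m + m) (fun t =>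
    c_s t ^ 2 * ((ratio t - 1) + 1) ^ 2)) by bigO_tac.
  destruct h0 as [C hC]; exists C.
  generalize (filter_and _ _ hC near_0_s_pos); apply filter_imp; intros t [h1 h2].
  refine (Rle_trans _ _ _ _ h1).
  assert (hp : forall X Y, H3 (chart_pt X Y)) by (intros; apply exp_pos).
  pose proof (hdist2_chord _ _ (hp (c_x t) (c_y t))
    (hp (c_x t + c_s t * c_v t) (c_y t + c_s t * c_w t))) as hd.
  fold (step t) in hd.
  set (ch := chord _ _) in hd.
  assert (E : ratio t = ch / c_s t ^ 2).
  { unfold ratio, ch, chart_pt; rewrite coord1_step, coord2_step; reflexivity. }
  assert (hs2 : 0 < c_s t ^ 2) by now apply pow_lt.
  replace (ratio t - 1 + 1) with (ratio t) by ring.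
  rewrite E.
  replace (step t ^ 2 / c_s t ^ 2 - ch / c_s t ^ 2)
    with ((step t ^ 2 - ch) * / c_s t ^ 2) by (field; lra).
  replace (c_s t ^ 2 * (ch / c_s t ^ 2) ^ 2) with (ch ^ 2 * / c_s t ^ 2)
    by (field; lra).
  assert (hi : 0 < / c_s t ^ 2) by now apply Rinv_0_lt_compat.
  rewrite !Rabs_mult, (Rabs_pos_eq (/ c_s t ^ 2)) by lra.
  apply Rmult_le_compat_r; [lra|].
  rewrite (Rabs_pos_eq (ch ^ 2)) by apply pow2_ge_0.
  pose proof (pow2_ge_0 ch); lra.
Qed.

Lemma step_crude : bigO (near_0 m) c_eps 2 (fun t => step t ^ 2 / c_s t ^ 2 - 1).
Proof.
  pose proof step_ratio as h1; pose proof ratio_crude as h2.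
  apply (bigO_ext _ (fun t => (step t ^ 2 / c_s t ^ 2 - ratio t) + (ratio t - 1))).
  - apply filter_forall; intros t; ring.
  - bigO_tac.
Qed.

Lemma step_fine : (3 <= m)%nat -> litO (near_0 m) c_eps 2
  (fun t => step t ^ 2 / c_s t ^ 2 - conf k (c_x t) (c_y t) ^ 2).
Proof.
  intros hm3.
  assert (hm2 : (2 <= m)%nat) by lia.
  pose proof (chord_fine eps_small u r a b c hr u_horoconvex u_second_order m x y
    p1 p2 c_s hm x_bigO y_bigO p1_bigO p2_bigO os near_0_s_pos hm2) as h1.
  pose proof (metric_expansion hm3) as h2; pose proof conf_expansion as h3.
  pose proof step_ratio as h4.
  pose (E := fun t => (p1 t ^ 2 + p2 t ^ 2) * (1 + quad a b c (x t) (y t))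
    + bilin a b c (x t) (y t) (p1 t) (p2 t) ^ 2).
  pose (N := fun t => 1 - k / 2 * (c_x t ^ 2 + c_y t ^ 2)).
  change (bigO (near_0 m) c_eps 3 (fun t => E t - N t)) in h2.
  change (bigO (near_0 m) c_eps 4 (fun t => conf k (c_x t) (c_y t) ^ 2 - N t)) in h3.
  apply (litO_ext _ (fun t => (ratio t - E t) + ((step t ^ 2 / c_s t ^ 2 - ratio t)
    + ((E t - N t) - (conf k (c_x t) (c_y t) ^ 2 - N t))))).
  - apply filter_forall; intros t; ring.
  - apply litO_plus; [exact h1|].
    apply (litO_of_bigO eps_small 2 3); [lia|].
    bigO_tac.
Qed.

End Expansion.

Variables (u : R -> R -> R) (r : R).
Hypothesis hr : 0 < r.
Hypothesis u_horoconvex : horoconvex r u.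
Hypothesis u_second_order : second_order a b c u.

Lemma config_of_points X Y X' Y' e : 0 < eucl (X' - X) (Y' - Y) ->
  let s := eucl (X' - X) (Y' - Y) in
  let t := Config e X Y ((X' - X) / s) ((Y' - Y) / s) s in
  c_v t ^ 2 + c_w t ^ 2 = 1 /\ X + s * c_v t = X' /\ Y + s * c_w t = Y'.
Proof.
  intros h s t; simpl.
  assert (hs : s ^ 2 = (X' - X) ^ 2 + (Y' - Y) ^ 2) by apply eucl_sqr.
  fold s in h; split; [|split; field; lra].
  transitivity (s ^ 2 / s ^ 2); [rewrite hs at 1; field; lra|field; lra].
Qed.

Lemma chart_crude : exists e, 0 < e /\ forall X Y X' Y',
  eucl X Y <= e -> eucl X' Y' <= e ->
  eucl (X' - X) (Y' - Y) <= 4 * hdist (chart_pt u X Y) (chart_pt u X' Y') /\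
  hdist (chart_pt u X Y) (chart_pt u X' Y') <= 4 * eucl (X' - X) (Y' - Y).
Proof.
  pose proof (step_crude 1 (le_n 1) u r hr u_horoconvex u_second_order) as h.
  apply (litO_of_bigO (near_0_eps 1) 0 2 _ ltac:(lia)) in h.
  assert (hq : 0 < / 2) by lra.
  destruct (h (/ 2) hq) as (e0 & he0 & hb).
  exists (e0 / 2); split; [lra|]; intros X Y X' Y' h1 h2.
  destruct (eucl_nonneg (X' - X) (Y' - Y)) as [hs|hs].
  2: { symmetry in hs; rewrite hs; apply eucl_eq_0 in hs as [e1 e2].
       replace X' with X by lra; replace Y' with Y by lra.
       rewrite hdist_refl; lra. }
  pose proof (config_of_points X Y X' Y' (e0 / 2) hs) as (g1 & g2 & g3).
  simpl c_v in *; simpl c_w in *.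
  specialize (hb (Config (e0 / 2) X Y ((X' - X) / eucl (X' - X) (Y' - Y))
    ((Y' - Y) / eucl (X' - X) (Y' - Y)) (eucl (X' - X) (Y' - Y)))).
  cbn [c_eps c_x c_y c_v c_w c_s] in hb.
  rewrite g2, g3 in hb.
  pose proof (eucl_triangle X' Y' (- X) (- Y)) as tr; rewrite eucl_opp in tr.
  set (s := eucl (X' - X) (Y' - Y)) in *.
  specialize (hb ltac:(lra) h1 g1 ltac:(unfold s, Rminus in *; lra)).
  pose proof (hdist_nonneg (chart_pt u X Y) (chart_pt u X' Y')) as d0.
  set (d := hdist _ _) in *.
  assert (hs2 : 0 < s ^ 2) by now apply pow_lt.
  rewrite Rmult_1_r in hb; apply Rabs_le_between in hb as [b1 b2].
  assert (E : d ^ 2 / s ^ 2 * s ^ 2 = d ^ 2) by (field; lra).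
  split; apply sqr_le_inv; try lra; nra.
Qed.

Lemma chart_fine eta : 0 < eta -> exists e0, 0 < e0 /\ forall e, 0 < e < e0 ->
  forall X Y X' Y', eucl X Y <= e -> eucl (X' - X) (Y' - Y) <= e ^ 3 ->
  Rabs (hdist (chart_pt u X Y) (chart_pt u X' Y') ^ 2
        - conf k X Y ^ 2 * eucl (X' - X) (Y' - Y) ^ 2)
    <= eta * e ^ 2 * eucl (X' - X) (Y' - Y) ^ 2.
Proof.
  intros heta.
  assert (h13 : (1 <= 3)%nat) by lia.
  destruct (step_fine 3 h13 u r hr u_horoconvex u_second_order (le_n 3) eta heta)
    as (e0 & he0 & hb).
  exists e0; split; [assumption|]; intros e he X Y X' Y' h1 h2.
  destruct (eucl_nonneg (X' - X) (Y' - Y)) as [hs|hs].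
  2: { symmetry in hs; rewrite hs; apply eucl_eq_0 in hs as [e1 e2].
       replace X' with X by lra; replace Y' with Y by lra.
       rewrite hdist_refl.
       replace (0 ^ 2 - conf k X Y ^ 2 * 0 ^ 2) with 0 by ring.
       rewrite Rabs_R0; lra. }
  pose proof (config_of_points X Y X' Y' e hs) as (g1 & g2 & g3).
  simpl c_v in *; simpl c_w in *.
  specialize (hb (Config e X Y ((X' - X) / eucl (X' - X) (Y' - Y))
    ((Y' - Y) / eucl (X' - X) (Y' - Y)) (eucl (X' - X) (Y' - Y)))).
  cbn [c_eps c_x c_y c_v c_w c_s] in hb.
  rewrite g2, g3 in hb.
  set (s := eucl (X' - X) (Y' - Y)) in *.
  assert (he3 : 0 < e ^ 3) by (apply pow_lt; lra).
  specialize (hb he h1 g1 ltac:(lra)).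
  set (d := hdist _ _) in *.
  assert (hs2 : 0 < s ^ 2) by now apply pow_lt.
  replace (d ^ 2 - conf k X Y ^ 2 * s ^ 2)
    with ((d ^ 2 / s ^ 2 - conf k X Y ^ 2) * s ^ 2) by (field; lra).
  rewrite Rabs_mult, (Rabs_pos_eq (s ^ 2)) by lra.
  apply Rmult_le_compat_r; lra.
Qed.

(** On the interval of radius [2 t] the cubic term is smaller than [t], so that the
    intermediate value theorem applies. *)
Lemma cubic_solve a0 a1 a2 a3 : exists t0, 0 < t0 /\
  forall t p z, 0 < t <= t0 -> Rabs p <= 2 * t -> Rabs z <= t ->
    exists w, Rabs w <= 2 * t /\ w + cubic a0 a1 a2 a3 w p = z.
Proof.
  pose (M := Rabs a0 + Rabs a1 + Rabs a2 + Rabs a3).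
  assert (hM : 0 <= M).
  { unfold M; pose proof (Rabs_pos a0); pose proof (Rabs_pos a1).
    pose proof (Rabs_pos a2); pose proof (Rabs_pos a3); lra. }
  assert (bound : forall t v w, 0 < t -> Rabs v <= 2 * t -> Rabs w <= 2 * t ->
    Rabs (cubic a0 a1 a2 a3 v w) <= M * (8 * t ^ 3)).
  { intros t v w ht hv hw.
    assert (mono : forall i j, (i + j = 3)%nat -> Rabs v ^ i * Rabs w ^ j <= 8 * t ^ 3).
    { intros i j hij; replace (8 * t ^ 3) with ((2 * t) ^ 3) by ring.
      rewrite <- hij, pow_add.
      apply Rmult_le_compat; try (apply pow_le, Rabs_pos);
        apply pow_incr; split; (apply Rabs_pos || assumption). }
    assert (term : forall a i j, (i + j = 3)%nat ->
      Rabs (a * (v ^ i * w ^ j)) <= Rabs a * (8 * t ^ 3)).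
    { intros a' i j hij; rewrite !Rabs_mult, <- !RPow_abs.
      apply Rmult_le_compat_l; [apply Rabs_pos|now apply mono]. }
    pose proof (term a0 3%nat 0%nat eq_refl) as t1.
    pose proof (term a1 2%nat 1%nat eq_refl) as t2.
    pose proof (term a2 1%nat 2%nat eq_refl) as t3.
    pose proof (term a3 0%nat 3%nat eq_refl) as t4.
    replace (cubic a0 a1 a2 a3 v w) with
      (a0 * (v ^ 3 * w ^ 0) + a1 * (v ^ 2 * w ^ 1) + a2 * (v ^ 1 * w ^ 2)
       + a3 * (v ^ 0 * w ^ 3)) by (unfold cubic; ring).
    unfold M; rewrite !Rmult_plus_distr_r.
    do 3 (eapply Rle_trans; [apply Rabs_triang|];
      apply Rplus_le_compat; [|assumption]).
    assumption. }
  exists (Rmin 1 (/ (8 * (M + 1)))); split.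
  { apply Rmin_glb_lt; [lra|apply Rinv_0_lt_compat; lra]. }
  intros t p z [ht ht0] hp hz.
  pose proof (Rle_trans _ _ _ ht0 (Rmin_l _ _)) as l1.
  pose proof (Rle_trans _ _ _ ht0 (Rmin_r _ _)) as l2.
  assert (small : M * (8 * t ^ 3) <= t).
  { apply (Rmult_le_compat_l (8 * (M + 1))) in l2; [|lra].
    rewrite Rinv_r in l2 by lra.
    replace (M * (8 * t ^ 3)) with (8 * M * t * t * t) by ring.
    assert (8 * M * t <= 1) by nra.
    assert (8 * M * t * t <= 1) by nra.
    nra. }
  pose proof (bound t (2 * t) p ht ltac:(rewrite Rabs_pos_eq; lra) hp) as b1.
  pose proof (bound t (- (2 * t)) p ht ltac:(rewrite Rabs_Ropp, Rabs_pos_eq; lra) hp)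
    as b2.
  apply Rabs_le_between in b1, b2, hz.
  pose (phi := fun w => w + cubic a0 a1 a2 a3 w p).
  destruct (IVT_gen phi (- (2 * t)) (2 * t) z) as (w & hw & E).
  - unfold phi, cubic; intros w; apply derivable_continuous_pt.
    apply ex_derive_Reals_0; auto_derive; exact I.
  - rewrite Rmin_left, Rmax_right by (unfold phi; lra); unfold phi; lra.
  - rewrite Rmin_left, Rmax_right in hw by lra.
    exists w; split; [apply Rabs_le; lra|exact E].
Qed.

Lemma coord_onto e : 0 < e -> exists d, 0 < d /\ forall x y, eucl x y <= d ->
  exists X Y, eucl X Y < e /\ coord1 X Y = x /\ coord2 X Y = y.
Proof.
  intros he.
  destruct (cubic_solve (- (k / 2 + c + c ^ 2) / 6) (- (b + b * c) / 2)
    (- (k / 2 + a + b ^ 2) / 2) (- (a * b - b) / 6)) as (t2 & ht2 & s2).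
  destruct (cubic_solve (- (k / 2 + a + a ^ 2) / 6) (- (b + a * b) / 2)
    (- (k / 2 + c + b ^ 2) / 2) (- (b * c - b) / 6)) as (t1 & ht1 & s1).
  pose (d := Rmin (e / 8) (Rmin t1 t2)).
  assert (hd : 0 < d) by (unfold d; repeat apply Rmin_glb_lt; lra).
  assert (d1 : d <= e / 8) by apply Rmin_l.
  assert (d2 : d <= t1) by (eapply Rle_trans; [apply Rmin_r|apply Rmin_l]).
  assert (d3 : d <= t2) by (eapply Rle_trans; [apply Rmin_r|apply Rmin_r]).
  exists d; split; [assumption|]; intros x y hxy.
  pose proof (Rabs_le_eucl_l x y); pose proof (Rabs_le_eucl_r x y).
  destruct (s2 d x y) as (Y & hY & EY); [lra..|].
  destruct (s1 d Y x) as (X & hX & EX); [lra..|].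
  exists X, Y; split; [eapply Rle_lt_trans; [apply eucl_le_Rabs|lra]|].
  assert (E1 : coord1 X Y = x) by exact EX.
  split; [assumption|].
  unfold coord2; rewrite E1, <- EY; unfold cubic2, cubic; ring.
Qed.

Lemma coord_small e : 0 < e -> exists d, 0 < d /\ forall X Y, eucl X Y < d ->
  eucl (coord1 X Y) (coord2 X Y) < e.
Proof.
  intros he.
  destruct (bigO_in_disc (near_0_eps 1) _ _ (x_bigO 1 (le_n 1))
    (y_bigO 1 (le_n 1)))
    as (C & hC & e0 & he0 & h).
  exists (Rmin e0 (e / C)); split.
  { apply Rmin_glb_lt; [assumption|now apply Rdiv_lt_0_compat]. }
  intros X Y hXY.
  pose proof (Rlt_le_trans _ _ _ hXY (Rmin_l _ _)) as l1.
  pose proof (Rlt_le_trans _ _ _ hXY (Rmin_r _ _)) as l2.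
  pose proof (eucl_nonneg X Y) as n.
  pose (d := (eucl X Y + Rmin e0 (e / C)) / 2).
  pose proof (Rmin_l e0 (e / C)); pose proof (Rmin_r e0 (e / C)).
  assert (dC : d < e / C) by (unfold d; lra).
  assert (hd : 0 < d < e0) by (unfold d; lra).
  specialize (h (Config d X Y 1 0 d)); cbn [c_eps c_x c_y c_v c_w c_s] in h.
  eapply Rle_lt_trans; [apply h; [exact hd|unfold d; lra|ring|lra]|].
  apply (Rmult_lt_compat_l C) in dC; [|assumption].
  replace (C * (e / C)) with e in dC by (field; lra).
  exact dC.
Qed.

End Coordinates.

(** * The chart at a normal point *)

Lemma conf_sqr_lipschitz k e x y x' y' : 0 <= e -> eucl x y <= e -> eucl x' y' <= e ->
  / 2 <= conf k x y <= 2 -> / 2 <= conf k x' y' <= 2 ->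
  Rabs (conf k x' y' ^ 2 - conf k x y ^ 2)
    <= 32 * Rabs k * e * eucl (x' - x) (y' - y).
Proof.
  intros he h1 h2 c1 c2.
  assert (rho_inv : forall x y, / 2 <= conf k x y <= 2 ->
    rho k x y * conf k x y = 1 /\ 0 < rho k x y <= 2).
  { unfold conf; intros v w h.
    assert (E : rho k v w * / rho k v w = 1).
    { apply Rinv_r; intros E; rewrite E, Rinv_0 in h; lra. }
    split; [assumption|split; nra]. }
  destruct (rho_inv _ _ c1) as [e1 b1]; destruct (rho_inv _ _ c2) as [e2 b2].
  set (g := conf k x y) in *; set (g' := conf k x' y') in *.
  replace (g' ^ 2 - g ^ 2)
    with ((rho k x y - rho k x' y') * (rho k x y + rho k x' y') * (g * g') ^ 2).
  2: { transitivity ((rho k x y * g) ^ 2 * g' ^ 2 - (rho k x' y' * g') ^ 2 * g ^ 2);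
       [ring|rewrite e1, e2; ring]. }
  assert (hd : Rabs (rho k x y - rho k x' y') <= Rabs k / 2 * e * eucl (x' - x) (y' - y)).
  { replace (rho k x y - rho k x' y')
      with (k * ((eucl x y - eucl x' y') * ((eucl x y + eucl x' y') / 4))).
    2: { transitivity (k * ((eucl x y ^ 2 - eucl x' y' ^ 2) / 4)); [field|].
         rewrite !eucl_sqr; unfold rho; field. }
    pose proof (eucl_diff_le x y x' y'); pose proof (eucl_diff_le x' y' x y) as t.
    rewrite (eucl_sub_sym x y) in t.
    pose proof (eucl_nonneg x y); pose proof (eucl_nonneg x' y').
    rewrite !Rabs_mult, (Rabs_pos_eq ((eucl x y + eucl x' y') / 4)) by lra.
    replace (Rabs k / 2 * e * eucl (x' - x) (y' - y))
      with (Rabs k * (eucl (x' - x) (y' - y) * (e / 2))) by field.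
    apply Rmult_le_compat_l; [apply Rabs_pos|].
    apply Rmult_le_compat; [apply Rabs_pos|lra|apply Rabs_le; lra|lra]. }
  rewrite !Rabs_mult, (Rabs_pos_eq (rho k x y + _)) by lra.
  rewrite (Rabs_pos_eq ((g * g') ^ 2)) by apply pow2_ge_0.
  assert (hg : 0 <= g * g' <= 4) by nra.
  assert (hg2 : (g * g') ^ 2 <= 16) by nra.
  replace (32 * Rabs k * e * eucl (x' - x) (y' - y))
    with (Rabs k / 2 * e * eucl (x' - x) (y' - y) * 4 * 16) by field.
  pose proof (Rabs_pos (rho k x y - rho k x' y')).
  apply Rmult_le_compat; [|apply pow2_ge_0| |assumption].
  - apply Rmult_le_pos; lra.
  - apply Rmult_le_compat; lra.
Qed.

Lemma sqr_ratio_bound p q t : 0 <= p -> 0 <= q -> 0 <= t ->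
  p ^ 2 <= (1 + t) * q ^ 2 -> p <= (1 + t) * q.
Proof.
  intros hp hq ht h; apply sqr_le_inv; [apply Rmult_le_pos; lra|].
  apply Rle_trans with (1 := h).
  rewrite Rpow_mult_distr; apply Rmult_le_compat_r; [apply pow2_ge_0|nra].
Qed.

Lemma disc_radius k e : 0 < e -> exists r, 0 < r <= e /\
  forall x y, in_disc r x y -> 0 < rho k x y /\ / 2 <= conf k x y <= 2.
Proof.
  intros he.
  pose proof (Rabs_pos k) as hk.
  exists (Rmin e (/ (Rabs k + 1))); split.
  { split; [|apply Rmin_l].
    apply Rmin_glb_lt; [assumption|apply Rinv_0_lt_compat; lra]. }
  intros x y h.
  assert (hr : Rmin e (/ (Rabs k + 1)) <= / (Rabs k + 1)) by apply Rmin_r.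
  assert (hr0 : 0 < Rmin e (/ (Rabs k + 1)))
    by (apply Rmin_glb_lt; [assumption|apply Rinv_0_lt_compat; lra]).
  set (r := Rmin e (/ (Rabs k + 1))) in *.
  assert (h1 : (Rabs k + 1) * r <= 1).
  { apply (Rmult_le_compat_l (Rabs k + 1)) in hr; [|lra].
    rewrite Rinv_r in hr; lra. }
  assert (hs : Rabs (k * (x ^ 2 + y ^ 2)) <= 1).
  { rewrite Rabs_mult, (Rabs_pos_eq (x ^ 2 + y ^ 2)) by apply sum_sqr_nonneg.
    unfold in_disc in h; pose proof (sum_sqr_nonneg x y).
    apply Rle_trans with (Rabs k * r ^ 2); [apply Rmult_le_compat_l; lra|].
    assert (r <= 1) by nra.
    assert (Rabs k * r <= 1) by nra.
    replace (Rabs k * r ^ 2) with (Rabs k * r * r) by ring; nra. }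
  apply Rabs_le_between in hs.
  assert (hrho : 3 / 4 <= rho k x y <= 5 / 4) by (unfold rho; lra).
  split; [lra|]; unfold conf; split.
  - apply Rinv_le_contravar; lra.
  - rewrite <- (Rinv_inv 2); apply Rinv_le_contravar; lra.
Qed.

Section NormalChart.

Variables (K : E3 -> Prop) (q : E3) (Phi : E3 -> E3) (r a b c : R) (u : R -> R -> R).
Hypothesis bdry_q : bdry K q.
Hypothesis Phi_isometry : isometry_H3 Phi.
Hypothesis Phi_q : Phi q = (0, 0, 1).
Hypothesis hr : 0 < r.
Hypothesis graph : locally_graph (fun p => exists p', bdry K p' /\ Phi p' = p) r u.
Hypothesis u_horoconvex : horoconvex r u.
Hypothesis u_0 : u 0 0 = 0.
Hypothesis u_second_order : second_order a b c u.

Let k := curvature a b c.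

(** [Phi] is inverted on the graph by choice, the point over [(x, y)] being unique
    because [Phi] preserves [hdist]. *)
Definition bdry_pt (x y : R) : E3 :=
  epsilon (inhabits q) (fun p => bdry K p /\ Phi p = graph_pt u x y).

Definition theta (X Y : R) : E3 := bdry_pt (coord1 a b c X Y) (coord2 a b c X Y).

Lemma bdry_H3 p : bdry K p -> H3 p.
Proof. now intros [h _]. Qed.

Lemma bdry_pt_spec x y : x ^ 2 + y ^ 2 < r ^ 2 ->
  bdry K (bdry_pt x y) /\ Phi (bdry_pt x y) = graph_pt u x y.
Proof.
  intros h; unfold bdry_pt; apply epsilon_spec.
  destruct graph as (W & _ & _ & hW).
  apply (proj2 (hW (graph_pt u x y))); exists x, y; split; [assumption|reflexivity].
Qed.

Lemma Phi_injective p p' : H3 p -> H3 p' -> Phi p = Phi p' -> p = p'.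
Proof.
  intros hp hp' E; apply hdist_eq_0; try assumption.
  destruct Phi_isometry as (_ & iso & _).
  rewrite <- iso, E by assumption; apply hdist_refl.
Qed.

Lemma hdist_theta X Y X' Y' :
  eucl (coord1 a b c X Y) (coord2 a b c X Y) < r ->
  eucl (coord1 a b c X' Y') (coord2 a b c X' Y') < r ->
  hdist (theta X Y) (theta X' Y')
    = hdist (chart_pt a b c u X Y) (chart_pt a b c u X' Y').
Proof.
  intros h h'; apply eucl_lt in h, h'; try assumption.
  destruct (bdry_pt_spec _ _ h) as [h1 h2]; destruct (bdry_pt_spec _ _ h') as [h3 h4].
  destruct Phi_isometry as (_ & iso & _).
  unfold theta; rewrite <- iso by now apply bdry_H3.
  now rewrite h2, h4.
Qed.

Lemma theta_0 : theta 0 0 = q.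
Proof.
  assert (E1 : coord1 a b c 0 0 = 0) by (unfold coord1, cubic1, cubic; ring).
  assert (E2 : coord2 a b c 0 0 = 0)
    by (unfold coord2; rewrite E1; unfold cubic2, cubic; ring).
  unfold theta; rewrite E1, E2.
  destruct (bdry_pt_spec 0 0) as [h1 h2]; [nra|].
  apply Phi_injective; try now apply bdry_H3.
  rewrite h2, Phi_q; unfold graph_pt; now rewrite u_0, Ropp_0, exp_0.
Qed.

(** Points of the boundary near [q] are sent by the isometry near [(0, 0, 1)],
    where they lie on the graph, and small parameters of the graph are reached by
    the coordinates. *)
Lemma theta_onto e : 0 < e -> exists r0, 0 < r0 /\ forall p, bdry K p ->
  hdist q p < r0 -> exists X Y, eucl X Y < e /\ theta X Y = p.
Proof.
  intros he.
  destruct (coord_onto a b c e he) as (d & hd & onto).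
  pose proof graph as (W & W_open & W_0 & hW).
  destruct (W_open _ W_0) as [e1 he1].
  destruct (hdist_small_edist (0, 0, 1) (Rmin d e1)) as (r0 & hr0 & near).
  { unfold H3, cz; simpl; lra. }
  { apply Rmin_glb_lt; [assumption|apply cond_pos]. }
  exists r0; split; [assumption|]; intros p hp hpq.
  destruct Phi_isometry as (Phi_H3 & iso & _).
  assert (hpH := bdry_H3 p hp).
  assert (dist : hdist (Phi p) (0, 0, 1) < r0).
  { rewrite <- Phi_q, iso by (assumption || now apply bdry_H3).
    now rewrite hdist_sym. }
  specialize (near _ (Phi_H3 p hpH) dist).
  assert (m1 : Rmin d e1 <= d) by apply Rmin_l.
  assert (m2 : Rmin d e1 <= e1) by apply Rmin_r.
  assert (m0 : 0 < Rmin d e1) by (apply Rmin_glb_lt; [assumption|apply cond_pos]).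
  set (m := Rmin d e1) in *.
  unfold edist2 in near; cbn [cx cy cz fst snd] in near.
  pose proof (pow2_ge_0 (cx (Phi p) - 0)) as s1.
  pose proof (pow2_ge_0 (cy (Phi p) - 0)) as s2.
  pose proof (pow2_ge_0 (cz (Phi p) - 1)) as s3.
  unfold cx, cy, cz in near, s1, s2, s3; simpl fst in *; simpl snd in *.
  assert (inW : W (Phi p)).
  { apply he1, ball_E3; unfold cx, cy, cz; simpl.
    repeat split; (apply Rlt_le_trans with m; [|assumption]);
      apply sqr_lt_inv; try lra; rewrite pow2_abs; lra. }
  destruct (proj1 (hW (Phi p)) (conj inW (ex_intro _ p (conj hp eq_refl))))
    as (x & y & hxy & E).
  rewrite E in near, s1, s2, s3; simpl in near, s1, s2, s3.
  destruct (onto x y) as (X & Y & hXY & E1 & E2).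
  { apply eucl_le; [lra|].
    apply Rle_trans with (m ^ 2); [|apply pow_incr; lra].
    simpl; rewrite !Rminus_0_r in near; simpl in near.
    lra. }
  exists X, Y; split; [assumption|].
  unfold theta; rewrite E1, E2.
  destruct (bdry_pt_spec x y hxy) as [h1 h2].
  apply Phi_injective; try now apply bdry_H3.
  now rewrite h2, E.
Qed.

Section Radius.

Variable r1 : R.
Hypothesis hr1 : 0 < r1.
Hypothesis r1_graph : forall X Y, eucl X Y < r1 ->
  eucl (coord1 a b c X Y) (coord2 a b c X Y) < r.
Hypothesis r1_conf : forall X Y, in_disc r1 X Y -> 0 < rho k X Y /\ / 2 <= conf k X Y <= 2.
Hypothesis r1_crude : forall X Y X' Y', in_disc r1 X Y -> in_disc r1 X' Y' ->
  eucl (X' - X) (Y' - Y) <= 4 * hdist (theta X Y) (theta X' Y') /\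
  hdist (theta X Y) (theta X' Y') <= 4 * eucl (X' - X) (Y' - Y).

(** The additive errors become multiplicative because the conformal factor is at
    least 1/2 and because of the crude bound; the conformal factor varies by
    [O(eps d)] at scale [d]. *)
Lemma theta_chordwise_close eta : 0 < eta -> exists eps0, 0 < eps0 /\
  forall eps, 0 < eps < eps0 -> exists d, 0 < d /\
    chordwise_close k theta eps (1 + eta * eps ^ 2) d.
Proof.
  intros he.
  assert (he1 : 0 < eta / 64) by lra.
  destruct (chart_fine a b c u r hr u_horoconvex u_second_order _ he1)
    as (e0 & he0 & fine).
  exists (Rmin e0 r1); split; [now apply Rmin_glb_lt|].
  intros e [e_pos e_lt].
  pose proof (Rlt_le_trans _ _ _ e_lt (Rmin_l _ _)) as l1.
  pose proof (Rlt_le_trans _ _ _ e_lt (Rmin_r _ _)) as l2.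
  pose proof (Rabs_pos k) as hk.
  pose (d := Rmin (e ^ 3) (eta / 64 * e / (32 * Rabs k + 1))).
  assert (hd1 : d <= e ^ 3) by apply Rmin_l.
  assert (hd2 : (32 * Rabs k + 1) * d <= eta / 64 * e).
  { replace (eta / 64 * e)
      with ((32 * Rabs k + 1) * (eta / 64 * e / (32 * Rabs k + 1))) by (field; lra).
    apply Rmult_le_compat_l; [lra|apply Rmin_r]. }
  exists d; split.
  { apply Rmin_glb_lt; [now apply pow_lt|].
    apply Rdiv_lt_0_compat; [apply Rmult_lt_0_compat|]; lra. }
  intros x y x' y' x2 y2 h h' h2 hs hs2.
  assert (inr : forall v w, eucl v w <= e -> in_disc r1 v w)
    by (intros v w hvw; apply in_disc_eucl; lra).
  pose proof (r1_crude _ _ _ _ (inr _ _ h) (inr _ _ h')) as [crude _].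
  pose proof (fine e (conj e_pos l1) x y x' y' h ltac:(lra)) as hf.
  rewrite <- hdist_theta in hf by (apply r1_graph; lra).
  pose proof (r1_conf _ _ (inr _ _ h)) as [_ c1].
  pose proof (r1_conf _ _ (inr _ _ h2)) as [_ c2].
  pose proof (conf_sqr_lipschitz k e x y x2 y2 ltac:(lra) h h2 c1 c2) as lip.
  fold k in hf.
  set (s := eucl (x' - x) (y' - y)) in *.
  set (D := hdist (theta x y) (theta x' y')) in *.
  set (g := conf k x y) in *; set (g2 := conf k x2 y2) in *.
  assert (s0 : 0 <= s) by apply eucl_nonneg.
  assert (D0 : 0 <= D) by apply hdist_nonneg.
  assert (lip' : Rabs (g2 ^ 2 - g ^ 2) <= eta / 64 * e ^ 2).
  { apply Rle_trans with (1 := lip).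
    set (s2 := eucl (x2 - x) (y2 - y)) in *.
    assert (0 <= s2) by apply eucl_nonneg.
    replace (32 * Rabs k * e * s2) with (e * (32 * Rabs k * s2)) by ring.
    replace (eta / 64 * e ^ 2) with (e * (eta / 64 * e)) by ring.
    apply Rmult_le_compat_l; [lra|].
    apply Rle_trans with ((32 * Rabs k + 1) * d); [|assumption].
    apply Rmult_le_compat; lra. }
  apply Rabs_le_between in lip', hf.
  pose proof (pow2_ge_0 s) as ss.
  assert (ep : 0 < e ^ 2) by now apply pow_lt.
  set (t := eta / 64 * e ^ 2) in *.
  assert (t0 : 0 < t) by now apply Rmult_lt_0_compat.
  assert (diff : - (2 * t * s ^ 2) <= D ^ 2 - g2 ^ 2 * s ^ 2 <= 2 * t * s ^ 2).
  { assert (- (t * s ^ 2) <= (g2 ^ 2 - g ^ 2) * s ^ 2 <= t * s ^ 2) by (split; nra).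
    lra. }
  replace (1 + eta * e ^ 2) with (1 + 64 * t) by (unfold t; field).
  assert (g2s : (g2 * s) ^ 2 = g2 ^ 2 * s ^ 2) by ring.
  assert (g24 : s ^ 2 <= 4 * (g2 * s) ^ 2).
  { rewrite g2s; assert (1 <= 4 * g2 ^ 2) by nra.
    rewrite <- Rmult_assoc, <- (Rmult_1_l (s ^ 2)) at 1.
    now apply Rmult_le_compat_r. }
  assert (sD : s ^ 2 <= 16 * D ^ 2).
  { replace (16 * D ^ 2) with ((4 * D) ^ 2) by ring; apply pow_incr; lra. }
  pose proof (Rmult_le_compat_l t _ _ (Rlt_le _ _ t0) g24) as b1.
  pose proof (Rmult_le_compat_l t _ _ (Rlt_le _ _ t0) sD) as b2.
  assert (0 <= t * (g2 * s) ^ 2).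
  { apply Rmult_le_pos; [lra|apply pow2_ge_0]. }
  assert (0 <= t * D ^ 2) by (apply Rmult_le_pos; [lra|apply pow2_ge_0]).
  rewrite <- g2s in diff.
  split; apply sqr_ratio_bound; try lra.
  - apply Rmult_le_pos; lra.
  - apply Rmult_le_pos; lra.
Qed.

End Radius.

Theorem normal_point_biLipschitz :
  exists S : surface,
    smooth_riemannian_surface S /\ has_constant_curvature S k /\
    exists rem : R -> R,
      filterlim (fun eps => rem eps / eps ^ 2) (at_right 0) (locally 0) /\
      exists eps0 : R, 0 < eps0 /\
        forall eps, 0 < eps < eps0 ->
          exists U : carrier S -> Prop,
            open_in S U /\
            biLipschitz_lt (bdry_ball K q eps) (intrinsic_dist (bdry K))
                           U (riemannian_dist S) (1 + rem eps).
Proof.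
  destruct (chart_crude a b c u r hr u_horoconvex u_second_order) as (e1 & he1 & crude).
  destruct (coord_small a b c r hr) as (e2 & he2 & small).
  destruct (disc_radius k (Rmin e1 e2)) as (r1 & [hr1 hr1'] & hconf).
  { now apply Rmin_glb_lt. }
  pose proof (Rle_trans _ _ _ hr1' (Rmin_l _ _)) as l1.
  pose proof (Rle_trans _ _ _ hr1' (Rmin_r _ _)) as l2.
  assert (r1_graph : forall X Y, eucl X Y < r1 ->
    eucl (coord1 a b c X Y) (coord2 a b c X Y) < r).
  { intros X Y h; apply small; lra. }
  assert (r1_crude : forall X Y X' Y', in_disc r1 X Y -> in_disc r1 X' Y' ->
    eucl (X' - X) (Y' - Y) <= 4 * hdist (theta X Y) (theta X' Y') /\
    hdist (theta X Y) (theta X' Y') <= 4 * eucl (X' - X) (Y' - Y)).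
  { intros X Y X' Y' h h'; apply in_disc_eucl in h, h'; try assumption.
    rewrite hdist_theta by now apply r1_graph.
    apply crude; lra. }
  assert (rho_pos : forall x y, in_disc r1 x y -> 0 < rho k x y).
  { intros x y h; now apply hconf. }
  destruct (theta_onto r1 hr1) as (r0 & hr0 & onto).
  exists (disc_surface k r1 hr1).
  split; [now apply disc_surface_smooth|].
  split; [now apply disc_surface_curvature|].
  apply (biLipschitz_of_chart (bdry K) q k r1 r0 theta); try assumption.
  - exact bdry_H3.
  - intros x y h; now apply hconf.
  - intros x y h; apply bdry_pt_spec, eucl_lt; [assumption|].
    apply r1_graph; now apply in_disc_eucl.
  - apply theta_0.
  - intros p hp hpq; destruct (onto p hp hpq) as (X & Y & hXY & E).
    exists X, Y; split; [now apply in_disc_eucl|assumption].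
  - intros eta he; now apply (theta_chordwise_close r1).
Qed.

End NormalChart.

Theorem corollary9 :
  forall (K : E3 -> Prop) (q : E3),
    (forall p, K p -> H3 p) ->
    compact_set (T := prod_UniformSpace _ _) K ->
    hconvex K ->
    (exists p, interior_pt K p) ->
    bdry K q ->
    normal_pt K q ->
    exists (k : R) (S : surface),
      smooth_riemannian_surface S /\ has_constant_curvature S k /\
      exists rem : R -> R,
        filterlim (fun eps => rem eps / eps ^ 2) (at_right 0) (locally 0) /\
        exists eps0 : R, 0 < eps0 /\
          forall eps, 0 < eps < eps0 ->
            exists U : carrier S -> Prop,
              open_in S U /\
              biLipschitz_lt (bdry_ball K q eps) (intrinsic_dist (bdry K))
                             U (riemannian_dist S) (1 + rem eps).
Proof.
  intros K q _ _ _ _ hq (_ & Phi & r & u & (iso & Phi_q & _) & hr & graph & horo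
    & u0 & _ & (a & b & c & second)).
  exists (curvature a b c).
  now apply (normal_point_biLipschitz K q Phi r a b c u).
Qed.
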